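(* Let $\alpha$ be a $2\pi$-periodic one-parameter automorphism group of a unital $C^*$-algebra $\mathcal{A}$ such that the induced $\mathbb{T}$-action $\gamma$ (with $\alpha_t=\gamma_{e^{it}}$) is full, and assume that $\mathcal{A}^0$ has a tracial state. Let $s'$ be the operator on $\mathcal{T}(\mathcal{A}^0)$ given by $s'(\tau)(a)=\tau(\sum_jx_j^*ax_j)$. Then the set of inverse temperatures $\beta\in\mathbb{R}$ of KMS states of $(\mathcal{A},\alpha)$ is a closed subset of the interval $[\log r_{\min}(s'),\log r_{\max}(s')]$ containing its two extreme points.
   Context: For $k\in\mathbb{Z}$, $\mathcal{A}^k=\{a\in\mathcal{A}:\gamma_z(a)=z^ka\ \forall z\in\mathbb{T}\}$. The action $\gamma$ is full if for every $k\in\mathbb{Z}$ the closed linear span of $\{xy:x\in\mathcal{A}^k,y\in\mathcal{A}^{-k}\}$ equals $\mathcal{A}^0$. A state $\omega$ of $\mathcal{A}$ is a KMS state at inverse temperature $\beta\in\mathbb{R}$ if $\omega(a\alpha_{i\beta}(b))=\omega(ba)$ for all $a,b$ in a dense $*$-subalgebra of entire elements for $\alpha$ (equivalently, for all $a,b$ in the linear span of the spaces $\mathcal{A}^k$, $k\in\mathbb{Z}$). $\mathcal{T}(\mathcal{A}^0)$ is the Banach space of bounded trace functionals on $\mathcal{A}^0$. By fullness there are finite subsets $\{x_j\}\subset\mathcal{A}^1$ with $\sum_jx_jx_j^*=I$; the operator $s'$ on $\mathcal{T}(\mathcal{A}^0)$, $s'(\tau)(a)=\tau(\sum_jx_j^*ax_j)$,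 does not depend on the choice of $\{x_j\}$ and is invertible. $r_{\max}(s')$ and $r_{\min}(s')$ are the maximum and the minimum of $|\lambda|$ over the spectrum of $s'$. *)

(* Defs.v *)
From HB Require Import structures.
From mathcomp Require Import all_boot all_order all_algebra.
From mathcomp Require Import complex.
From mathcomp Require Import boolp classical_sets functions set_interval reals.
From mathcomp Require Import topology normedtype sequences exp trigo.

Set Implicit Arguments.
Unset Strict Implicit.
Unset Printing Implicit Defensive.

Import Order.TTheory GRing.Theory Num.Theory.
Import numFieldNormedType.Exports.

Local Open Scope classical_set_scope.
Local Open Scope ring_scope.
Local Open Scope complex_scope.

(* Unital C*-algebras over R[i]; the zero algebra is excluded.  The product is
   not that of a MathComp ring because a ring that is also a normed module has
   no common superstructure with [numDomainType], which the hierarchy requires.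
   As for any [normedModType R[i]], the norm takes its values in the
   nonnegative reals of R[i]. *)
HB.mixin Record isCStarAlgebra (R : realType) A
    of CompleteNormedModule R[i] A := {
  cmul : A -> A -> A ;
  cone : A ;
  star : A -> A ;
  cmulA : associative cmul ;
  cmul1l : left_id cone cmul ;
  cmul1r : right_id cone cmul ;
  cmulPl : forall (c : R[i]) (a b d : A),
    cmul (c *: a + b) d = c *: cmul a d + cmul b d ;
  cmulPr : forall (c : R[i]) (a b d : A),
    cmul d (c *: a + b) = c *: cmul d a + cmul d b ;
  cone_neq0 : cone != 0 ;
  starK : involutive star ;
  starP : forall (c : R[i]) (a b : A),
    star (c *: a + b) = c^* *: star a + star b ;
  starM : forall a b : A, star (cmul a b) = cmul (star b) (star a) ;
  ler_norm_cmul : forall a b : A, `|cmul a b| <= `|a| * `|b| ;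
  norm_star_cmul : forall a : A, `|cmul (star a) a| = `|a| ^+ 2
}.

#[short(type="cstarAlgType")]
HB.structure Definition CStarAlgebra (R : realType) :=
  {A of CompleteNormedModule R[i] A & isCStarAlgebra R A}.

Declare Scope cstar_scope.
Delimit Scope cstar_scope with cstar.
Notation "a ** b" := (cmul a b) (at level 40, left associativity) : cstar_scope.
Local Open Scope cstar_scope.

Section linear_span.
Context (K : pzRingType) (V : lmodType K).

Definition linear_span (S : set V) : set V :=
  [set v | exists n (c : 'I_n -> K) (u : 'I_n -> V),
    (forall i, S (u i)) /\ v = \sum_(i < n) c i *: u i].

End linear_span.

Section circle_actions.
Context (R : realType) (A : cstarAlgType R).
Implicit Types (alpha : R -> A -> A) (gamma : R[i] -> A -> A).

Definition star_automorphism (f : A -> A) : Prop :=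
  [/\ linear f,
      {morph f : a b / a ** b},
      f cone = cone,
      {morph f : a / star a}
    & bijective f].

Definition automorphism_group alpha : Prop :=
  [/\ forall t, star_automorphism (alpha t),
      forall a, alpha 0 a = a,
      forall s t a, alpha (s + t) a = alpha s (alpha t a)
    & forall a, continuous (fun t => alpha t a)].

Definition periodic_2pi alpha : Prop :=
  forall t a, alpha (t + 2 * pi) a = alpha t a.

Definition expi (t : R) : R[i] := cos t +i* sin t.

(* Only the values of [gamma] on the unit circle are constrained. *)
Definition induces_circle_action alpha gamma : Prop :=
  forall t a, alpha t a = gamma (expi t) a.

Definition spectral_subspace gamma (k : int) : set A :=
  [set a | forall z : R[i], `|z| = 1 -> gamma z a = z ^ k *: a].

Definition full_action gamma : Prop :=
  forall k : int,
    closure (linear_span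
      [set a | exists x y, [/\ spectral_subspace gamma k x,
                               spectral_subspace gamma (- k) y & a = x ** y]])
    = spectral_subspace gamma 0.

(* [F] is the extension z |-> alpha_z(b) of t |-> alpha_t(b) to an entire
   function, i.e., to the sum of an everywhere convergent power series. *)
Definition entire_extension alpha (b : A) (F : R[i] -> A) : Prop :=
  (exists c : nat -> A, forall z : R[i],
     series (fun n => z ^+ n *: c n) @ \oo --> F z) /\
  (forall t : R, F t%:C = alpha t b).

Definition state (omega : A -> R[i]) : Prop :=
  [/\ forall (c : R[i]) a b, omega (c *: a + b) = c * omega a + omega b,
      forall a, 0 <= omega (star a ** a)
    & omega cone = 1].

(* The linear span of the spectral subspaces is a dense alpha-invariant
   *-subalgebra of entire elements; F (0 +i* beta) is alpha_{i beta}(b). *)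
Definition KMS_state alpha gamma (beta : R) (omega : A -> R[i]) : Prop :=
  state omega /\
  forall a b,
    linear_span (\bigcup_k spectral_subspace gamma k) a ->
    linear_span (\bigcup_k spectral_subspace gamma k) b ->
    exists2 F, entire_extension alpha b F
      & omega (a ** F (0 +i* beta)) = omega (b ** a).

Definition inverse_temperatures alpha gamma : set R :=
  [set beta | exists omega, KMS_state alpha gamma beta omega].

End circle_actions.

(* In this section B stands for a unital C*-subalgebra of A.  A functional on
   B is encoded as a function on A that vanishes outside B, so that functionals
   that agree on B are equal; [bounded_trace B] is then the Banach space of
   bounded complex-linear trace functionals on B, with pointwise operations and
   the norm [trace_norm B]. *)
Section trace_functionals.
Context (R : realType) (A : cstarAlgType R) (B : set A).
Implicit Types (tau : A -> R[i]) (L S : (A -> R[i]) -> A -> R[i]).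

Definition bounded_trace : set (A -> R[i]) :=
  [set tau |
    [/\ forall a, ~ B a -> tau a = 0,
        forall (c : R[i]) a b, B a -> B b ->
          tau (c *: a + b) = c * tau a + tau b,
        exists M : R, forall a, B a -> `|tau a| <= M%:C * `|a|
      & forall a b, B a -> B b -> tau (a ** b) = tau (b ** a)]].

Definition trace_norm tau : R :=
  sup [set complex.Re `|tau a| | a in [set a | B a /\ `|a| <= 1]].

Definition tracial_state tau : Prop :=
  [/\ bounded_trace tau, forall a, B a -> 0 <= tau (star a ** a)
    & tau cone = 1].

Definition bounded_operator S : Prop :=
  [/\ forall tau, bounded_trace tau -> bounded_trace (S tau),
      forall (c : R[i]) tau tau', bounded_trace tau -> bounded_trace tau' ->
        S (fun a => c * tau a + tau' a) = (fun a => c * S tau a + S tau' a)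
    & exists M : R, forall tau, bounded_trace tau ->
        trace_norm (S tau) <= M * trace_norm tau].

Definition invertible_operator L : Prop :=
  exists S, bounded_operator S /\
    forall tau, bounded_trace tau -> S (L tau) = tau /\ L (S tau) = tau.

Definition spectrum L : set R[i] :=
  [set lambda |
    ~ invertible_operator (fun tau a => L tau a - lambda * tau a)].

(* The spectrum is compact and, if there is a nonzero trace, nonempty; the
   supremum and infimum are then attained. *)
Definition r_max L : R := sup [set complex.Re `|lambda| | lambda in spectrum L].
Definition r_min L : R := inf [set complex.Re `|lambda| | lambda in spectrum L].

Definition dual_operator n (x : 'I_n -> A) : (A -> R[i]) -> A -> R[i] :=
  fun tau a =>
    if a \in B then tau (\sum_(j < n) star (x j) ** a ** x j) else 0.

End trace_functionals.

(* Main.v *)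
(** Write A0, A1 for the spectral subspaces of degree 0 and 1.  Restricting a
    KMS state at beta to A0 gives a tracial state tau with
    s' tau = e^beta tau, and conversely such a tau gives the KMS state
    tau \o E, where E averages over the circle action.  Hence the inverse
    temperatures are the logarithms of the eigenvalues of s' that have a
    tracial state as eigenvector.  They form a closed set because tracial
    states are weak*-compact, and lie in the interval because eigenvalues are
    spectral.

    That the extreme points are attained is a Krein-Rutman argument.  Every
    bounded trace is a combination of four positive ones (Jordan
    decomposition), so that the resolvent of s' is controlled by the numbers
    tau(s^k 1) for tracial states tau.  If rho is their exponential growth
    rate, the Neumann series converges beyond rho, while the partial sums of
    sum_k l^-k tau(s^k 1) are unbounded as l decreases to rho; normalizing the
    partial sums of sum_k l^-k s'^k tau and passing to a limit produces a
    tracial eigenvector for rho.  Fullness makes s' invertible, with an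
    inverse of the same form given by elements of degree -1, and the same
    argument for that inverse yields the left end point. *)

(* Positivity rests on norm estimates: [pos] compares an element with a scalar, square roots and
   inverses come from fixed points of contractions, and [Cgen] records the subalgebra in which they
   live. The operator s' is handled through the positive map s(a) = sum_j x_j^* a x_j on A0. This
   map need be neither tracial nor invertible: s(ab) and s(ba) agree only after a trace is applied,
   and so do a and its image under s composed with the analogous map of degree -1. The hypotheses on
   such maps are therefore stated under a trace. The growth rate is defined by one inequality: l is
   good if for some N, 2 g(s^N 1) <= l^N g(1) for all positive traces g. Uniformity in g allows
   iteration along the functionals g o s^k, the factor 2 yields geometric decay, and a better factor
   leaves room to lower l; this is how bounded sums near the infimum contradict its minimality.
   Limits along an ultrafilter serve both eigenstates and Neumann series. For the latter it is
   enough that the partial sums are bounded and that the remainder vanishes along a subsequence. *)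
Require Import Defs.
From HB Require Import structures.
From mathcomp Require Import all_boot all_order all_algebra.
From mathcomp Require Import complex ring lra.
From mathcomp Require Import boolp classical_sets functions set_interval reals.
From mathcomp Require Import topology normedtype sequences exp trigo.

Set Implicit Arguments.
Unset Strict Implicit.
Unset Printing Implicit Defensive.

Import Order.TTheory GRing.Theory Num.Theory.
Import numFieldNormedType.Exports.

Local Open Scope classical_set_scope.
Local Open Scope ring_scope.
Local Open Scope complex_scope.

(** * The ring underlying a C*-algebra *)

(* [A] itself cannot carry a ring structure next to its norm, see
   [isCStarAlgebra]; its alias [cring A] forgets the norm. *)
Definition cring (R : realType) (A : cstarAlgType R) : Type := A.

Section cring_algebra.
Context (R : realType) (A : cstarAlgType R).

Fact cmulDl : left_distributive (@cmul R A) +%R.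
Proof. by move=> a b c; have := cmulPl 1 a b c; rewrite !scale1r. Qed.

Fact cmulDr : right_distributive (@cmul R A) +%R.
Proof. by move=> a b c; have := cmulPr 1 b c a; rewrite !scale1r. Qed.

Fact cmul0l (a : A) : cmul 0 a = 0.
Proof. by apply: (addIr (cmul 0 a)); rewrite add0r -cmulDl add0r. Qed.

Fact cmul0r (a : A) : cmul a 0 = 0.
Proof. by apply: (addIr (cmul a 0)); rewrite add0r -cmulDr add0r. Qed.

HB.instance Definition _ := GRing.Lmodule.copy (cring A) A.

HB.instance Definition _ := GRing.Zmodule_isNzRing.Build (cring A)
  cmulA cmul1l cmul1r cmulDl cmulDr cone_neq0.

Fact cscaleAl (c : R[i]) (a b : cring A) : c *: (a * b) = (c *: a) * b.
Proof. by have := cmulPl c a 0 b; rewrite cmul0l !addr0 => <-. Qed.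

HB.instance Definition _ :=
  GRing.Lmodule_isLalgebra.Build R[i] (cring A) cscaleAl.

Fact cscaleAr (c : R[i]) (a b : cring A) : c *: (a * b) = a * (c *: b).
Proof. by have := cmulPr c b 0 a; rewrite cmul0r !addr0 => <-. Qed.

HB.instance Definition _ :=
  GRing.Lalgebra_isAlgebra.Build R[i] (cring A) cscaleAr.

End cring_algebra.

(** * Real scalars, norm and involution *)

Section real_complex.
Context (R : realType).
Implicit Types x y : R.

Lemma real_complexD x y : (x + y)%:C = x%:C + y%:C.
Proof. exact: rmorphD. Qed.

Lemma real_complexN x : (- x)%:C = - x%:C.
Proof. exact: rmorphN. Qed.

Lemma real_complexB x y : (x - y)%:C = x%:C - y%:C.
Proof. exact: rmorphB. Qed.

Lemma real_complexM x y : (x * y)%:C = x%:C * y%:C.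
Proof. exact: rmorphM. Qed.

Lemma real_complexX x n : (x ^+ n)%:C = x%:C ^+ n.
Proof. exact: rmorphXn. Qed.

Lemma real_complexV x : (x^-1)%:C = x%:C^-1.
Proof. exact: fmorphV. Qed.

Lemma real_complex1 : 1%:C = 1 :> R[i].
Proof. exact: rmorph1. Qed.

Lemma real_complex0 : 0%:C = 0 :> R[i].
Proof. exact: rmorph0. Qed.

End real_complex.

Section norm.
Context (R : realType) (A : cstarAlgType R).
Notation T := (cring A).
Implicit Types a b : T.
Implicit Type c : R[i].

(** Counterparts of [star] and of the norm on the ring alias. Unlike the norm of [A], [nrm] takes
    its values in the totally ordered field [R]. *)
Definition adj (a : T) : T := star (a : A).
Definition nrm (a : T) : R := complex.Re `|a : A|.

Lemma nrmE a : `|a : A| = (nrm a)%:C.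
Proof. by rewrite /nrm RRe_real // ger0_real. Qed.

Lemma nrm_ge0 a : 0 <= nrm a.
Proof. by rewrite -ler0c -nrmE. Qed.

Lemma nrm0 : nrm 0 = 0.
Proof. by rewrite /nrm normr0. Qed.

Lemma nrm_eq0 a : nrm a = 0 -> a = 0.
Proof. by move=> a0; apply/eqP; rewrite -[a == 0](normr_eq0 (a : A)) nrmE a0. Qed.

Lemma nrmD a b : nrm (a + b) <= nrm a + nrm b.
Proof. by rewrite -lecR real_complexD -!nrmE; exact: (ler_normD (a : A) b). Qed.

Lemma nrmN a : nrm (- a) = nrm a.
Proof. by rewrite /nrm (normrN (a : A)). Qed.

Lemma nrmB a b : nrm (a - b) <= nrm a + nrm b.
Proof. by rewrite -[nrm b]nrmN nrmD. Qed.

Lemma nrm_sub a b : nrm (a - b) = nrm (b - a).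
Proof. by rewrite -nrmN opprB. Qed.

Lemma nrmZ (c : R[i]) a : nrm (c *: a) = complex.Re `|c| * nrm a.
Proof.
rewrite /nrm (normrZ c (a : A)) nrmE.
by case: `|c| => x y /=; rewrite mulr0 subr0.
Qed.

Lemma nrmZr (r : R) a : nrm (r%:C *: a) = `|r| * nrm a.
Proof. by rewrite nrmZ normc_def /= expr0n addr0 sqrtr_sqr. Qed.

Lemma nrmM a b : nrm (a * b) <= nrm a * nrm b.
Proof. by rewrite -lecR real_complexM -!nrmE; exact: ler_norm_cmul. Qed.

Lemma nrm_adjM a : nrm (adj a * a) = nrm a ^+ 2.
Proof. by apply: complexI; rewrite real_complexX -!nrmE; exact: norm_star_cmul. Qed.

Lemma adjK : involutive adj. Proof. exact: starK. Qed.

Lemma adjM a b : adj (a * b) = adj b * adj a. Proof. exact: starM. Qed.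

Lemma adjD a b : adj (a + b) = adj a + adj b.
Proof.
have := starP 1 (a : A) b; rewrite rmorph1 !scale1r; exact.
Qed.

Lemma adj0 : adj 0 = 0.
Proof. by apply: (addIr (adj 0)); rewrite add0r -adjD add0r. Qed.

Lemma adjZ (c : R[i]) a : adj (c *: a) = conjc c *: adj a.
Proof.
by have := starP c (a : A) 0; rewrite [star 0]adj0 !addr0.
Qed.

Lemma adjN a : adj (- a) = - adj a.
Proof. by apply: (addIr (adj a)); rewrite -adjD !addNr adj0. Qed.

Lemma adjB a b : adj (a - b) = adj a - adj b.
Proof. by rewrite adjD adjN. Qed.

Lemma adj1 : adj 1 = 1.
Proof. by rewrite -[RHS]adjK -[adj 1]mulr1 adjM adjK mulr1. Qed.

Lemma adj_sum (I : Type) (r : seq I) (P : pred I) (F : I -> T) :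
  adj (\sum_(i <- r | P i) F i) = \sum_(i <- r | P i) adj (F i).
Proof. exact: (big_morph adj adjD adj0). Qed.

Lemma adj_alg (c : R[i]) : adj c%:A = (conjc c)%:A.
Proof. by rewrite adjZ adj1. Qed.

Lemma adj_real (r : R) : adj (r%:C%:A) = r%:C%:A.
Proof. by rewrite adj_alg conjc_real. Qed.

Lemma nrm_adj a : nrm (adj a) = nrm a.
Proof.
have le b : nrm b <= nrm (adj b).
  have [/eqP b0|b0] := boolP (nrm b == 0); first by rewrite b0 nrm_ge0.
  rewrite -(@ler_pM2r _ (nrm b)) ?lt_def ?b0 ?nrm_ge0// -expr2 -nrm_adjM.
  exact: nrmM.
by apply/eqP; rewrite eq_le -{2}[a]adjK !le.
Qed.

Lemma nrm1 : nrm 1 = 1.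
Proof.
have := nrm_adjM 1; rewrite adj1 mulr1 expr2 => /esym/eqP.
rewrite -subr_eq0 -[X in _ - X]mulr1 -mulrBr mulf_eq0 => /orP[/eqP/nrm_eq0/eqP|].
  by rewrite oner_eq0.
by rewrite subr_eq0 => /eqP.
Qed.

Lemma nrm_alg (r : R) : nrm (r%:C%:A) = `|r|.
Proof. by rewrite nrmZr nrm1 mulr1. Qed.

Definition tends (u : nat -> T) (l : T) : Prop :=
  forall e : R, 0 < e -> exists N, forall n, (N <= n)%N -> nrm (u n - l) < e.

Lemma cvg_tends (u : nat -> A) (l : A) : u @ \oo --> l <-> tends u l.
Proof.
split.
  move=> /(@cvgrPdist_lt _ A _ _ _ u l) ul e e0.
  have := ul e%:C; rewrite ltcR => /(_ e0) [N _ Nu].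
  exists N => n Nn; have := Nu n Nn; rewrite /= -ltcR -nrmE.
  by rewrite (@distrC _ A).
move=> ul; apply/(@cvgrPdist_lt _ A _ _ _ u l) => e e0.
have [e' e'0 e'e] : exists2 e' : R, 0 < e' & e = e'%:C.
  exists (complex.Re e); last by rewrite RRe_real// gtr0_real.
  by rewrite -ltcR RRe_real// gtr0_real.
have [N Nu] := ul _ e'0; exists N => // n Nn.
by rewrite /= e'e (@distrC _ A) (nrmE (u n - l : T)) ltcR Nu.
Qed.

Lemma tends_cauchy (u : nat -> T) :
  (forall e : R, 0 < e -> exists N, forall m n, (N <= m)%N -> (N <= n)%N ->
    nrm (u m - u n) < e) -> exists l, tends u l.
Proof.
move=> uC; suff /cauchy_cvgP u_cvg : cauchy ((u : nat -> A) @ \oo).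
  by exists (lim ((u : nat -> A) @ \oo)); apply/cvg_tends.
apply/cauchy_ballP => e e0.
have [e' e'0 e'e] : exists2 e' : R, 0 < e' & e = e'%:C.
  exists (complex.Re e); last by rewrite RRe_real// gtr0_real.
  by rewrite -ltcR RRe_real// gtr0_real.
have [N Nu] := uC _ e'0.
exists ([set a : A | exists2 n, (N <= n)%N & a = u n],
        [set a : A | exists2 n, (N <= n)%N & a = u n]).
  by split; exists N => // n Nn; exists n.
move=> [_ _] /= [[m Nm ->] [n Nn ->]]; rewrite -ball_normE /ball_ /= e'e.
by rewrite (nrmE (u m - u n : T)) ltcR Nu.
Qed.

Lemma closure_nrm (S : set A) (a : A) :
  closure S a <-> forall e : R, 0 < e -> exists2 b, S b & nrm (a - b : T) < e.
Proof.
split.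
  move=> Sa e e0; have [|b [Sb ab]] := Sa (ball a e%:C).
    by apply: nbhsx_ballx; rewrite ltcR.
  by exists b => //; move: ab; rewrite -ball_normE /ball_ /= (nrmE (a - b : T)) ltcR.
move=> Sa B /nbhs_ballP [e /= e0 eB].
have [e' e'0 e'e] : exists2 e' : R, 0 < e' & e = e'%:C.
  exists (complex.Re e); last by rewrite RRe_real// gtr0_real.
  by rewrite -ltcR RRe_real// gtr0_real.
have [b Sb ab] := Sa _ e'0; exists b; split=> //; apply: eB.
by rewrite -ball_normE /ball_ /= e'e (nrmE (a - b : T)) ltcR.
Qed.

End norm.

Lemma expr_small (R : realType) (q e : R) : 0 <= q < 1 -> 0 < e ->
  exists N, forall n, (N <= n)%N -> q ^+ n < e.
Proof.
move=> /andP[q0 q1] e0.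
have /cvgrPdist_lt/(_ _ e0)[N _ Nq] : (q ^+ n) @[n --> \oo] --> (0 : R).
  by apply: cvg_expr; rewrite ger0_norm.
exists N => n /Nq; rewrite /= sub0r normrN ger0_norm ?exprn_ge0//.
Qed.

Section scalars.
Context (R : realType) (A : cstarAlgType R).
Notation T := (cring A).
Implicit Types (a b : T) (s t : R).

Definition sc t : T := t%:C%:A.

Lemma sc0 : sc 0 = 0. Proof. by rewrite /sc scale0r. Qed.
Lemma sc1 : sc 1 = 1. Proof. by rewrite /sc scale1r. Qed.
Lemma scD s t : sc (s + t) = sc s + sc t.
Proof. by rewrite /sc real_complexD scalerDl. Qed.
Lemma scN t : sc (- t) = - sc t.
Proof. by rewrite /sc real_complexN scaleNr. Qed.
Lemma scB s t : sc (s - t) = sc s - sc t.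
Proof. by rewrite scD scN. Qed.
Lemma scZ s t : s%:C *: sc t = sc (s * t).
Proof. by rewrite /sc scalerA real_complexM. Qed.
Lemma scMl t a : sc t * a = t%:C *: a. Proof. by rewrite mulr_algl. Qed.
Lemma scMr t a : a * sc t = t%:C *: a. Proof. by rewrite mulr_algr. Qed.
Lemma adj_sc t : adj (sc t) = sc t. Proof. exact: adj_real. Qed.
Lemma nrm_sc t : nrm (sc t) = `|t|. Proof. exact: nrm_alg. Qed.
Lemma comm_sc t a : sc t * a = a * sc t. Proof. by rewrite scMl scMr. Qed.

Lemma nrmZ_ge0 t a : 0 <= t -> nrm (t%:C *: a) = t * nrm a.
Proof. by move=> t0; rewrite nrmZr ger0_norm. Qed.

Lemma nrm_lt_eq0 a : (forall e : R, 0 < e -> nrm a < e) -> a = 0.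
Proof.
move=> a0; apply: nrm_eq0; apply/eqP; rewrite eq_le nrm_ge0 andbT.
by apply/ler_addgt0Pr => e e0; rewrite add0r ltW// a0.
Qed.

Lemma nrm_dist a b : `|nrm a - nrm b| <= nrm (a - b).
Proof.
have := nrmD (b - a) a; have := nrmD (a - b) b; rewrite !subrK (nrm_sub b a).
by move=> h1 h2; rewrite ler_norml; apply/andP; split; lra.
Qed.

Lemma nrm_trans a b c : nrm (a - c) <= nrm (a - b) + nrm (b - c).
Proof. by have := nrmD (a - b) (b - c); rewrite addrA subrK. Qed.

Definition nclosed (U : T -> Prop) : Prop :=
  forall a, (forall e : R, 0 < e -> exists2 b, U b & nrm (a - b) < e) -> U a.

Lemma tends_nclosed (U : T -> Prop) u l :
  nclosed U -> tends u l -> (forall n, U (u n)) -> U l.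
Proof.
move=> Uc ul Uu; apply: Uc => e /ul[N Nu].
by exists (u N) => //; rewrite nrm_sub Nu.
Qed.

(** Banach's theorem relative to a closed set [U], which transfers to the fixed point what the
    iterates satisfy: self-adjointness, a norm bound, membership in a generated C*-algebra. *)
Lemma contraction_fixpoint (U : T -> Prop) (f : T -> T) (q : R) (x0 : T) :
  nclosed U -> U x0 -> (forall x, U x -> U (f x)) -> 0 <= q < 1 ->
  (forall x y, U x -> U y -> nrm (f x - f y) <= q * nrm (x - y)) ->
  exists2 x, U x & f x = x.
Proof.
move=> Uc U0 Uf q01 fq; have [q0 q1] := andP q01.
have q1' : 0 < 1 - q by rewrite subr_gt0.
pose u n := iter n f x0.
have Uu n : U (u n) by elim: n => //= n; exact: Uf.
pose D := nrm (u 1%N - u 0%N).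
have uS n : nrm (u n.+1 - u n) <= q ^+ n * D.
  elim: n => [|n IH]; first by rewrite expr0 mul1r.
  rewrite exprS -mulrA; apply: (le_trans (fq _ _ (Uu n.+1) (Uu n))).
  by rewrite ler_wpM2l.
(* Keeping the factor [1 - q ^+ k] of the geometric sum is what lets the induction close; it is
   dropped in [uD']. *)
have uD n k : nrm (u (n + k)%N - u n) * (1 - q) <= q ^+ n * D * (1 - q ^+ k).
  elim: k => [|k IH]; first by rewrite addn0 subrr nrm0 expr0 subrr mul0r mulr0.
  rewrite addnS; have := nrm_trans (u (n + k).+1) (u (n + k)%N) (u n).
  rewrite -(ler_pM2r q1') mulrDl => /le_trans; apply.
  have : nrm (u (n + k).+1 - u (n + k)%N) * (1 - q) <= q ^+ n * D * q ^+ k * (1 - q).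
    by rewrite ler_pM2r// (le_trans (uS _))// exprD mulrAC.
  move/lerD => /(_ _ _ IH)/le_trans; apply.
  rewrite le_eqVlt; apply/orP; left; apply/eqP.
  by rewrite exprS; ring.
have uD' n k : nrm (u (n + k)%N - u n) <= q ^+ n * (D / (1 - q)).
  rewrite mulrA ler_pdivlMr// (le_trans (uD n k))// -[leRHS]mulr1 ler_wpM2l//.
    by rewrite mulr_ge0 ?exprn_ge0// nrm_ge0.
  by rewrite gerBl exprn_ge0.
have D0 : 0 <= D / (1 - q) by rewrite divr_ge0 ?nrm_ge0// ltW.
have uN n e : 0 < e -> q ^+ n < e / (D / (1 - q) + 1) ->
    forall k, nrm (u (n + k)%N - u n) < e.
  move=> e0 ne k; rewrite (le_lt_trans (uD' n k))//.
  move: ne; rewrite ltr_pdivlMr ?ltr_wpDl// => /(le_lt_trans _); apply.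
  by rewrite ler_wpM2l ?exprn_ge0// lerDl.
have [|l ul] := @tends_cauchy _ A u.
  move=> e e0; have e20 : 0 < e / 2 / (D / (1 - q) + 1).
    by rewrite !divr_gt0// ltr_wpDl.
  have [N Nq] := expr_small q01 e20; exists N => m n Nm Nn.
  rewrite (le_lt_trans (nrm_trans _ (u N) _))// [ltRHS](splitr e) ltrD//.
    by rewrite -(subnKC Nm) uN ?divr_gt0// Nq.
  by rewrite nrm_sub -(subnKC Nn) uN ?divr_gt0// Nq.
have Ul : U l by exact: tends_nclosed ul Uu.
exists l => //; apply/subr0_eq/nrm_lt_eq0 => e e0.
have [|N Nu] := ul (e / 2); first by rewrite divr_gt0.
rewrite (le_lt_trans (nrm_trans _ (u N.+1) _))// [ltRHS](splitr e) ltr_leD//.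
  apply: (le_lt_trans (fq _ _ Ul (Uu N))).
  rewrite nrm_sub (le_lt_trans _ (Nu N _))//.
  by rewrite -[leRHS]mul1r ler_wpM2r ?nrm_ge0// ltW.
by rewrite ltW// Nu.
Qed.

End scalars.

(** * Positive elements *)

Section closed_subalgebras.
Context (R : realType) (A : cstarAlgType R).
Notation T := (cring A).
Implicit Types (a b c u v x y : T) (s t d e : R).

Record closed_star_subalgebra (B : T -> Prop) : Prop := {
  cs_one : B 1;
  cs_scale : forall (c : R[i]) a, B a -> B (c *: a);
  cs_add : forall a b, B a -> B b -> B (a + b);
  cs_mul : forall a b, B a -> B b -> B (a * b);
  cs_adj : forall a, B a -> B (adj a);
  cs_closed : nclosed B
}.

Lemma cs_opp B a : closed_star_subalgebra B -> B a -> B (- a).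
Proof. by move=> hB /(cs_scale hB (-1)); rewrite scaleN1r. Qed.

Lemma cs_sub B a b : closed_star_subalgebra B -> B a -> B b -> B (a - b).
Proof. by move=> hB ha /(cs_opp hB); exact: cs_add. Qed.

Lemma cs_sc B t : closed_star_subalgebra B -> B (sc A t).
Proof. by move=> hB; exact: (cs_scale hB _ (cs_one hB)). Qed.

Lemma cs_zero B : closed_star_subalgebra B -> B 0.
Proof. by move=> /(cs_sc 0); rewrite sc0. Qed.

Lemma cs_sum B (I : Type) (r : seq I) (P : pred I) (F : I -> T) :
  closed_star_subalgebra B -> (forall i, P i -> B (F i)) ->
  B (\sum_(i <- r | P i) F i).
Proof.
move=> hB BF; apply: big_ind => //; first exact: cs_zero.
by move=> a b; exact: cs_add.
Qed.

(** The unital C*-algebra generated by [a], as an intersection. Roots and inverses of [a] found in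
    it belong to every closed subalgebra containing [a], in particular to A0, and commute with the
    self-adjoint elements that commute with [a]. *)
Definition Cgen a b : Prop :=
  forall B, closed_star_subalgebra B -> B a -> B b.

Lemma Cgen_closed a : closed_star_subalgebra (Cgen a).
Proof.
split=> [|c b hb|b c hb hc|b c hb hc|b hb|b hb] B hB Ba.
- exact: cs_one.
- by apply: cs_scale => //; exact: hb.
- by apply: cs_add => //; [exact: hb|exact: hc].
- by apply: cs_mul => //; [exact: hb|exact: hc].
- by apply: cs_adj => //; exact: hb.
- apply: (cs_closed hB) => e /hb[c ac bc]; exists c => //; exact: ac.
Qed.

Lemma Cgen_trans a b c : Cgen a b -> Cgen b c -> Cgen a c.
Proof. by move=> ab; apply; [exact: Cgen_closed|]. Qed.

Definition sa a : Prop := adj a = a.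

Lemma saD a b : sa a -> sa b -> sa (a + b).
Proof. by rewrite /sa adjD => -> ->. Qed.
Lemma saN a : sa a -> sa (- a).
Proof. by rewrite /sa adjN => ->. Qed.
Lemma saB a b : sa a -> sa b -> sa (a - b).
Proof. by move=> sa_a /saN; exact: saD. Qed.
Lemma saZ t a : sa a -> sa (t%:C *: a).
Proof. by rewrite /sa adjZ conjc_real => ->. Qed.
Lemma sa_sc t : sa (sc A t). Proof. exact: adj_sc. Qed.
Lemma saM_comm a b : sa a -> sa b -> a * b = b * a -> sa (a * b).
Proof. by rewrite /sa adjM => -> ->. Qed.
Lemma saM a : sa a -> sa (a * a).
Proof. by rewrite /sa adjM => ->. Qed.
Lemma sa_adjM a : sa (adj a * a).
Proof. by rewrite /sa adjM adjK. Qed.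
Lemma sa_conj a x : sa a -> sa (adj x * a * x).
Proof. by rewrite /sa !adjM adjK mulrA => ->. Qed.
Lemma sa0 : sa 0. Proof. exact: adj0. Qed.
Lemma sa1 : sa 1. Proof. exact: adj1. Qed.

Lemma sa_closed : nclosed sa.
Proof.
move=> a h; apply/subr0_eq/nrm_lt_eq0 => e e0.
have [|b sb ab] := h (e / 2); first by rewrite divr_gt0.
rewrite (le_lt_trans (nrm_trans _ b _))// [ltRHS](splitr e) ltrD//.
  by rewrite -{1}sb -adjB nrm_adj.
by rewrite nrm_sub.
Qed.

(** Self-adjointness of [a] makes the commutant stable under [adj]. For closedness, the commutator
    of [a] with [b] equals that with [b - c] for any [c] in the commutant. *)
Lemma commutant_closed a : sa a -> closed_star_subalgebra (fun b => a * b = b * a).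
Proof.
move=> sa_a; split.
- by rewrite mulr1 mul1r.
- by move=> c b h; rewrite -scalerAr h scalerAl.
- by move=> b c h1 h2; rewrite mulrDr mulrDl h1 h2.
- by move=> b c h1 h2; rewrite mulrA h1 -mulrA h2 mulrA.
- by move=> b /(congr1 (@adj R A)); rewrite !adjM sa_a.
move=> b h; apply/subr0_eq/nrm_lt_eq0 => e e0.
have a1 : 0 < nrm a + 1 by rewrite ltr_wpDl// nrm_ge0.
have [|c ac bc] := h (e / 2 / (nrm a + 1)); first by rewrite !divr_gt0.
have -> : a * b - b * a = a * (b - c) - (b - c) * a.
  by rewrite mulrBr mulrBl ac opprB addrA subrK.
move: bc; rewrite ltr_pdivlMr// => bc.
have k : nrm (b - c) * nrm a < e / 2.
  by rewrite (le_lt_trans _ bc)// ler_wpM2l ?nrm_ge0// lerDl.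
rewrite (le_lt_trans (nrmB _ _))// [ltRHS](splitr e) ltrD//.
  by rewrite (le_lt_trans (nrmM _ _))// mulrC.
by rewrite (le_lt_trans (nrmM _ _)).
Qed.

Lemma Cgen_comm a b c : sa a -> a * b = b * a -> Cgen b c -> a * c = c * a.
Proof. by move=> /commutant_closed h ab hc; exact: (hc _ h ab). Qed.

Lemma Cgen_comm2 a b c : sa a -> sa b -> Cgen a b -> Cgen a c -> b * c = c * b.
Proof.
move=> sa_a sa_b ab ac; apply: (@Cgen_comm b a) => //.
by symmetry; apply: (@Cgen_comm a a).
Qed.

Lemma nclosed_ball t : nclosed (fun a => nrm a <= t).
Proof.
move=> a h; apply/ler_addgt0Pr => e /h[b bt ab].
by have := nrmD (a - b) b; rewrite subrK => /le_trans; apply; rewrite addrC lerD// ltW.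
Qed.

Lemma nclosedI (U V : T -> Prop) : nclosed U -> nclosed V ->
  nclosed (fun a => U a /\ V a).
Proof.
move=> Uc Vc a h; split; [apply: Uc|apply: Vc] => e /h[b [? ?] ?]; by exists b.
Qed.

(* If [a = t (1 - h)] with [nrm h < 1], then the square root of [1 - h] is
   [1 - b], where [b] is the fixed point of the contraction
   [b |-> (h + b^2) / 2] on the ball of radius [1 - sqrt (1 - nrm h)]. *)
Lemma exists_sqrt_lt a t : sa a -> nrm (sc A t - a) < t ->
  exists u s, [/\ sa u, u * u = a, Cgen a u & nrm (sc A s - u) <= s].
Proof.
move=> sa_a at_.
have t0 : 0 < t by rewrite (le_lt_trans _ at_)// nrm_ge0.
pose h := t^-1%:C *: (sc A t - a).
have sa_h : sa h by apply/saZ/saB => //; exact: sa_sc.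
have Ch : Cgen a h.
  apply: (cs_scale (Cgen_closed a)).
  by apply: (cs_sub (Cgen_closed a)) => //; exact: (cs_sc _ (Cgen_closed a)).
pose q := nrm h.
have q0 : 0 <= q by exact: nrm_ge0.
have q1 : q < 1.
  by rewrite /q nrmZ_ge0 ?invr_ge0 ?ltW// mulrC ltr_pdivrMr// mul1r.
(* The smaller solution of q + r^2 = 2 r; it is both the radius of an invariant ball and the
   contraction factor on it. *)
pose r := 1 - Num.sqrt (1 - q).
have sq : Num.sqrt (1 - q) ^+ 2 = 1 - q by rewrite sqr_sqrtr// subr_ge0 ltW.
have sq0 : 0 < Num.sqrt (1 - q) by rewrite sqrtr_gt0 subr_gt0.
have sq1 : Num.sqrt (1 - q) <= 1 by rewrite -[leRHS]sqrtr1 ler_wsqrtr// gerBl.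
have r01 : 0 <= r < 1 by rewrite /r subr_ge0 sq1 gtrBl.
have [r0 r1] := andP r01.
have rq : q + r * r = 2 * r by rewrite /r; move: sq; rewrite expr2;
  set z := Num.sqrt _ => zq; nra.
pose f b := (2^-1 : R)%:C *: (h + b * b).
have [//||//||b [[Cb sb] br] fb] := @contraction_fixpoint _ A
    (fun b => (Cgen a b /\ sa b) /\ nrm b <= r) f r 0 _ _ _ r01.
- apply: nclosedI; last exact: nclosed_ball.
  apply: nclosedI; [exact: cs_closed (Cgen_closed a)|exact: sa_closed].
- by rewrite nrm0; split=> //; split; [exact: (cs_zero (Cgen_closed a))|exact: sa0].
- move=> b [[Cb sb] br]; split; first split.
  + apply: (cs_scale (Cgen_closed a)).
    by apply: (cs_add (Cgen_closed a)) => //; exact: (cs_mul (Cgen_closed a)).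
  + by apply/saZ/saD => //; exact: saM.
  + rewrite /f nrmZ_ge0 ?invr_ge0// mulrC ler_pdivrMr// mulrC -rq.
    rewrite (le_trans (nrmD _ _))// lerD2l (le_trans (nrmM _ _))//.
    by rewrite ler_pM ?nrm_ge0.
- move=> b c [_ br] [_ cr].
  rewrite /f -scalerBr nrmZ_ge0 ?invr_ge0// opprD addrACA subrr add0r.
  have -> : b * b - c * c = b * (b - c) + (b - c) * c.
    by rewrite mulrBr mulrBl addrA subrK.
  rewrite mulrC ler_pdivrMr//.
  rewrite (le_trans (nrmD _ _))// (le_trans (lerD (nrmM _ _) (nrmM _ _)))//.
  have := nrm_ge0 (b - c); move: (nrm (b - c)) => z z0; nra.
exists ((Num.sqrt t)%:C *: (1 - b)), (Num.sqrt t); split.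
- by apply/saZ/saB => //; exact: sa1.
- rewrite -scalerAl -scalerAr scalerA -real_complexM -expr2 sqr_sqrtr ?ltW//.
  have -> : (1 - b) * (1 - b) = 1 - h.
    rewrite mulrBl mul1r mulrBr mulr1.
    have : (2%:C : R[i]) *: f b = (2%:C : R[i]) *: b by rewrite fb.
    rewrite /f scalerA -real_complexM divff ?pnatr_eq0// real_complex1 scale1r => hb.
    have -> : h = b + b - b * b.
      apply: (addIr (b * b)); rewrite hb subrK.
      by rewrite [2%:C](_ : _ = 1 + 1) ?scalerDl ?scale1r// -real_complexD.
    by rewrite -addrA -opprD addrA.
  rewrite scalerBr -[t%:C *: 1]/(sc A t) /h scalerA -real_complexM divff ?gt_eqF//.
  by rewrite real_complex1 scale1r opprB addrC subrK.
- apply: (cs_scale (Cgen_closed a)).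
  by apply: (cs_sub (Cgen_closed a)) => //; exact: (cs_one (Cgen_closed a)).
- rewrite scalerBr opprB addrC subrK nrmZ_ge0 ?sqrtr_ge0//.
  by rewrite -[leRHS]mulr1 ler_wpM2l ?sqrtr_ge0// (le_trans br)// ltW.
Qed.

End closed_subalgebras.

Section positive_elements.
Context (R : realType) (A : cstarAlgType R).
Notation T := (cring A).
Notation sc := (sc A).
Implicit Types (a b c u v x y : T) (s t d e : R).

Definition iC : R[i] := 0 +i* 1.

Lemma iC2 : iC * iC = -1.
Proof. by rewrite /iC; simpc. Qed.

Lemma conj_iC : conjc iC = - iC.
Proof. by rewrite /iC; simpc. Qed.

Lemma norm_iC : complex.Re `|iC| = 1.
Proof. by rewrite normc_def /= expr0n expr1n add0r sqrtr1. Qed.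

Lemma nrm_iC a : nrm (iC *: a) = nrm a.
Proof. by rewrite nrmZ norm_iC mul1r. Qed.

Lemma half_dbl a : (2^-1 : R)%:C *: (a + a) = a.
Proof.
by rewrite scalerDr -scalerDl -real_complexD (_ : 2^-1 + 2^-1 = 1) ?scale1r//; lra.
Qed.

(* For self-adjoint [a], this says that the spectrum of [a] is nonnegative;
   in this form it defines a closed convex cone. *)
Definition pos a : Prop := sa a /\ nrm (sc (nrm a) - a) <= nrm a.

Lemma pos_sa a : pos a -> sa a. Proof. by case. Qed.

Lemma pos0 : pos 0.
Proof. by split; [exact: sa0|rewrite nrm0 sc0 subrr nrm0]. Qed.

Lemma nrm_sq u : sa u -> nrm (u * u) = nrm u ^+ 2.
Proof. by move=> su; rewrite -nrm_adjM su. Qed.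

(* [u + iv] is normal, so that its norm dominates those of its real and
   imaginary parts. *)
Lemma nrm_sq_le u v : sa u -> sa v -> u * v = v * u ->
  nrm u ^+ 2 <= nrm (u * u + v * v).
Proof.
move=> su sv uv; pose w := u + iC *: v.
have aw : adj w = u - iC *: v by rewrite /w adjD adjZ su sv conj_iC scaleNr.
have -> : u * u + v * v = adj w * w.
  rewrite aw /w mulrDr !mulrBl -!scalerAl -!scalerAr scalerA iC2 scaleN1r opprK.
  by rewrite uv addrA subrK.
rewrite nrm_adjM lerXn2r ?nnegrE ?nrm_ge0//.
have -> : u = (2^-1 : R)%:C *: (w + adj w).
  by rewrite aw /w addrACA subrr addr0 half_dbl.
rewrite nrmZ_ge0 ?invr_ge0// mulrC ler_pdivrMr//.
by rewrite (le_trans (nrmD _ _))// nrm_adj -mulr2n mulr_natr.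
Qed.

(** If [nrm v < 1], the root [w] of 1 - v^2 commutes with [v], and w^2 + v^2 = 1 forces nrm w <= 1
    by [nrm_sq_le]. The boundary case is reached by scaling [u] with [r < 1]. *)
Lemma nrm_1sub_sq u : sa u -> nrm u <= 1 -> nrm (1 - u * u) <= 1.
Proof.
have lt1 v : sa v -> nrm v < 1 -> nrm (1 - v * v) <= 1.
  move=> sv v1; have svv := saM sv.
  have [||w [s [sw ww Cw _]]] := @exists_sqrt_lt _ A (1 - v * v) 1.
  - by apply: saB => //; exact: sa1.
  - by rewrite sc1 opprB addrC subrK nrm_sq// exprn_ilt1// nrm_ge0.
  have vw : v * w = w * v.
    apply: (Cgen_comm sv _ Cw).
    by rewrite mulrBr mulrBl mulr1 mul1r mulrA.
  have := nrm_sq_le sw sv (esym vw); rewrite ww subrK nrm1.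
  by rewrite -nrm_sq// ww.
move=> su u1; apply/ler_addgt0Pr => e e0.
pose r := Num.max 0 (1 - e / 2).
have r0 : 0 <= r by rewrite le_max lexx.
have r1 : r < 1 by rewrite gt_max ltr01 gtrBl divr_gt0.
have r2 : 1 - r ^+ 2 <= e.
  rewrite /r; case: (leP (1 - e / 2) 0) => h; nra.
have := lt1 (r%:C *: u) (saZ _ su).
rewrite nrmZ_ge0// -scalerAl -scalerAr scalerA -real_complexM -expr2 => k.
have {}k : nrm (1 - (r ^+ 2)%:C *: (u * u)) <= 1.
  by apply: k; rewrite (le_lt_trans _ r1)// -[leRHS]mulr1 ler_wpM2l.
have -> : 1 - u * u = (1 - (r ^+ 2)%:C *: (u * u)) - (1 - r ^+ 2)%:C *: (u * u).
  by rewrite real_complexB scalerBl scale1r opprB addrA subrK.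
rewrite (le_trans (nrmB _ _))// lerD// nrmZ_ge0 ?subr_ge0 ?expr_le1 ?(ltW r1)//.
rewrite nrm_sq// (le_trans _ r2)// -[leRHS]mulr1 ler_wpM2l ?expr_le1 ?nrm_ge0//.
by rewrite subr_ge0 expr_le1// ltW.
Qed.

Lemma pos_sq u : sa u -> pos (u * u).
Proof.
move=> su; split; first exact: saM.
rewrite nrm_sq//; have [/nrm_eq0->|u0] := eqVneq (nrm u) 0.
  by rewrite nrm0 expr0n sc0 mulr0 subrr nrm0.
have un : 0 < nrm u by rewrite lt_def u0 nrm_ge0.
pose v := (nrm u)^-1%:C *: u.
have vv : u * u = (nrm u ^+ 2)%:C *: (v * v).
  rewrite -scalerAl -scalerAr !scalerA -!real_complexM expr2.
  by rewrite -mulrA mulrACA divff// mulr1 real_complex1 scale1r.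
rewrite vv -[sc _]mulr1 scMl -scalerBr nrmZ_ge0 ?exprn_ge0 ?nrm_ge0//.
rewrite -[leRHS]mulr1 ler_wpM2l ?exprn_ge0 ?nrm_ge0//.
apply: nrm_1sub_sq; first exact: saZ.
by rewrite nrmZ_ge0 ?invr_ge0 ?nrm_ge0// mulVf.
Qed.

Lemma pos_closed : nclosed pos.
Proof.
move=> a h; split.
  by apply: sa_closed => e /h[b [sb _] ab]; exists b.
apply/ler_addgt0Pr => e e0.
have [|b [_ pb] ab] := h (e / 3); first by rewrite divr_gt0.
have := nrm_dist a b; rewrite ler_norml => /andP[h1 h2].
have -> : sc (nrm a) - a = (sc (nrm a - nrm b) + (sc (nrm b) - b)) - (a - b).
  by rewrite scB addrA subrK opprB addrA subrK.
have := nrmB (sc (nrm a - nrm b) + (sc (nrm b) - b)) (a - b).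
have := nrmD (sc (nrm a - nrm b)) (sc (nrm b) - b).
rewrite nrm_sc; have : `|nrm a - nrm b| <= nrm (a - b) by exact: nrm_dist.
lra.
Qed.

Lemma approx_shift (P : T -> Prop) a : nclosed P ->
  (forall d, 0 < d -> P (a + sc d)) -> P a.
Proof.
move=> Pc h; apply: Pc => e e0; exists (a + sc (e / 2)); first by apply: h; lra.
by rewrite opprD addrA subrr add0r nrmN nrm_sc ger0_norm; lra.
Qed.

(** Any [t] may take the place of [nrm a] in [pos]: a + d meets the strict hypothesis of
    [exists_sqrt_lt] with t + d, so it is a square, and d tends to 0. Convexity of the cone
    follows. *)
Lemma pos_of_le a t : sa a -> nrm (sc t - a) <= t -> pos a.
Proof.
move=> sa_a at_; apply: (approx_shift pos_closed) => d d0.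
have [||u [s [su <- _ _]]] := @exists_sqrt_lt _ A (a + sc d) (t + d).
- by apply: saD => //; exact: sa_sc.
- rewrite scD opprD addrACA subrr addr0; lra.
exact: pos_sq.
Qed.

Lemma posD a b : pos a -> pos b -> pos (a + b).
Proof.
move=> [sa_a pa] [sb pb]; apply: (@pos_of_le _ (nrm a + nrm b)).
  exact: saD.
by rewrite scD opprD addrACA (le_trans (nrmD _ _))// lerD.
Qed.

Lemma posZ t a : 0 <= t -> pos a -> pos (t%:C *: a).
Proof.
move=> t0 [sa_a pa]; apply: (@pos_of_le _ (t * nrm a)); first exact: saZ.
by rewrite -scZ -scalerBr nrmZ_ge0// ler_wpM2l.
Qed.

Lemma pos_sc t : 0 <= t -> pos (sc t).
Proof.
move=> t0; apply: (@pos_of_le _ t); first exact: sa_sc.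
by rewrite subrr nrm0.
Qed.

Lemma pos_sum (I : Type) (r : seq I) (P : pred I) (F : I -> T) :
  (forall i, P i -> pos (F i)) -> pos (\sum_(i <- r | P i) F i).
Proof. by move=> PF; apply: big_ind => //; [exact: pos0|exact: posD]. Qed.

Lemma pos_scB a t : sa a -> nrm a <= t -> pos (sc t - a).
Proof.
move=> sa_a at_; apply: (@pos_of_le _ t); first by apply: saB => //; exact: sa_sc.
by rewrite opprB addrC subrK.
Qed.

Lemma pos_scD a t : sa a -> nrm a <= t -> pos (sc t + a).
Proof. by move=> sa_a; rewrite -{2}[a]opprK -nrmN; apply: pos_scB; exact: saN. Qed.

Lemma exists_sqrt_shift a d : pos a -> 0 < d ->
  exists u, [/\ pos u, u * u = a + sc d & Cgen a u].
Proof.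
move=> pa d0; have [||u [s [su uu Cu us]]] := @exists_sqrt_lt _ A (a + sc d) (nrm a + d).
- by apply: saD; [exact: pos_sa|exact: sa_sc].
- by rewrite scD opprD addrACA subrr addr0; case: pa; lra.
exists u; split=> //; first exact: pos_of_le us.
apply: Cgen_trans Cu; apply: (cs_add (Cgen_closed a)) => //.
exact: (cs_sc _ (Cgen_closed a)).
Qed.

(** After a small shift, [a] and t - a have roots [u], [v] in the C*-algebra generated by [a]. They
    commute and u^2 + v^2 is a scalar, which bounds nrm u ^ 2 by [nrm_sq_le]. *)
Lemma pos_nrm_le a t : pos a -> pos (sc t - a) -> 0 <= t -> nrm a <= t.
Proof.
move=> pa pta t0; apply/ler_addgt0Pr => e e0.
have e30 : 0 < e / 3 by lra.
have [u [/pos_sa su uu Cu]] := exists_sqrt_shift pa e30.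
have [v [/pos_sa sv vv Cv]] := exists_sqrt_shift pta e30.
have {}Cv : Cgen a v.
  apply: Cgen_trans Cv; apply: (cs_sub (Cgen_closed a)) => //.
  exact: (cs_sc _ (Cgen_closed a)).
have uv := Cgen_comm2 (pos_sa pa) su Cu Cv.
have := nrm_sq_le su sv uv; rewrite -nrm_sq// uu vv.
rewrite addrACA [a + (_ - _)]addrC subrK -!scD nrm_sc ger0_norm; last lra.
have := nrmB (a + sc (e / 3)) (sc (e / 3)).
rewrite addrK nrm_sc ger0_norm; lra.
Qed.

Lemma pos_anti a : pos a -> pos (- a) -> a = 0.
Proof.
move=> pa pa'; apply: nrm_eq0; apply/eqP; rewrite eq_le nrm_ge0 andbT.
by apply: pos_nrm_le => //; rewrite sc0 add0r.
Qed.

Lemma pos_mono a b : pos a -> pos (b - a) -> nrm a <= nrm b.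
Proof.
move=> pa pab; apply: pos_nrm_le => //; last exact: nrm_ge0.
have -> : sc (nrm b) - a = (sc (nrm b) - b) + (b - a) by rewrite addrA subrK.
apply: posD => //; apply: pos_scB => //.
by rewrite -[b](subrK a); apply: saD; apply: pos_sa.
Qed.

(** Up to small shifts, a b is the square of the product of commuting roots of [a] and [b]. *)
Lemma posM a b : pos a -> pos b -> a * b = b * a -> pos (a * b).
Proof.
move=> pa pb ab; apply: pos_closed => e e0.
pose d := Num.min 1 (e / 2 / (nrm a + nrm b + 1)).
have k0 : 0 < nrm a + nrm b + 1 by rewrite ltr_wpDl// addr_ge0 ?nrm_ge0.
have d0 : 0 < d by rewrite lt_min ltr01 !divr_gt0.
have d1 : d <= 1 by rewrite ge_min lexx.
have dk : d * (nrm a + nrm b + 1) <= e / 2.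
  by rewrite -ler_pdivlMr// ge_min lexx orbT.
have [u [/pos_sa su uu Cu]] := exists_sqrt_shift pa d0.
have [v [/pos_sa sv vv Cv]] := exists_sqrt_shift pb d0.
have bu : b * u = u * b by apply: (Cgen_comm (pos_sa pb) _ Cu).
have uv : u * v = v * u by apply: (Cgen_comm su _ Cv).
exists ((a + sc d) * (b + sc d)).
  have -> : (a + sc d) * (b + sc d) = (u * v) * (u * v).
    by rewrite -uu -vv -!mulrA; congr (_ * _); rewrite !mulrA uv.
  by apply: pos_sq; exact: saM_comm.
rewrite mulrDl mulrDr opprD addrA opprD addrA subrr add0r scMr scMl.
rewrite (le_lt_trans (nrmD _ _))// !nrmN !nrmZ_ge0 ?(ltW d0)//.
have := nrmD b (sc d); rewrite nrm_sc ger0_norm ?(ltW d0)// => bd.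
have : d * nrm (b + sc d) <= d * (nrm b + d) by rewrite ler_wpM2l// (ltW d0).
have : d * d <= d * 1 by rewrite ler_wpM2l// (ltW d0).
lra.
Qed.

End positive_elements.

Section square_root.
Context (R : realType) (A : cstarAlgType R).
Notation T := (cring A).
Notation sc := (sc A).
Implicit Types (a b c u v x y : T) (s t d e : R).

(* With [x = u - v], [y = u + v] and [c = s - t] one has [x y = c], so that
   [x = x^2 y / c] is positive, and [c - x^2 = 2 x v] is positive. *)
Lemma sqrt_dist a u v s t : pos u -> pos v -> u * v = v * u ->
  u * u = a + sc s -> v * v = a + sc t -> t < s -> nrm (u - v) ^+ 2 <= s - t.
Proof.
move=> pu pv uv uu vv ts; have st : 0 < s - t by rewrite subr_gt0.
have su := pos_sa pu; have sv := pos_sa pv; have suv := saB su sv.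
pose x := u - v; pose y := u + v.
have xy : x * y = sc (s - t).
  rewrite mulrDr !mulrBl uu vv -uv addrA subrK.
  by rewrite opprD addrACA subrr add0r scB.
have xv : x * v = v * x by rewrite mulrBl mulrBr uv.
have yx : y * x = x * y.
  by rewrite /x /y mulrDl mulrBl !mulrBr !mulrDr uv addrA subrK opprD addrA addrK.
have px : pos x.
  have -> : x = (s - t)^-1%:C *: (x * x * y).
    rewrite -mulrA xy scMr scalerA -real_complexM mulVf ?gt_eqF//.
    by rewrite real_complex1 scale1r.
  apply: posZ; first by rewrite invr_ge0 ltW.
  by apply: posM; [exact: pos_sq|exact: posD|rewrite -mulrA -yx mulrA -yx !mulrA].
rewrite -nrm_sq//; apply: pos_nrm_le; [exact: pos_sq| |exact: ltW].
have -> : sc (s - t) - (u - v) * (u - v) = x * v + x * v.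
  rewrite -xy -/x -mulrBr -mulrDr (_ : y - x = v + v)//.
  by rewrite /x /y opprB addrC addrA subrK.
by apply: posD; exact: posM.
Qed.

(** The roots [u n] of a + 1/(n+1) form a Cauchy sequence: by [sqrt_dist], the squared distance of
    [u m] and [u n] is at most 1/(m+1) for m <= n. *)
Lemma exists_sqrt a : pos a -> exists u, [/\ pos u, u * u = a & Cgen a u].
Proof.
move=> pa; pose dl n : R := n.+1%:R^-1.
have dl0 n : 0 < dl n by rewrite invr_gt0.
have [u hu] := choice (fun n => exists_sqrt_shift pa (dl0 n)).
have pu n : pos (u n) by case: (hu n).
have uu n : u n * u n = a + sc (dl n) by case: (hu n).
have Cu n : Cgen a (u n) by case: (hu n).
have dlN e : 0 < e -> exists N, forall n, (N <= n)%N -> dl n < e.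
  move=> e0; have e10 : 0 <= e^-1 by rewrite invr_ge0 ltW.
  exists (Num.Def.truncn e^-1) => n Nn.
  rewrite /dl -[e]invrK ltf_pV2 ?posrE ?invr_gt0//.
  by rewrite (lt_le_trans (truncnS_gt _))// ler_nat.
have comm m n : u m * u n = u n * u m.
  exact: (Cgen_comm2 (pos_sa pa) (pos_sa (pu m)) (Cu m) (Cu n)).
have dist m n : (m <= n)%N -> nrm (u m - u n) ^+ 2 <= dl m.
  rewrite leq_eqVlt => /orP[/eqP->|mn].
    by rewrite subrr nrm0 expr0n ltW.
  rewrite (le_trans (sqrt_dist (pu m) (pu n) (comm m n) (uu m) (uu n) _))//.
    by rewrite ltf_pV2 ?posrE// ltr_nat.
  by rewrite gerBl ltW.
have [|l ul] := @tends_cauchy _ A u.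
  move=> e e0; have [|N Nd] := dlN (e ^+ 2); first by rewrite exprn_gt0.
  exists N => m n Nm Nn; wlog mn : m n Nm Nn / (m <= n)%N.
    move=> h; have [mn|nm] := leqP m n; first exact: h.
    by rewrite nrm_sub; apply: h => //; exact: ltnW.
  rewrite -(@ltr_pXn2r _ 2)// ?nnegrE ?nrm_ge0 ?(ltW e0)//.
  by rewrite (le_lt_trans (dist _ _ mn))// Nd.
exists l; split.
- exact: (tends_nclosed (@pos_closed _ A) ul).
- apply/subr0_eq/nrm_lt_eq0 => e e0.
  have k0 : 0 < nrm l + nrm l + 1 by rewrite ltr_wpDl// addr_ge0 ?nrm_ge0.
  pose e' := Num.min 1 (e / 2 / (nrm l + nrm l + 1)).
  have e'0 : 0 < e' by rewrite lt_min ltr01 !divr_gt0.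
  have e'1 : e' <= 1 by rewrite ge_min lexx.
  have e'k : e' * (nrm l + nrm l + 1) <= e / 2.
    by rewrite -ler_pdivlMr// ge_min lexx orbT.
  have [N1 h1] := ul _ e'0.
  have [|N2 h2] := dlN (e / 2); first by rewrite divr_gt0.
  pose n := maxn N1 N2; have {h1} := h1 n (leq_maxl _ _).
  have {h2} := h2 n (leq_maxr _ _); move: (uu n) (dl0 n); move: (u n) (dl n).
  move=> v d vv d0 de ve.
  have -> : l * l - a = - (v - l) * v - l * (v - l) + sc d.
    rewrite mulNr mulrBl mulrBr vv opprB opprB.
    by rewrite [_ + (l * l - _)]addrC addrA subrK opprD addrA subrK.
  rewrite (le_lt_trans (nrmD _ _))// nrm_sc ger0_norm ?(ltW d0)//.
  have := nrmB (- (v - l) * v) (l * (v - l)); have := nrmM l (v - l).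
  have := nrmM (- (v - l)) v; rewrite nrmN.
  have vl : nrm v <= nrm l + 1.
    by have := nrmD (v - l) l; rewrite subrK; lra.
  have : nrm (v - l) * nrm v <= e' * (nrm l + 1).
    by rewrite ler_pM ?nrm_ge0// ltW.
  have : nrm l * nrm (v - l) <= nrm l * e'.
    by rewrite ler_wpM2l ?nrm_ge0// ltW.
  lra.
- exact: (tends_nclosed (cs_closed (Cgen_closed a)) ul).
Qed.

(** Neumann series in fixed point form: c = (s + d)(1 - h) with nrm h < 1, and x = 1 + h x inverts 1
    - h. The inverse [b] is positive because b = b^2 c. *)
Lemma exists_inv c d : pos (c - sc d) -> 0 < d ->
  exists b, [/\ pos b, c * b = 1, b * c = 1 & Cgen c b].
Proof.
move=> pcd d0; have pc : pos c.
  by rewrite -[c](subrK (sc d)); apply: posD => //; apply: pos_sc; exact: ltW.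
have sc_ := pos_sa pc.
pose s := nrm (c - sc d); have s0 : 0 <= s by exact: nrm_ge0.
have cs : nrm (sc (s + d) - c) <= s.
  by rewrite scD -addrA -opprB; case: pcd.
have t0 : 0 < s + d by rewrite ltr_wpDl.
pose h := (s + d)^-1%:C *: (sc (s + d) - c).
have Ch : Cgen c h.
  apply: (cs_scale (Cgen_closed c)); apply: (cs_sub (Cgen_closed c)) => //.
  exact: (cs_sc _ (Cgen_closed c)).
have h1 : 1 - h = (s + d)^-1%:C *: c.
  rewrite /h scalerBr scZ mulVf ?gt_eqF// sc1.
  by rewrite opprB addrC subrK.
have h01 : 0 <= nrm h < 1.
  rewrite nrm_ge0 /= nrmZ_ge0 ?invr_ge0 ?(ltW t0)// mulrC ltr_pdivrMr// mul1r.
  by rewrite (le_lt_trans cs)// ltrDl.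
have [|||||x Cx hx] := @contraction_fixpoint _ A (Cgen c) (fun x => 1 + h * x) (nrm h) 1.
- exact: cs_closed (Cgen_closed c).
- exact: (cs_one (Cgen_closed c)).
- move=> x Cx; apply: (cs_add (Cgen_closed c)); first exact: (cs_one (Cgen_closed c)).
  exact: (cs_mul (Cgen_closed c)).
- by [].
- by move=> x y _ _; rewrite opprD addrACA subrr add0r -mulrBr nrmM.
have cx : c * x = x * c by exact: (Cgen_comm sc_ (erefl _) Cx).
pose b := (s + d)^-1%:C *: x.
have cb : c * b = 1.
  by rewrite /b -scalerAr scalerAl -h1 mulrBl mul1r -{1}hx addrK.
have bc : b * c = 1 by rewrite -cb /b -scalerAl -scalerAr cx.
have Cb : Cgen c b by exact: (cs_scale (Cgen_closed c)).
exists b; split => //.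
have sb : sa b.
  have : adj (c * b) = adj 1 by rewrite cb.
  rewrite adjM adj1 sc_ => abc.
  by rewrite /sa -[adj b]mulr1 -cb mulrA abc mul1r.
have -> : b = (b * b) * c by rewrite -mulrA bc mulr1.
by apply: posM => //; [exact: pos_sq|rewrite -mulrA bc mulrA cb mul1r mulr1].
Qed.

(* The least [s >= 0] such that [a + s] is positive must be 0: a positive
   invertible element remains positive when slightly decreased. *)
Lemma pos_of_invertible a : sa a ->
  (forall s, 0 < s -> exists b, (a + sc s) * b = 1 /\ b * (a + sc s) = 1) ->
  pos a.
Proof.
move=> sa_a inv; pose S := [set s | 0 <= s /\ pos (a + sc s)].
have SinfS : has_inf S.
  split; first by exists (nrm a); split; [exact: nrm_ge0|rewrite addrC; exact: pos_scD].
  by exists 0 => s [].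
have s00 : 0 <= inf S by apply: lb_le_inf => [|s []//]; case: SinfS.
have pS : pos (a + sc (inf S)).
  apply: pos_closed => e e0.
  have [s [s0 ps] se] := inf_adherent e0 SinfS.
  exists (a + sc s) => //.
  have Ss : inf S <= s by apply: ge_inf => //; exists 0 => r [].
  rewrite opprD addrACA subrr add0r -scB nrm_sc distrC ger0_norm; lra.
have [s0|s0] := eqVneq (inf S) 0; first by rewrite s0 sc0 addr0 in pS.
have {s00}s0 : 0 < inf S by rewrite lt_def s0.
have [b [cb bc]] := inv _ s0.
have sc_ := pos_sa pS.
have sb : sa b.
  have : adj ((a + sc (inf S)) * b) = adj 1 by rewrite cb.
  rewrite adjM adj1 sc_ => abc.
  by rewrite /sa -[adj b]mulr1 -cb mulrA abc mul1r.
pose e := Num.min (inf S) (nrm b + 1)^-1.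
have b1 : 0 < nrm b + 1 by rewrite ltr_wpDl// nrm_ge0.
have e0 : 0 < e by rewrite lt_min s0 invr_gt0.
have eb : e * nrm b <= 1.
  have : e * (nrm b + 1) <= 1 by rewrite -ler_pdivlMr// div1r ge_min lexx orbT.
  by lra.
have : S (inf S - e).
  split; first by rewrite subr_ge0 ge_min lexx.
  have -> : a + sc (inf S - e) = (a + sc (inf S)) * (1 - e%:C *: b).
    by rewrite mulrBr mulr1 -scalerAr cb scB addrA.
  apply: posM => //.
    by rewrite -sc1; apply: pos_scB; [exact: saZ|rewrite nrmZ_ge0 ?(ltW e0)].
  by rewrite mulrBr mulrBl mulr1 mul1r -scalerAr -scalerAl cb bc.
move=> SE; have : inf S <= inf S - e by apply: ge_inf => //; exists 0 => r [].
lra.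
Qed.

(* [s - y* y] is invertible if and only if [s - y y*] is. *)
Lemma pos_opp_swap y : pos (- (adj y * y)) -> pos (- (y * adj y)).
Proof.
move=> py; apply: pos_of_invertible => [|s s0].
  by apply: saN; rewrite -{1}[y]adjK; exact: sa_adjM.
have [|r [_ mr rm _]] := @exists_inv (- (adj y * y) + sc s) s _ s0;
  first by rewrite addrK.
pose M := - (y * adj y) + sc s; pose m := - (adj y * y) + sc s.
have My : M * y = y * m by rewrite mulrDl mulrDr mulNr mulrN comm_sc mulrA.
have yM : adj y * M = m * adj y by rewrite mulrDl mulrDr mulNr mulrN comm_sc mulrA.
have s1 : sc s^-1 * sc s = 1 by rewrite scMl scZ mulVf ?gt_eqF// sc1.
have Ms : M + y * adj y = sc s by rewrite /M addrAC addNr add0r.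
(* The inverse of s - y y^* expressed through the inverse [r] of s - y^* y; it rests on the
   intertwining relations [My] and [yM]. *)
exists (sc s^-1 * (1 + y * r * adj y)); rewrite -/M; split.
- rewrite mulrA -comm_sc -mulrA mulrDr mulr1 !mulrA My -[y * m * r]mulrA mr mulr1.
  by rewrite Ms s1.
- rewrite -mulrA mulrDl mul1r -[y * r * adj y * M]mulrA yM !mulrA -[y * r * m]mulrA.
  by rewrite rm mulr1 Ms s1.
Qed.

(** Since c^2 = a^2, (c - a + t)(c + a + t) = t^2 + 2 t c, which is bounded below by t^2. Hence c -
    a + t is invertible for every t > 0, and [pos_of_invertible] applies. *)
Lemma le_of_sq_le a c : sa a -> pos c -> a * c = c * a -> c * c = a * a ->
  pos (c - a).
Proof.
move=> sa_a pc ac cc; have sc_ := pos_sa pc.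
apply: pos_of_invertible => [|t t0]; first exact: saB.
pose m := (c - a + sc t) * (c + a + sc t).
have mE : m = sc (t * t) + (2 * t)%:C *: c.
  have -> : m = (c + sc t - a) * (c + sc t + a).
    by rewrite /m [c - a + _]addrAC [c + a + _]addrAC.
  have ca : (c + sc t) * a = a * (c + sc t) by rewrite mulrDl mulrDr ac comm_sc.
  rewrite mulrDr !mulrBl -ca addrA subrK mulrDl !mulrDr cc !scMr scMl scZ.
  rewrite addrC !addrA addNr add0r addrC -scalerDl -real_complexD.
  by congr (_ + _%:C *: _); ring.
have [||r [_ mr rm Cr]] := @exists_inv m (t * t).
- by rewrite mE addrAC subrr add0r; apply: posZ => //; lra.
- by rewrite mulr_gt0.
have cm : (c - a + sc t) * (c + a + sc t) = (c + a + sc t) * (c - a + sc t).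
  rewrite [in LHS]mulrDl [in RHS]mulrDr comm_sc; congr (_ + _).
  rewrite [in LHS]mulrDr [in RHS]mulrDl comm_sc; congr (_ + _).
  by rewrite mulrDr !mulrBl mulrDl !mulrBr ac.
exists ((c + a + sc t) * r); rewrite mulrA -/m mr; split=> //.
have rm' : r * (c + a + sc t) * (c - a + sc t) = 1 by rewrite -mulrA -cm -/m rm.
have -> : (c + a + sc t) * r = r * (c + a + sc t).
  by rewrite -[LHS]mul1r -rm' -mulrA [(c - a + _) * _]mulrA -/m mr mulr1.
exact: rm'.
Qed.

Lemma sq_addB_sub a b :
  (a + b) * (a + b) - (a - b) * (a - b) = (a * b + b * a) + (a * b + b * a).
Proof.
have -> : (a + b) * (a + b) = a * a + b * b + (a * b + b * a).
  by rewrite mulrDr !mulrDl [a * b + b * b]addrC addrACA [b * a + _]addrC.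
have -> : (a - b) * (a - b) = a * a + b * b - (a * b + b * a).
  by rewrite mulrBr !mulrBl opprB addrACA -opprD [b * a + _]addrC.
by rewrite opprB addrC addrA subrK.
Qed.

(* Kaplansky: if [d] is the negative part of [a = x* x] and [y = x d], then
   [y* y = - d^3], hence [- y y*] is positive as well; since [y* y + y y*] is
   positive, this forces [d^3 = 0]. *)
Lemma pos_adjM x : pos (adj x * x).
Proof.
set a := adj x * x; have sa_a : sa a by exact: sa_adjM.
have [c [pc cc Cc]] := exists_sqrt (pos_sq sa_a).
have sc_ := pos_sa pc.
have ac : a * c = c * a.
  by apply: (Cgen_comm sa_a _ Cc); rewrite mulrA.
have pca : pos (c - a) by exact: le_of_sq_le.
have pca' : pos (c + a).
  rewrite -[a]opprK; apply: le_of_sq_le; rewrite ?mulrNN//; first exact: saN.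
  by rewrite mulNr mulrN ac.
have apd : a = (2^-1 : R)%:C *: (c + a) - (2^-1 : R)%:C *: (c - a).
  by rewrite -scalerBr opprB addrC addrA subrK half_dbl.
pose d := (2^-1 : R)%:C *: (c - a); pose p := (2^-1 : R)%:C *: (c + a).
have pd : pos d by apply: posZ => //; rewrite invr_ge0.
have pp : pos p by apply: posZ => //; rewrite invr_ge0.
have sd := pos_sa pd.
have pd0 : p * d = 0.
  rewrite -scalerAl -scalerAr mulrDl !mulrBr ac addrA subrK cc subrr.
  by rewrite !scaler0.
have aE : a = p - d by [].
pose y := x * d.
have yy : adj y * y = - (d * d * d).
  rewrite adjM sd mulrA -[d * adj x * x]mulrA -/a aE mulrBr mulrBl.
  by rewrite -[d * p * d]mulrA pd0 mulr0 sub0r.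
have py : pos (- (adj y * y)).
  by rewrite yy opprK; apply: posM => //; [exact: pos_sq|rewrite mulrA].
have py' := pos_opp_swap py.
have yy0 : adj y * y = 0.
  apply: pos_anti => //.
  (* Up to sign, twice the real and imaginary parts of [y], so that u^2 + v^2 is twice
     [adj y * y + y * adj y]. *)
  pose u := y + adj y; pose v := iC R *: (y - adj y).
  have pu : pos (u * u).
    by apply: pos_sq; rewrite /sa /u adjD adjK addrC.
  have pv : pos (v * v).
    by apply: pos_sq; rewrite /sa /v adjZ adjB adjK conj_iC scaleNr -scalerN opprB.
  have uv : u * u + v * v = (adj y * y + y * adj y) + (adj y * y + y * adj y).
    rewrite /v -scalerAl -scalerAr scalerA iC2 scaleN1r /u.
    by rewrite sq_addB_sub [y * _ + _]addrC.
  have -> : adj y * y = (2^-1 : R)%:C *: (u * u + v * v) - y * adj y.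
    by rewrite uv half_dbl addrK.
  by apply: posD => //; apply: posZ; [rewrite invr_ge0|exact: posD].
have d0 : d = 0.
  apply: nrm_eq0; apply/eqP; suff : nrm d ^+ 4 == 0 by rewrite expf_eq0.
  have -> : nrm d ^+ 4 = nrm (d * d * (d * d)).
    by rewrite nrm_sq ?nrm_sq ?exprM//; [rewrite -exprM|exact: saM].
  have dd0 : d * d * d = 0 by apply/oppr_inj; rewrite oppr0 -yy.
  by rewrite mulrA dd0 mul0r nrm0.
by rewrite aE d0 subr0.
Qed.

End square_root.

(** * Spectral subspaces and the conditional expectation *)

Section circle.
Context (R : realType).
Implicit Types (s t : R) (z : R[i]).

Lemma expiD s t : expi (s + t) = expi s * expi t.
Proof. by rewrite /expi cosD sinD; simpc; rewrite [cos s * sin t + _]addrC. Qed.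

Lemma expi0 : expi (0 : R) = 1.
Proof. by rewrite /expi cos0 sin0. Qed.

Lemma norm_expi t : `|expi t| = 1.
Proof. by rewrite normc_def /= cos2Dsin2 sqrtr1. Qed.

Lemma expi_neq0 t : expi t != 0.
Proof. by rewrite -normr_eq0 norm_expi oner_eq0. Qed.

Lemma expiN t : expi (- t) = (expi t)^-1.
Proof. by apply: (mulfI (expi_neq0 t)); rewrite -expiD subrr expi0 divff ?expi_neq0. Qed.

Lemma expi_conj t : conjc (expi t) = expi (- t).
Proof. by rewrite /expi cosN sinN. Qed.

Lemma expiMn t (n : nat) : expi (t *+ n) = expi t ^+ n.
Proof. by elim: n => [|n IH]; rewrite ?expi0// mulrS expiD IH exprS. Qed.

Lemma expiMz t (k : int) : expi (t *~ k) = expi t ^ k.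
Proof.
case: k => n; first by rewrite -pmulrn expiMn.
by rewrite NegzE mulrNz expiN -pmulrn expiMn -invr_expz.
Qed.

Lemma unit_expi z : `|z| = 1 -> exists t, z = expi t.
Proof.
case: z => x y; rewrite normc_def /= => /complexI xy1.
have {}xy1 : x ^+ 2 + y ^+ 2 = 1.
  by rewrite -(sqr_sqrtr (_ : 0 <= x ^+ 2 + y ^+ 2)) ?addr_ge0 ?sqr_ge0// xy1 expr1n.
have x1 : -1 <= x <= 1.
  rewrite -ler_norml -(@ler_pXn2r _ 2)// ?nnegrE// expr1n real_normK ?num_real//.
  by rewrite -xy1 lerDl sqr_ge0.
have yE : y ^+ 2 = 1 - x ^+ 2 by rewrite -xy1 addrAC subrr add0r.
have [y0|y0] := leP 0 y.
  exists (acos x); rewrite /expi acosK ?in_itv//= sin_acos// -yE.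
  by rewrite sqrtr_sqr ger0_norm.
exists (- acos x); rewrite /expi cosN sinN acosK ?in_itv//= sin_acos// -yE.
by rewrite sqrtr_sqr ltr0_norm// opprK.
Qed.

End circle.

Section star_automorphisms.
Context (R : realType) (A : cstarAlgType R).
Notation T := (cring A).
Notation sc := (sc A).
Variable f : T -> T.
Hypothesis f_aut : star_automorphism (A := A) f.
Implicit Types (a b : T) (t : R).

Lemma aut_linear (c : R[i]) a b : f (c *: a + b) = c *: f a + f b.
Proof. by case: f_aut => fl _ _ _ _; exact: fl. Qed.

Lemma autD a b : f (a + b) = f a + f b.
Proof. by have := aut_linear 1 a b; rewrite !scale1r. Qed.

Lemma aut0 : f 0 = 0.
Proof. by apply: (addIr (f 0)); rewrite add0r -autD add0r. Qed.

Lemma autZ (c : R[i]) a : f (c *: a) = c *: f a.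
Proof. by have := aut_linear c a 0; rewrite aut0 !addr0. Qed.

Lemma autB a b : f (a - b) = f a - f b.
Proof. by rewrite autD -scaleN1r autZ scaleN1r. Qed.

Lemma autM a b : f (a * b) = f a * f b.
Proof. by case: f_aut => _ fM _ _ _; exact: fM. Qed.

Lemma aut1 : f 1 = 1.
Proof. by case: f_aut. Qed.

Lemma aut_adj a : f (adj a) = adj (f a).
Proof. by case: f_aut => _ _ _ fJ _; exact: fJ. Qed.

Lemma aut_sc t : f (sc t) = sc t.
Proof. by rewrite /sc autZ aut1. Qed.

Lemma aut_pos a : pos a -> pos (f a).
Proof.
move=> /exists_sqrt[u [pu <- _]]; rewrite autM; apply: pos_sq.
by rewrite /sa -aut_adj (pos_sa pu).
Qed.

(** Roots show that [f] preserves positivity, hence the inequality between [adj a * a] and the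
    scalar nrm a ^ 2; the C*-identity turns this into a norm bound. *)
Lemma aut_contractive a : nrm (f a) <= nrm a.
Proof.
rewrite -(@ler_pXn2r _ 2)// ?nnegrE ?nrm_ge0// -!nrm_adjM -aut_adj -autM.
apply: pos_nrm_le; [exact/aut_pos/pos_adjM| |exact: nrm_ge0].
by rewrite -aut_sc -autB; apply/aut_pos/pos_scB => //; exact: sa_adjM.
Qed.

End star_automorphisms.

Section tends.
Context (R : realType) (A : cstarAlgType R).
Notation T := (cring A).
Implicit Types (a b l m : T) (u v : nat -> T).

Lemma tends_unique u l m : tends u l -> tends u m -> l = m.
Proof.
move=> ul um; apply/subr0_eq/nrm_lt_eq0 => e e0.
have [|N1 h1] := ul (e / 2); first by rewrite divr_gt0.
have [|N2 h2] := um (e / 2); first by rewrite divr_gt0.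
rewrite (le_lt_trans (nrm_trans _ (u (maxn N1 N2)) _))// [ltRHS](splitr e) ltrD//.
  by rewrite nrm_sub h1// leq_maxl.
by rewrite h2// leq_maxr.
Qed.

Lemma tends_linear (c : R[i]) u v l m : tends u l -> tends v m ->
  tends (fun n => c *: u n + v n) (c *: l + m).
Proof.
move=> ul vm e e0; pose k := complex.Re `|c| + 1.
have c0 : 0 <= complex.Re `|c|.
  by rewrite normc_def /= sqrtr_ge0.
have k0 : 0 < k by rewrite ltr_wpDl.
have [|N1 h1] := ul (e / 2 / k); first by rewrite !divr_gt0.
have [|N2 h2] := vm (e / 2); first by rewrite divr_gt0.
exists (maxn N1 N2) => n; rewrite geq_max => /andP[n1 n2].
rewrite opprD addrACA -scalerBr (le_lt_trans (nrmD _ _))// [ltRHS](splitr e) ltrD//.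
  rewrite nrmZ; have := h1 n n1; rewrite ltr_pdivlMr// => /(le_lt_trans _); apply.
  by rewrite mulrC ler_wpM2l ?nrm_ge0// /k lerDl.
exact: h2.
Qed.

Lemma tends_cst l : tends (fun=> l) l.
Proof. by move=> e e0; exists 0%N => n _; rewrite subrr nrm0. Qed.

Lemma nrm_sum (I : Type) (r : seq I) (P : pred I) (F : I -> T) :
  nrm (\sum_(i <- r | P i) F i) <= \sum_(i <- r | P i) nrm (F i).
Proof.
elim/big_ind2 : _ => [|a s b t ha hb|//]; first by rewrite nrm0.
by rewrite (le_trans (nrmD _ _))// lerD.
Qed.

End tends.

Section averages.
Context (R : realType) (A : cstarAlgType R).
Notation T := (cring A).
Notation sc := (sc A).
Variables (alpha : R -> T -> T) (gamma : R[i] -> T -> T).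
Hypothesis alpha_group : automorphism_group (A := A) alpha.
Hypothesis alpha_gamma : induces_circle_action (A := A) alpha gamma.
Implicit Types (a b : T) (s t e : R) (k l : int).

Let alpha_aut t : star_automorphism (A := A) (alpha t).
Proof. by case: alpha_group. Qed.

Let alpha0 a : alpha 0 a = a.
Proof. by case: alpha_group. Qed.

Let alphaD s t a : alpha (s + t) a = alpha s (alpha t a).
Proof. by case: alpha_group. Qed.

Lemma alpha_continuous0 a e : 0 < e ->
  exists2 d : R, 0 < d & forall t, `|t| < d -> nrm (alpha t a - a) < e.
Proof.
move=> e0; case: alpha_group => _ _ _ ac.
have /(@cvgrPdist_lt _ A _ _ _ (fun t => alpha t a) (alpha 0 a)) := ac a 0.
move=> /(_ e%:C); rewrite ltcR => /(_ e0) /nbhs_ballP [d /= d0 dP].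
exists d => // t td; have := dP t; rewrite -ball_normE /ball_ /= sub0r normrN.
move=> /(_ td); rewrite alpha0 (nrmE (a - alpha t a : T)) ltcR nrm_sub; exact.
Qed.

Lemma nrm_alpha t a : nrm (alpha t a) = nrm a.
Proof.
apply/eqP; rewrite eq_le (aut_contractive (alpha_aut t))/=.
by rewrite -{1}[a]alpha0 -(addNr t) alphaD (aut_contractive (alpha_aut _)).
Qed.

Notation Sp := (spectral_subspace (A := A) gamma).

Lemma SpP k a : Sp k a <-> forall t, alpha t a = expi t ^ k *: a.
Proof.
split=> [h t|h z /unit_expi[t ->]]; last by rewrite -h; exact/esym/alpha_gamma.
by rewrite [LHS]alpha_gamma h// norm_expi.
Qed.

Lemma Sp0P a : Sp 0 a <-> forall t, alpha t a = a.
Proof.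
by split=> [/SpP h t|h]; [rewrite h expr0z scale1r|apply/SpP => t;
  rewrite expr0z scale1r].
Qed.

Lemma SpM k l a b : Sp k a -> Sp l b -> Sp (k + l) (a * b).
Proof.
move=> /SpP ha /SpP hb; apply/SpP => t.
rewrite (autM (alpha_aut t)) ha hb -scalerAl -scalerAr scalerA.
by rewrite expfzDr// expi_neq0.
Qed.

Lemma Sp_adj k a : Sp k a -> Sp (- k) (adj a).
Proof.
move=> /SpP ha; apply/SpP => t; rewrite (aut_adj (alpha_aut t)) ha adjZ.
by rewrite -expiMz expi_conj -mulrNz expiMz.
Qed.

Lemma Sp_linear k (c : R[i]) a b : Sp k a -> Sp k b -> Sp k (c *: a + b).
Proof.
move=> /SpP ha /SpP hb; apply/SpP => t.
by rewrite (aut_linear (alpha_aut t)) ha hb scalerDr !scalerA mulrC.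
Qed.

Lemma Sp_zero k : Sp k 0.
Proof. by apply/SpP => t; rewrite (aut0 (alpha_aut t)) scaler0. Qed.

Lemma Sp_scale k (c : R[i]) a : Sp k a -> Sp k (c *: a).
Proof. by move=> ha; rewrite -[_ *: _]addr0; apply: Sp_linear => //; exact: Sp_zero. Qed.

Lemma SpD k a b : Sp k a -> Sp k b -> Sp k (a + b).
Proof. by move=> ha hb; rewrite -[a]scale1r; exact: Sp_linear. Qed.

Lemma Sp_sum k (I : Type) (r : seq I) (P : pred I) (F : I -> T) :
  (forall i, P i -> Sp k (F i)) -> Sp k (\sum_(i <- r | P i) F i).
Proof. by move=> h; apply: big_ind => //; [exact: Sp_zero|move=> a b; exact: SpD]. Qed.

Lemma Sp_closed k : nclosed (Sp k).
Proof.
move=> a h; apply/SpP => t; apply/subr0_eq/nrm_lt_eq0 => e e0.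
have [|b /SpP hb ab] := h (e / 2); first by rewrite divr_gt0.
rewrite (le_lt_trans (nrm_trans _ (alpha t b) _))// [ltRHS](splitr e) ltrD//.
  by rewrite -(autB (alpha_aut t)) nrm_alpha.
rewrite hb -scalerBr nrmZ -expiMz norm_expi (_ : complex.Re 1 = 1)// mul1r.
by rewrite nrm_sub.
Qed.

Lemma Sp0_closed : closed_star_subalgebra (Sp 0).
Proof.
split.
- by apply/Sp0P => t; exact: (aut1 (alpha_aut t)).
- by move=> c a; exact: Sp_scale.
- by move=> a b; exact: SpD.
- by move=> a b ha hb; rewrite -[0]addr0; exact: SpM.
- by move=> a /Sp_adj; rewrite oppr0.
- exact: Sp_closed.
Qed.

End averages.

Section expectation.
Context (R : realType) (A : cstarAlgType R).
Notation T := (cring A).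
Notation sc := (sc A).
Variables (alpha : R -> T -> T) (gamma : R[i] -> T -> T).
Hypothesis alpha_group : automorphism_group (A := A) alpha.
Hypothesis alpha_periodic : periodic_2pi (A := A) alpha.
Hypothesis alpha_gamma : induces_circle_action (A := A) alpha gamma.
Implicit Types (a b : T) (s t d e : R) (k l : int) (n m : nat).

Let alpha_aut t : star_automorphism (A := A) (alpha t).
Proof. by case: alpha_group. Qed.

Let alpha0 a : alpha 0 a = a.
Proof. by case: alpha_group. Qed.

Let alphaD s t a : alpha (s + t) a = alpha s (alpha t a).
Proof. by case: alpha_group. Qed.

Notation Sp := (spectral_subspace (A := A) gamma).

(* The conditional expectation is the integral of [alpha t a] over a period;
   it is obtained here as the limit of its Riemann sums. *)
Definition step n : R := 2 * pi / n%:R.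

Definition average n a : T :=
  (n%:R^-1 : R)%:C *: \sum_(0 <= k < n) alpha (k%:R * step n) a.

Lemma step_gt0 n : (0 < n)%N -> 0 < step n.
Proof. by move=> n0; rewrite divr_gt0 ?mulr_gt0 ?pi_gt0 ?ltr0n. Qed.

Lemma step_small d : 0 < d ->
  exists N, forall n, (N <= n)%N -> (0 < n)%N /\ step n < d.
Proof.
move=> d0; exists (Num.Def.truncn (2 * pi / d)).+1 => n Nn.
have n0 : (0 < n)%N by rewrite (leq_trans _ Nn).
split=> //; rewrite /step ltr_pdivrMr ?ltr0n// [d * _]mulrC -ltr_pdivrMr//.
by rewrite (lt_le_trans (truncnS_gt _))// ler_nat.
Qed.

Lemma average_linear n (c : R[i]) a b :
  average n (c *: a + b) = c *: average n a + average n b.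
Proof.
rewrite /average; under eq_bigr do rewrite (aut_linear (alpha_aut _)).
by rewrite big_split/= -scaler_sumr scalerDr !scalerA mulrC.
Qed.

(** The n m sample points form n blocks of m, each point lying within [step n] of the left end of
    its block. As [alpha] acts by isometries, continuity at 0 controls all blocks at once. Two
    averages are later compared through their common refinement. *)
Lemma average_refine a d e n m : (0 < n)%N -> (0 < m)%N -> step n < d ->
  (forall t, `|t| < d -> nrm (alpha t a - a) < e) ->
  nrm (average (n * m) a - average n a) <= e.
Proof.
move=> n0 m0 nd ad.
have n0' : n%:R != 0 :> R by rewrite pnatr_eq0 -lt0n.
have m0' : m%:R != 0 :> R by rewrite pnatr_eq0 -lt0n.
have nm0 : 0 < (n * m)%:R :> R by rewrite ltr0n muln_gt0 n0.
have -> : average n a = ((n * m)%:R^-1 : R)%:C *: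
    \sum_(0 <= k < n) \sum_(0 <= l < m) alpha (k%:R * step n) a.
  under [in RHS]eq_bigr do rewrite sumr_const_nat subn0 -scaler_nat.
  rewrite -scaler_sumr scalerA /average; congr (_ *: _).
  by rewrite natrM invfM real_complexM -mulrA -(rmorph_nat (real_complex R))
    -real_complexM mulVf// real_complex1 mulr1.
rewrite {1}/average big_nat_mul -scalerBr -sumrB.
have nm0i : 0 <= (n * m)%:R^-1 :> R by rewrite invr_ge0 ltW.
rewrite nrmZ_ge0// mulrC ler_pdivrMr//.
rewrite (le_trans (nrm_sum _ _ _))//.
have -> : e * (n * m)%:R = \sum_(0 <= k < n) e * m%:R.
  by rewrite sumr_const_nat subn0 natrM -[RHS]mulr_natr; ring.
rewrite !big_mkord; apply: ler_sum => k _.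
rewrite -{1}[(k * m)%N]add0n big_addn mulSn addnK -sumrB.
rewrite (le_trans (nrm_sum _ _ _))//.
have -> : e * m%:R = \sum_(0 <= l < m) e by rewrite sumr_const_nat subn0 mulr_natr.
rewrite !big_mkord; apply: ler_sum => l _.
have -> : (l + k * m)%N%:R * step (n * m) = k%:R * step n + l%:R * step (n * m).
  rewrite natrD mulrDl addrC; congr (_ + _).
  by rewrite /step !natrM; field; rewrite n0' m0'.
rewrite alphaD -(autB (alpha_aut _)) (nrm_alpha alpha_group) ltW// ad//.
have sn := step_gt0 n0; have snm : 0 < step (n * m) by rewrite step_gt0// muln_gt0 n0.
rewrite ger0_norm; last by apply: mulr_ge0; [exact: ler0n|exact: ltW].
rewrite (lt_trans _ nd)//.
have -> : step n = m%:R * step (n * m).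
  by rewrite /step natrM; field; rewrite n0' m0'.
by rewrite ltr_pM2r// ltr_nat.
Qed.

Lemma average_cvg a : exists b, tends (fun n => average n a) b.
Proof.
apply: tends_cauchy => e e0.
have e30 : 0 < e / 3 by lra.
have [d d0 da] := alpha_continuous0 alpha_group a e30.
have [N Nd] := step_small d0; exists N => m n Nm Nn.
have [m0 md] := Nd m Nm; have [n0 nd] := Nd n Nn.
have h1 := average_refine m0 n0 md da; rewrite nrm_sub in h1.
have h2 := average_refine n0 m0 nd da; rewrite mulnC in h2.
have := nrm_trans (average m a) (average (m * n) a) (average n a); lra.
Qed.

Lemma alpha_average a n t : alpha t (average n a) = average n (alpha t a).
Proof.
rewrite (autZ (alpha_aut t)); congr (_ *: _).
rewrite (big_morph _ (autD (alpha_aut t)) (aut0 (alpha_aut t))).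
by apply: eq_bigr => k _; rewrite -!alphaD addrC.
Qed.

(** A shift by one step permutes the sample points cyclically: periodicity identifies the last point
    with the first. *)
Lemma alpha_step_average a n m : (0 < n)%N ->
  alpha (m%:R * step n) (average n a) = average n a.
Proof.
move=> n0; elim: m => [|m IH]; first by rewrite mul0r alpha0.
rewrite -natr1 mulrDl mul1r addrC alphaD IH.
rewrite (autZ (alpha_aut _)); congr (_ *: _).
rewrite (big_morph _ (autD (alpha_aut _)) (aut0 (alpha_aut _))).
under eq_bigr do rewrite -alphaD -{1}[step n]mul1r -mulrDl nat1r.
rewrite -(big_add1 _ _ 0 n.+1 xpredT (fun j : nat => alpha (j%:R * step n) a)).
clear IH; case: n n0 => // n _; rewrite big_nat_recr//= [RHS]big_ltn// addrC;
  congr (_ + _).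
rewrite mul0r /step mulrC divfK ?pnatr_eq0// -[2 * pi]add0r.
exact: alpha_periodic.
Qed.

Lemma nrm_average a n : nrm (average n a) <= nrm a.
Proof.
have [->|n0] := posnP n.
  by rewrite /average big_geq// scaler0 nrm0 nrm_ge0.
rewrite nrmZ_ge0 ?invr_ge0 ?ler0n// mulrC ler_pdivrMr ?ltr0n//.
rewrite (le_trans (nrm_sum _ _ _))//.
under eq_bigr do rewrite (nrm_alpha alpha_group).
by rewrite sumr_const_nat subn0 mulr_natr.
Qed.

(** A time t >= 0 is a multiple of [step n], which fixes [average n a], plus a remainder below
    [step n], which moves it by little. Negative times follow by inversion. *)
Lemma expectation_invariant a b : tends (fun n => average n a) b -> Sp 0 b.
Proof.
move=> ab; apply/(Sp0P alpha_gamma).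
suff h t : 0 <= t -> alpha t b = b.
  move=> t; have [t0|t0] := leP 0 t; first exact: h.
  by rewrite -[b in LHS](h (- t)) ?oppr_ge0 ?ltW// -alphaD subrr alpha0.
move=> t0; apply/subr0_eq/nrm_lt_eq0 => e e0.
have e30 : 0 < e / 3 by lra.
have [d d0 da] := alpha_continuous0 alpha_group a e30.
have [N1 Nd] := step_small d0; have [N2 Nb] := ab _ e30.
pose n := maxn N1 N2; have [n0 nd] := Nd n (leq_maxl _ _).
have {Nb}nb := Nb n (leq_maxr _ _).
have sn := step_gt0 n0.
pose m := Num.Def.truncn (t / step n).
have [r r0 tE] : exists2 r, 0 <= r < d & t = r + m%:R * step n.
  exists (t - m%:R * step n); last by rewrite subrK.
  have := truncn_itv (divr_ge0 t0 (ltW sn)); rewrite -/m => /andP[].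
  rewrite ler_pdivlMr// ltr_pdivrMr// -natr1 mulrDl mul1r => h1 h2.
  by apply/andP; split; lra.
have {}r0 : `|r| < d by case/andP: r0 => r0 rd; rewrite ger0_norm.
have h : nrm (alpha t (average n a) - average n a) < e / 3.
  rewrite tE alphaD alpha_step_average// alpha_average.
  have -> : average n (alpha r a) - average n a = average n (alpha r a - a).
    by rewrite -scaleN1r addrC -average_linear scaleN1r addrC.
  by rewrite (le_lt_trans (nrm_average _ _))// da.
have := nrm_trans (alpha t b) (alpha t (average n a)) b.
have := nrm_trans (alpha t (average n a)) (average n a) b.
have : nrm (alpha t b - alpha t (average n a)) < e / 3.
  by rewrite -(autB (alpha_aut t) b) (nrm_alpha alpha_group) nrm_sub.
lra.
Qed.

Lemma average_Sp k a n : Sp k a -> Sp k (average n a).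
Proof.
move=> /(SpP alpha_gamma) ka.
apply: (Sp_scale alpha_group alpha_gamma); apply: (Sp_sum alpha_group alpha_gamma) => j _.
by rewrite ka; apply: (Sp_scale alpha_group alpha_gamma); apply/(SpP alpha_gamma).
Qed.

Lemma exists_expectation : exists E : T -> T,
  [/\ forall a, Sp 0 (E a), forall a, Sp 0 a -> E a = a,
      forall (c : R[i]) a b, E (c *: a + b) = c *: E a + E b,
      forall a, pos a -> pos (E a)
    & forall k a, k != 0 -> Sp k a -> E a = 0].
Proof.
have [E Ea] := choice average_cvg; exists E; split.
- by move=> a; exact: expectation_invariant (Ea a).
- move=> a /(Sp0P alpha_gamma) a0; apply: (tends_unique (Ea a)).
  move=> e e0; exists 1%N => n n0; rewrite /average.
  under eq_bigr do rewrite a0.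
  rewrite sumr_const_nat subn0 -[a *+ n]scaler_nat scalerA.
  rewrite -(rmorph_nat (real_complex R)) -real_complexM mulVf ?pnatr_eq0 -?lt0n//.
  by rewrite real_complex1 scale1r subrr nrm0.
- move=> c a b; apply: (tends_unique (Ea _)).
  have := tends_linear c (Ea a) (Ea b); congr tends.
  by apply/funext => n; rewrite average_linear.
- move=> a pa; apply: (tends_nclosed (@pos_closed _ A) (Ea a)) => n.
  apply: posZ; first by rewrite invr_ge0.
  by apply: pos_sum => k _; exact: (aut_pos (alpha_aut _)).
- move=> k a k0 ka; have kE : Sp k (E a).
    apply: (tends_nclosed (@Sp_closed _ _ _ _ alpha_group alpha_gamma k) (Ea a)) => n.
    exact: average_Sp.
  (* [E a] is invariant and also has degree [k]; at t = pi/k the latter multiplies it by -1, so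
     [E a] equals its opposite. *)
  have /(Sp0P alpha_gamma)/(_ (pi / k%:~R)) := expectation_invariant (Ea a).
  move/(SpP alpha_gamma) : kE => ->; rewrite -expiMz -mulrzl mulrC divfK ?intr_eq0//.
  rewrite /expi cospi sinpi => EE.
  have : E a + E a = 0.
    by rewrite -{1}EE (_ : -1 +i* 0 = -1) ?scaleN1r ?addNr// /GRing.opp /= oppr0.
  by move=> h; rewrite -[LHS]half_dbl h scaler0.
Qed.

End expectation.

(** * Jordan decomposition of bounded traces *)

Section real_imaginary_parts.
Context (R : realType) (A : cstarAlgType R).
Notation T := (cring A).
Notation sc := (sc A).
Implicit Types (a b : T) (s t : R).

Lemma pos_conj x a : pos a -> pos (adj x * a * x).
Proof.
move=> /exists_sqrt[u [pu <- _]].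
have -> : adj x * (u * u) * x = adj (u * x) * (u * x).
  by rewrite adjM (pos_sa pu) !mulrA.
exact: pos_adjM.
Qed.

Lemma pos_conj_sa d a : sa d -> pos a -> pos (d * a * d).
Proof. by move=> sd /(pos_conj d); rewrite sd. Qed.

Definition rpart a : T := (2^-1 : R)%:C *: (a + adj a).
Definition ipart a : T := (2^-1 : R)%:C *: (- iC R *: (a - adj a)).

Lemma sa_rpart a : sa (rpart a).
Proof. by apply: saZ; rewrite /sa adjD adjK addrC. Qed.

Lemma conj_opp_iC : conjc (- iC R) = iC R.
Proof. by rewrite -conj_iC conjcK. Qed.

Lemma sa_ipart a : sa (ipart a).
Proof.
apply: saZ; rewrite /sa adjZ adjB adjK conj_opp_iC.
by rewrite scaleNr -scalerN opprB.
Qed.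

Lemma rpart_ipart a : a = rpart a + iC R *: ipart a.
Proof.
have -> : iC R *: ipart a = (2^-1 : R)%:C *: (a - adj a).
  rewrite /ipart scalerA mulrC -scalerA; congr (_ *: _).
  by rewrite scalerA mulrN iC2 opprK scale1r.
by rewrite -scalerDr addrACA subrr addr0 half_dbl.
Qed.

Lemma nrm_rpart a : nrm (rpart a) <= nrm a.
Proof.
rewrite nrmZ_ge0 ?invr_ge0// mulrC ler_pdivrMr//.
by rewrite (le_trans (nrmD _ _))// nrm_adj; lra.
Qed.

Lemma nrm_ipart a : nrm (ipart a) <= nrm a.
Proof.
rewrite nrmZ_ge0 ?invr_ge0// scaleNr nrmN nrm_iC mulrC ler_pdivrMr//.
by rewrite (le_trans (nrmB _ _))// nrm_adj; lra.
Qed.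

Lemma rpart_sa a : sa a -> rpart a = a.
Proof. by rewrite /rpart => ->; rewrite half_dbl. Qed.

Lemma ipart_sa a : sa a -> ipart a = 0.
Proof. by rewrite /ipart => ->; rewrite subrr !scaler0. Qed.

Lemma rpartD a b : rpart (a + b) = rpart a + rpart b.
Proof. by rewrite /rpart adjD addrACA scalerDr. Qed.

Lemma ipartD a b : ipart (a + b) = ipart a + ipart b.
Proof. by rewrite /ipart adjD opprD addrACA !scalerDr. Qed.

Lemma rpartZ t a : rpart (t%:C *: a) = t%:C *: rpart a.
Proof. by rewrite /rpart adjZ conjc_real -scalerDr !scalerA mulrC. Qed.

Lemma ipartZ t a : ipart (t%:C *: a) = t%:C *: ipart a.
Proof.
by rewrite /ipart adjZ conjc_real -scalerBr !scalerA; congr (_ *: _); ring.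
Qed.

Lemma rpart_i a : rpart (iC R *: a) = - ipart a.
Proof.
rewrite /rpart /ipart adjZ conj_iC !scaleNr scalerN opprK.
by rewrite -scalerBr.
Qed.

Lemma ipart_i a : ipart (iC R *: a) = rpart a.
Proof.
rewrite /rpart /ipart adjZ conj_iC !scaleNr opprK -scalerDr.
by rewrite scalerA iC2 scaleN1r opprK.
Qed.

Lemma complex_iC (c : R[i]) : c = (complex.Re c)%:C + (complex.Im c)%:C * iC R.
Proof. by case: c => x y; rewrite /iC; simpc. Qed.

Lemma rpart_conj u a : rpart (adj u * a * u) = adj u * rpart a * u.
Proof.
by rewrite /rpart !adjM adjK -scalerAr -scalerAl mulrDr mulrDl !mulrA.
Qed.

Lemma ipart_conj u a : ipart (adj u * a * u) = adj u * ipart a * u.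
Proof.
by rewrite /ipart !adjM adjK -!scalerAr -!scalerAl mulrBr mulrBl !mulrA.
Qed.

End real_imaginary_parts.

(* An additive function on the positive cone extends to a linear functional;
   unitary invariance makes it a trace because every element is a linear
   combination of unitaries [k + i sqrt (1 - k^2)]. *)
Section cone_extension.
Context (R : realType) (A : cstarAlgType R).
Notation T := (cring A).
Notation sc := (sc A).
Implicit Types (a b h : T) (s t : R).
Variables (B : T -> Prop) (p : T -> R).
Hypothesis csB : closed_star_subalgebra B.
Hypothesis p_ge0 : forall a, B a -> pos a -> 0 <= p a.
Hypothesis pD : forall a b, B a -> B b -> pos a -> pos b -> p (a + b) = p a + p b.
Hypothesis pZ : forall t a, B a -> pos a -> 0 <= t -> p (t%:C *: a) = t * p a.
Hypothesis p_unitary : forall u a, B u -> B a -> pos a ->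
  adj u * u = 1 -> u * adj u = 1 -> p (adj u * a * u) = p a.

(** The shift by [nrm h] moves [h] into the positive cone. By [fE], every nonnegative shift that
    does so yields the same value, whence additivity and homogeneity. *)
Let f h : R := p (h + sc (nrm h)) - nrm h * p 1.

Let p_sc s : 0 <= s -> p (sc s) = s * p 1.
Proof. by move=> s0; apply: pZ => //; [exact: cs_one|rewrite -(sc1 A);
  exact: pos_sc]. Qed.

Let Bsc t : B (sc t). Proof. exact: cs_sc. Qed.

Let BDsc a t : B a -> B (a + sc t). Proof. by move=> Ba; exact: cs_add. Qed.

Let p_shift a t : B a -> pos a -> 0 <= t -> p (a + sc t) = p a + t * p 1.
Proof. by move=> Ba pa t0; rewrite pD ?p_sc//; exact: pos_sc. Qed.

Let fE h s : B h -> sa h -> 0 <= s -> pos (h + sc s) -> f h = p (h + sc s) - s * p 1.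
Proof.
move=> Bh sh s0 phs; have n0 := nrm_ge0 h.
have phn : pos (h + sc (nrm h)) by rewrite addrC; exact: pos_scD.
have := p_shift (BDsc (nrm h) Bh) phn s0; have := p_shift (BDsc s Bh) phs n0.
rewrite -!addrA -!scD [nrm h + s]addrC => ->.
rewrite /f; lra.
Qed.

Let fD h k : B h -> B k -> sa h -> sa k -> f (h + k) = f h + f k.
Proof.
move=> Bh Bk sh sk.
have ph : pos (h + sc (nrm h)) by rewrite addrC; exact: pos_scD.
have pk : pos (k + sc (nrm k)) by rewrite addrC; exact: pos_scD.
have hk : h + k + sc (nrm h + nrm k) = (h + sc (nrm h)) + (k + sc (nrm k)).
  by rewrite scD addrACA.
rewrite (fE (s := nrm h + nrm k)) ?hk ?addr_ge0 ?nrm_ge0//; last 3 first.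
- exact: cs_add.
- exact: saD.
- exact: posD.
rewrite pD//; [rewrite /f; lra|exact: BDsc|exact: BDsc].
Qed.

Let fp h : B h -> pos h -> f h = p h.
Proof.
move=> Bh ph; rewrite (fE (s := 0))//.
- by rewrite sc0 addr0 mul0r subr0.
- exact: pos_sa.
- by rewrite sc0 addr0.
Qed.

Let f0 : f 0 = 0.
Proof.
have B0 := cs_zero csB; have := fD B0 B0 (sa0 A) (sa0 A); rewrite addr0; lra.
Qed.

Let fN h : B h -> sa h -> f (- h) = - f h.
Proof.
move=> Bh sh; have := fD Bh (cs_opp csB Bh) sh (saN sh).
by rewrite subrr f0; lra.
Qed.

Let fZ t h : B h -> sa h -> f (t%:C *: h) = t * f h.
Proof.
move=> Bh sh; wlog t0 : t / 0 <= t.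
  move=> H; have [|t0] := leP 0 t; first exact: H.
  have := H (- t); rewrite oppr_ge0 (ltW t0) => /(_ isT).
  rewrite real_complexN scaleNr fN; [lra|exact: cs_scale|exact: saZ].
have ph : pos (h + sc (nrm h)) by rewrite addrC; exact: pos_scD.
have E : t%:C *: h + sc (t * nrm h) = t%:C *: (h + sc (nrm h)).
  by rewrite scalerDr scZ.
rewrite (fE (s := t * nrm h)) ?E ?mulr_ge0 ?nrm_ge0//; last 3 first.
- exact: cs_scale.
- exact: saZ.
- exact: posZ.
rewrite pZ//; [rewrite /f; lra|exact: BDsc].
Qed.

Let f_le h : B h -> sa h -> `|f h| <= p 1 * nrm h.
Proof.
move=> Bh sh; have n0 := nrm_ge0 h.
have psc := pos_sc A n0.
have fsc : f (sc (nrm h)) = nrm h * p 1 by rewrite fp// p_sc.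
have h1 : 0 <= f (sc (nrm h) + h).
  by rewrite fp; [apply: p_ge0|exact: cs_add|exact: pos_scD];
    [exact: cs_add|exact: pos_scD].
have h2 : 0 <= f (sc (nrm h) - h).
  by rewrite fp; [apply: p_ge0|exact: cs_sub|exact: pos_scB];
    [exact: cs_sub|exact: pos_scB].
move: h1 h2; rewrite (fD (Bsc _) Bh (sa_sc _ _) sh).
rewrite (fD (Bsc _) (cs_opp csB Bh) (sa_sc _ _) (saN sh)) (fN Bh sh) fsc.
by move=> h1 h2; rewrite ler_norml; apply/andP; split; lra.
Qed.

Let f_unitary u h : B u -> B h -> sa h -> adj u * u = 1 -> u * adj u = 1 ->
  f (adj u * h * u) = f h.
Proof.
move=> Bu Bh sh uu uu'; have n0 := nrm_ge0 h.
have ph : pos (h + sc (nrm h)) by rewrite addrC; exact: pos_scD.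
have E : adj u * h * u + sc (nrm h) = adj u * (h + sc (nrm h)) * u.
  by rewrite mulrDr mulrDl -comm_sc -[sc _ * adj u * u]mulrA uu mulr1.
rewrite (fE (s := nrm h)) ?E//; last 3 first.
- by do 2?apply: cs_mul => //; exact: cs_adj.
- exact: sa_conj.
- exact: pos_conj.
by rewrite p_unitary//; apply: cs_add => //; exact: cs_sc.
Qed.

Let g a : R[i] :=
  if pselect (B a) then (f (rpart a))%:C + (f (ipart a))%:C * iC R else 0.

Let Br a : B a -> B (rpart a).
Proof. by move=> Ba; apply: cs_scale => //; apply: cs_add => //; exact: cs_adj. Qed.

Let Bi a : B a -> B (ipart a).
Proof. by move=> Ba; do 2!apply: cs_scale => //; apply: cs_sub => //; exact: cs_adj. Qed.

Let gE a : B a -> g a = (f (rpart a))%:C + (f (ipart a))%:C * iC R.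
Proof. by rewrite /g; case: pselect. Qed.

Let gD a b : B a -> B b -> g (a + b) = g a + g b.
Proof.
move=> Ba Bb; rewrite !gE//; last exact: cs_add.
rewrite rpartD ipartD (fD (Br Ba) (Br Bb) (sa_rpart _) (sa_rpart _)).
by rewrite (fD (Bi Ba) (Bi Bb) (sa_ipart _) (sa_ipart _)) !real_complexD; ring.
Qed.

Let gZr t a : B a -> g (t%:C *: a) = t%:C * g a.
Proof.
move=> Ba; rewrite !gE//; last exact: cs_scale.
rewrite rpartZ ipartZ (fZ _ (Br Ba) (sa_rpart _)) (fZ _ (Bi Ba) (sa_ipart _)).
by rewrite !real_complexM; ring.
Qed.

Let gi a : B a -> g (iC R *: a) = iC R * g a.
Proof.
move=> Ba; rewrite !gE//; last exact: cs_scale.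
rewrite rpart_i ipart_i (fN (Bi Ba) (sa_ipart _)) real_complexN.
by rewrite mulrDr mulrCA iC2; ring.
Qed.

Let g_linear (c : R[i]) a b : B a -> B b -> g (c *: a + b) = c * g a + g b.
Proof.
move=> Ba Bb; rewrite gD//; last exact: cs_scale.
rewrite {1}[c]complex_iC scalerDl gD; [|exact: cs_scale|exact: cs_scale].
rewrite -scalerA !gZr// ?gi//; last exact: cs_scale.
by rewrite mulrA -mulrDl -complex_iC.
Qed.

Let g_pos a : B a -> pos a -> g a = (p a)%:C.
Proof.
move=> Ba pa; have sa_a := pos_sa pa.
by rewrite gE// rpart_sa// ipart_sa// f0 real_complex0 mul0r addr0 fp.
Qed.

Let g_unitary u b : B u -> B b -> adj u * u = 1 -> u * adj u = 1 ->
  g (u * b) = g (b * u).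
Proof.
move=> Bu Bb uu uu'; have Bub : B (u * b) by exact: cs_mul.
have -> : b * u = adj u * (u * b) * u by rewrite mulrA uu mul1r.
have Bc : B (adj u * (u * b) * u).
  by apply: cs_mul => //; apply: cs_mul => //; exact: cs_adj.
rewrite !gE// rpart_conj ipart_conj (f_unitary Bu (Br Bub) (sa_rpart _) uu uu').
by rewrite (f_unitary Bu (Bi Bub) (sa_ipart _) uu uu').
Qed.

Let g_sa h b : B h -> sa h -> B b -> g (h * b) = g (b * h).
Proof.
move=> Bh sh Bb; have n1 : 0 < nrm h + 1 by rewrite ltr_wpDl// nrm_ge0.
have [k [sk Bk k1 hE]] : exists k, [/\ sa k, B k, nrm k <= 1 & h = (nrm h + 1)%:C *: k].
  exists ((nrm h + 1)^-1%:C *: h); split; [exact: saZ|exact: cs_scale| |].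
    by rewrite nrmZ_ge0 ?invr_ge0 ?(ltW n1)// mulrC ler_pdivrMr// mul1r lerDl.
  by rewrite scalerA -real_complexM divff ?gt_eqF// real_complex1 scale1r.
have pk : pos (1 - k * k).
  rewrite -(sc1 A); apply: pos_scB; first exact: saM.
  by rewrite nrm_sq// expr_le1 ?nrm_ge0.
have [v [pv vv Cv]] := exists_sqrt pk.
have sv := pos_sa pv.
have Bv : B v by apply: Cv => //; apply: cs_sub => //; [exact: cs_one|exact: cs_mul].
have kv : k * v = v * k.
  by apply: (Cgen_comm sk _ Cv); rewrite mulrBr mulrBl mulr1 mul1r mulrA.
pose u := k + iC R *: v.
have au : adj u = k - iC R *: v by rewrite adjD adjZ sk sv conj_iC scaleNr.
have uu : adj u * u = 1.
  rewrite au /u mulrDr !mulrBl -!scalerAl -!scalerAr scalerA iC2 scaleN1r opprK.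
  by rewrite kv addrA subrK vv addrC subrK.
have uu' : u * adj u = 1.
  rewrite au /u mulrBr !mulrDl -!scalerAl -!scalerAr scalerA iC2 scaleN1r.
  by rewrite kv opprD opprK addrA addrK vv addrC subrK.
have Bu : B u by apply: cs_add => //; exact: cs_scale.
have Bau : B (adj u) by exact: cs_adj.
have kE : k = (2^-1 : R)%:C *: (u + adj u).
  by rewrite au /u addrACA subrr addr0 half_dbl.
have gk : g (k * b) = g (b * k).
  rewrite kE -scalerAl -scalerAr !gZr; last 2 first.
    by apply: cs_mul => //; exact: cs_add.
    by apply: cs_mul => //; exact: cs_add.
  rewrite mulrDl mulrDr !gD; try exact: cs_mul.
  by rewrite (g_unitary Bu)// (g_unitary Bau)// adjK.
rewrite hE; rewrite -scalerAl -scalerAr !gZr ?gk//; exact: cs_mul.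
Qed.

Lemma cone_extension : exists g : T -> R[i], [/\ bounded_trace (A := A) B g,
  forall a, B a -> pos a -> g a = (p a)%:C
  & forall a, B a -> sa a -> complex.Im (g a) = 0].
Proof.
exists g; split; [split| |].
- by move=> a; rewrite /g; case: pselect.
- exact: g_linear.
- exists (p 1 + p 1) => a Ba.
  have -> : (p 1 + p 1)%:C * `|a| = (p 1 * nrm a)%:C + (p 1 * nrm a)%:C.
    by rewrite nrmE -real_complexM mulrDl real_complexD.
  rewrite gE// (le_trans (ler_normD _ _))//.
  have le_f h : B h -> sa h -> nrm h <= nrm a -> `|(f h)%:C| <= (p 1 * nrm a)%:C :> R[i].
    move=> Bh sh ha; rewrite normc_def /= expr0n addr0 sqrtr_sqr lecR.
    rewrite (le_trans (f_le Bh sh))// ler_wpM2l// p_ge0//; first exact: cs_one.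
    by rewrite -(sc1 A); exact: pos_sc.
  rewrite lerD//; first by apply: le_f; [exact: Br|exact: sa_rpart|exact: nrm_rpart].
  have -> : `|(f (ipart a))%:C * iC R| = `|(f (ipart a))%:C|.
    have -> : `|(f (ipart a))%:C * iC R| = `|(f (ipart a))%:C| * `|iC R| by exact: normrM.
    by rewrite [`|iC R|]normc_def /= expr0n expr1n add0r sqrtr1 mulr1.
  by apply: le_f; [exact: Bi|exact: sa_ipart|exact: nrm_ipart].
- suff h (a b : T) : B a -> B b -> g (a * b) = g (b * a) by [].
  move=> Ba Bb.
  suff : g ((rpart a + iC R *: ipart a) * b) = g (b * (rpart a + iC R *: ipart a)).
    by rewrite -rpart_ipart.
  move: (Br Ba) (Bi Ba) (sa_rpart a) (sa_ipart a).
  move: (rpart a) (ipart a) => x y BrA BiA sx sy.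
  rewrite mulrDl mulrDr -scalerAl -scalerAr.
  have := cs_mul csB; have := cs_scale csB => csZ csM.
  rewrite (gD (csM _ _ BrA Bb) (csZ _ _ (csM _ _ BiA Bb))).
  rewrite (gD (csM _ _ Bb BrA) (csZ _ _ (csM _ _ Bb BiA))).
  rewrite (gi (csM _ _ BiA Bb)) (gi (csM _ _ Bb BiA)).
  by rewrite (g_sa BrA sx Bb) (g_sa BiA sy Bb).
- exact: g_pos.
- move=> a Ba sa_a; rewrite gE// ipart_sa// f0 real_complex0 mul0r addr0//.
Qed.

End cone_extension.

Section traces.
Context (R : realType) (A : cstarAlgType R).
Notation T := (cring A).
Variables (B : T -> Prop) (g : T -> R[i]).
Hypothesis csB : closed_star_subalgebra B.
Hypothesis g_trace : bounded_trace (A := A) B g.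
Implicit Types (a b : T).

Lemma trace_linear (c : R[i]) a b : B a -> B b -> g (c *: a + b) = c * g a + g b.
Proof. by case: g_trace => _ gl _ _; exact: gl. Qed.

Lemma trace_mulC a b : B a -> B b -> g (a * b) = g (b * a).
Proof. by case: g_trace => _ _ _ gM; exact: gM. Qed.

Lemma trace_out a : ~ B a -> g a = 0.
Proof. by case: g_trace => g0 _ _ _; exact: g0. Qed.

Lemma traceD a b : B a -> B b -> g (a + b) = g a + g b.
Proof. by move=> Ba Bb; have := trace_linear 1 Ba Bb; rewrite scale1r mul1r. Qed.

Lemma trace_0 : g 0 = 0.
Proof.
have B0 := cs_zero csB; have := traceD B0 B0; rewrite addr0 => /eqP.
by rewrite -subr_eq subrr => /eqP.
Qed.

Lemma traceZ (c : R[i]) a : B a -> g (c *: a) = c * g a.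
Proof.
by move=> Ba; have := trace_linear c Ba (cs_zero csB); rewrite trace_0 !addr0.
Qed.

Lemma traceB a b : B a -> B b -> g (a - b) = g a - g b.
Proof.
move=> Ba Bb; rewrite traceD//; last exact: cs_opp.
by rewrite -scaleN1r traceZ// mulN1r.
Qed.

Lemma trace_sum (I : Type) (r : seq I) (F : I -> T) : (forall i, B (F i)) ->
  g (\sum_(i <- r) F i) = \sum_(i <- r) g (F i).
Proof.
move=> BF; elim: r => [|i r IH]; first by rewrite !big_nil trace_0.
by rewrite !big_cons traceD ?IH//; exact: cs_sum.
Qed.

End traces.

Section jordan.
Context (R : realType) (A : cstarAlgType R).
Notation T := (cring A).
Notation sc := (sc A).
Implicit Types (a b h : T) (s t e : R).
Variables (B : T -> Prop).
Hypothesis csB : closed_star_subalgebra B.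

Definition positive_trace (g : T -> R[i]) : Prop :=
  bounded_trace (A := A) B g /\ forall a, B a -> pos a -> 0 <= g a.

Variables (phi : T -> R) (M : R).
Hypothesis phiD : forall a b, B a -> B b -> phi (a + b) = phi a + phi b.
Hypothesis phiZ : forall t a, B a -> phi (t%:C *: a) = t * phi a.
Hypothesis phiM : forall a b, B a -> B b -> phi (a * b) = phi (b * a).
Hypothesis phi_le : forall a, B a -> `|phi a| <= M * nrm a.

(* The positive part of [phi] on the positive cone. *)
Let below a : set T := [set b | [/\ B b, pos b & pos (a - b)]].

Let p a : R := sup (phi @` below a).

Let phi0 : phi 0 = 0.
Proof. by have := phiZ 0 (cs_zero csB); rewrite scaler0 mul0r. Qed.

Let phi_le1 a : B a -> phi a <= M * nrm a.
Proof. by move=> /phi_le; rewrite ler_norml => /andP[]. Qed.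

Let M0 : 0 <= M.
Proof. by have := phi_le (cs_one csB); rewrite nrm1 mulr1; exact: le_trans. Qed.

Let phi_has_sup a : B a -> pos a -> has_sup (phi @` below a).
Proof.
move=> Ba pa; split.
  exists (phi 0), 0 => //; split; [exact: cs_zero|exact: pos0|by rewrite subr0].
exists (M * nrm a) => _ [b [Bb pb pab] <-].
by rewrite (le_trans (phi_le1 Bb))// ler_wpM2l// pos_mono.
Qed.

Let p_ub a b : B a -> pos a -> B b -> pos b -> pos (a - b) -> phi b <= p a.
Proof.
move=> Ba pa Bb pb pab; apply: sup_ubound; last by exists b.
by case: (phi_has_sup Ba pa).
Qed.

Let p_le a x : B a -> pos a ->
  (forall b, B b -> pos b -> pos (a - b) -> phi b <= x) -> p a <= x.
Proof.
move=> Ba pa h; apply: ge_sup; first by case: (phi_has_sup Ba pa).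
by move=> _ [b [Bb pb pab] <-]; exact: h.
Qed.

Let p_ge0 a : B a -> pos a -> 0 <= p a.
Proof.
move=> Ba pa; rewrite -phi0; apply: p_ub => //.
- exact: cs_zero.
- exact: pos0.
- by rewrite subr0.
Qed.

Let p_ge_phi a : B a -> pos a -> phi a <= p a.
Proof. by move=> Ba pa; apply: p_ub => //; rewrite subrr; exact: pos0. Qed.

Let p_1 : p 1 <= M.
Proof.
have p1 : pos (1 : T) by rewrite -(sc1 A); exact: pos_sc.
apply: p_le => //; first exact: cs_one.
move=> b Bb pb pb1; rewrite (le_trans (phi_le1 Bb))// -[leRHS]mulr1 ler_wpM2l//.
by rewrite -(nrm1 A) pos_mono.
Qed.

Let pZ t a : B a -> pos a -> 0 <= t -> p (t%:C *: a) = t * p a.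
Proof.
have le s b : B b -> pos b -> 0 < s -> s * p b <= p (s%:C *: b).
  move=> Bb pb s0; rewrite mulrC -ler_pdivlMr//; apply: p_le => // c Bc pc pbc.
  rewrite ler_pdivlMr// mulrC -phiZ//; apply: p_ub.
  - exact: cs_scale.
  - by apply: posZ => //; exact: ltW.
  - exact: cs_scale.
  - by apply: posZ => //; exact: ltW.
  - by rewrite -scalerBr; apply: posZ => //; exact: ltW.
move=> Ba pa; rewrite le_eqVlt => /orP[/eqP<-|t0].
  rewrite mul0r real_complex0 scale0r; apply/eqP; rewrite eq_le p_ge0 ?andbT;
    last 2 first.
  - exact: cs_zero.
  - exact: pos0.
  apply: p_le => [||b Bb pb p0b]; [exact: cs_zero|exact: pos0|].
  by rewrite (pos_anti pb) ?phi0// -sub0r.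
apply/eqP; rewrite eq_le le// andbT.
rewrite -ler_pdivrMl//.
have := @le t^-1 (t%:C *: a); rewrite scalerA -real_complexM mulVf ?gt_eqF//.
rewrite real_complex1 scale1r; apply; [exact: cs_scale|apply: posZ => //; exact: ltW|].
by rewrite invr_gt0.
Qed.

Let p_unitary u a : B u -> B a -> pos a ->
  adj u * u = 1 -> u * adj u = 1 -> p (adj u * a * u) = p a.
Proof.
have le v b : B v -> B b -> pos b -> adj v * v = 1 -> v * adj v = 1 ->
    p b <= p (adj v * b * v).
  move=> Bv Bb pb vv vv'; have Bav := cs_adj csB Bv.
  apply: p_le => // c Bc pc pbc.
  have Bc' : B (adj v * c * v) by apply: cs_mul => //; exact: cs_mul.
  have -> : phi c = phi (adj v * c * v).
    by rewrite -mulrA (phiM Bav (cs_mul csB Bc Bv)) -mulrA vv' mulr1.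
  apply: p_ub => //; [|exact: pos_conj|exact: pos_conj|].
    by apply: cs_mul => //; exact: cs_mul.
  by rewrite -mulrBl -mulrBr; exact: pos_conj.
move=> Bu Ba pa uu uu'; apply/eqP; rewrite eq_le le// andbT.
have Bau := cs_adj csB Bu.
rewrite (le_trans (le (adj u) _ _ _ _ _ _))//; rewrite ?adjK//.
- by apply: cs_mul => //; exact: cs_mul.
- exact: pos_conj.
- by rewrite !mulrA uu' mul1r -mulrA uu' mulr1.
Qed.

(* If [c <= a + b], put [v = sqrt c] and [d = (a + b + e)^(-1/2)].  Then
   [c = v d (a + b) d v + e v d^2 v], and the trace property moves
   [v d a d v] to [sqrt a (d c d) (sqrt a)], which is below [a] since
   [d c d <= 1]; likewise for [b]. *)
Let p_add_le a b : B a -> B b -> pos a -> pos b -> p (a + b) <= p a + p b.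
Proof.
move=> Ba Bb pa pb; have Bab := cs_add csB Ba Bb; have pab := posD pa pb.
apply: p_le => // c Bc pc pabc.
apply/ler_addgt0Pr => e' e'0; pose e := e' / (M + 1).
have M1 : 0 < M + 1 by rewrite ltr_wpDl.
have e0 : 0 < e by rewrite divr_gt0.
have eM : e * M <= e'.
  have : e * (M + 1) = e' by rewrite divfK// gt_eqF.
  by lra.
pose k := a + b + sc e.
have [||k' [pk' kk' k'k Ck']] := @exists_inv _ A k e; [by rewrite addrK|by []|].
have [d [pd dd Cd]] := exists_sqrt pk'.
have sd := pos_sa pd; have sk : sa k by apply: saD; [exact: pos_sa|exact: sa_sc].
have Bsc t : B (sc t) by exact: cs_sc.
have Bk : B k by exact: cs_add.
have Bd : B d by apply: Cd => //; exact: Ck'.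
have kd : k * d = d * k.
  by apply: (Cgen_comm sk _ Cd); rewrite kk' k'k.
have dkd : d * k * d = 1 by rewrite -kd -mulrA dd.
have [v [pv vv Cv]] := exists_sqrt pc; have sv := pos_sa pv.
have Bv : B v by exact: Cv.
have pdc : pos (1 - d * c * d).
  rewrite -dkd -mulrBl -mulrBr; apply: pos_conj_sa => //.
  by rewrite /k addrAC; apply: posD => //; apply: pos_sc; exact: ltW.
have part x : B x -> pos x -> phi (v * d * x * (d * v)) <= p x.
  move=> Bx px; have [w [pw ww Cw]] := exists_sqrt px; have sw := pos_sa pw.
  have Bw : B w by exact: Cw.
  have -> : phi (v * d * x * (d * v)) = phi (w * (d * c * d) * w).
    have Bvdw : B (v * d * w) by do 2!apply: cs_mul => //.
    have Bwdv : B (w * (d * v)) by do 2!apply: cs_mul => //.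
    have -> : v * d * x * (d * v) = v * d * w * (w * (d * v)) by rewrite -ww !mulrA.
    by rewrite phiM// -vv !mulrA.
  apply: p_ub => //.
  - by do 4!apply: cs_mul => //.
  - by apply: pos_conj_sa => //; exact: pos_conj_sa.
  - have -> : x - w * (d * c * d) * w = w * (1 - d * c * d) * w.
      by rewrite mulrBr mulrBl mulr1 ww.
    exact: pos_conj_sa.
have Bvd : B (v * d) by exact: cs_mul.
have Bdv : B (d * v) by exact: cs_mul.
have cE : c = v * d * a * (d * v) + v * d * b * (d * v) + e%:C *: (v * d * (d * v)).
  rewrite -mulrDl -mulrDr -[e%:C *: _]scMl -mulrA.
  rewrite (_ : sc e * (v * d * (d * v)) = v * d * (sc e * (d * v))); last first.
    by rewrite mulrA comm_sc -mulrA.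
  rewrite -mulrDr -mulrDl -/k -vv.
  by rewrite !mulrA -[v * d * k]mulrA -[v * (d * k) * d]mulrA dkd mulr1.
rewrite {1}cE !phiD ?phiZ; do ?[apply: cs_add => //]; do ?[apply: cs_scale => //];
  do ?[apply: cs_mul => //].
apply: lerD; first by rewrite lerD// part.
rewrite (le_trans _ eM)// ler_wpM2l ?(ltW e0)//.
have Bx : B (v * d * (d * v)) by exact: cs_mul.
rewrite (le_trans (phi_le1 Bx))// -[leRHS]mulr1 ler_wpM2l//.
have -> : v * d * (d * v) = adj (d * v) * (d * v) by rewrite adjM sd sv.
(* The norm of (d v)^*(d v) is nrm (d v) ^ 2 = nrm (v d) ^ 2 = nrm (d c d), and d c d <= 1. *)
rewrite nrm_adjM -nrm_adj adjM sd sv -nrm_adjM adjM sd sv.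
have -> : d * v * (v * d) = d * c * d by rewrite -vv !mulrA.
rewrite -(nrm1 A); apply: pos_mono => //; exact: pos_conj_sa.
Qed.

Let pD a b : B a -> B b -> pos a -> pos b -> p (a + b) = p a + p b.
Proof.
move=> Ba Bb pa pb; apply/eqP; rewrite eq_le p_add_le//=.
rewrite -lerBrDr; apply: p_le => // a' Ba' pa' paa'.
rewrite lerBrDr -lerBrDl; apply: p_le => // b' Bb' pb' pbb'.
rewrite lerBrDl -phiD//; apply: p_ub.
- exact: cs_add.
- exact: posD.
- exact: cs_add.
- exact: posD.
- by rewrite opprD addrACA; exact: posD.
Qed.

(** The decomposition is phi = p - (p - phi), where both terms are nonnegative, additive and
    unitarily invariant on the cone, so that [cone_extension] makes traces of them. The bounds are
    those of p 1 and of p 1 - phi 1. The functional [phi] will be the real or the imaginary part of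
    a trace. *)
Lemma jordan_decomposition : exists g1 g2 : T -> R[i],
  [/\ positive_trace g1, positive_trace g2,
      g1 1 <= M%:C, g2 1 <= (M + M)%:C
    & forall h, B h -> sa h -> (phi h)%:C = g1 h - g2 h].
Proof.
have B1 := cs_one csB; have p1 : pos (1 : T) by rewrite -(sc1 A); exact: pos_sc.
have [g1 [g1t g1p _]] := cone_extension csB p_ge0 pD pZ p_unitary.
have [|||| g2 [g2t g2p _]] := @cone_extension _ A B (fun a => p a - phi a) csB.
- by move=> a Ba pa; rewrite subr_ge0 p_ge_phi.
- by move=> a b Ba Bb pa pb; rewrite pD// phiD//; lra.
- by move=> t a Ba pa t0; rewrite pZ// phiZ//; lra.
- move=> u a Bu Ba pa uu uu'; rewrite p_unitary//; congr (_ - _).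
  have Bau := cs_adj csB Bu.
  by rewrite -mulrA (phiM Bau (cs_mul csB Ba Bu)) -mulrA uu' mulr1.
exists g1, g2; split.
- by split=> // a Ba pa; rewrite g1p// ler0c p_ge0.
- by split=> // a Ba pa; rewrite g2p// ler0c subr_ge0 p_ge_phi.
- by rewrite g1p// lecR.
- by rewrite g2p// lecR; have := phi_le B1; rewrite nrm1 ler_norml; move: p_1; lra.
move=> h Bh sh; have phn : pos (h + sc (nrm h)) by rewrite addrC; exact: pos_scD.
have Bhn : B (h + sc (nrm h)) by apply: cs_add => //; exact: cs_sc.
have split (g : T -> R[i]) : bounded_trace (A := A) B g ->
    g h = g (h + sc (nrm h)) - (nrm h)%:C * g 1.
  by move=> gt; rewrite -(traceZ csB gt)// -(traceB csB gt) ?addrK//; exact: cs_scale.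
rewrite (split g1)// (split g2)// !g1p// !g2p// phiD ?phiZ//; last exact: cs_sc.
by rewrite !(real_complexB, real_complexD, real_complexM); ring.
Qed.

End jordan.

(** * Limits of traces *)

Section complex_modulus.
Context (R : realType).
Implicit Types (c d : R[i]) (t : R).

Definition cabs c : R := complex.Re `|c|.

Lemma cabsE c : `|c| = (cabs c)%:C.
Proof. by rewrite /cabs RRe_real// ger0_real. Qed.

Lemma cabs_ge0 c : 0 <= cabs c.
Proof. by rewrite -ler0c -cabsE. Qed.

Lemma cabs0 : cabs 0 = 0.
Proof. by rewrite /cabs normr0. Qed.

Lemma cabs1 : cabs 1 = 1.
Proof. by rewrite /cabs normr1. Qed.

Lemma cabs_eq0 c : (cabs c == 0) = (c == 0).
Proof. by rewrite -[RHS]normr_eq0 cabsE -real_complex0 (inj_eq (@complexI _)). Qed.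

Lemma cabsD c d : cabs (c + d) <= cabs c + cabs d.
Proof. by rewrite -lecR real_complexD -!cabsE; exact: ler_normD. Qed.

Lemma cabsN c : cabs (- c) = cabs c.
Proof. by rewrite /cabs normrN. Qed.

Lemma cabsB c d : cabs (c - d) <= cabs c + cabs d.
Proof. by rewrite -[cabs d]cabsN cabsD. Qed.

Lemma cabs_sub c d : cabs (c - d) = cabs (d - c).
Proof. by rewrite -cabsN opprB. Qed.

Lemma cabsM c d : cabs (c * d) = cabs c * cabs d.
Proof. by apply: complexI; rewrite real_complexM -!cabsE normrM. Qed.

Lemma cabsX c n : cabs (c ^+ n) = cabs c ^+ n.
Proof. by elim: n => [|n IH]; rewrite ?cabs1// !exprS cabsM IH. Qed.

Lemma cabsV c : cabs c^-1 = (cabs c)^-1.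
Proof. by apply: complexI; rewrite real_complexV -!cabsE normfV. Qed.

Lemma cabs_real t : cabs t%:C = `|t|.
Proof. by rewrite /cabs normc_def /= expr0n addr0 sqrtr_sqr. Qed.

Lemma cabs_iC : cabs (iC R) = 1.
Proof. exact: norm_iC. Qed.

Lemma cabs_Re c : `|complex.Re c| <= cabs c.
Proof. by rewrite -lecR -cabsE normc_ge_Re. Qed.

Lemma cabs_Im c : `|complex.Im c| <= cabs c.
Proof.
have -> : complex.Im c = complex.Re (- iC R * c).
  by case: c => x y; rewrite /iC; simpc.
by rewrite (le_trans (cabs_Re _))// cabsM cabsN cabs_iC mul1r.
Qed.

Lemma cabs_le c : cabs c <= `|complex.Re c| + `|complex.Im c|.
Proof.
rewrite {1}[c]complex_iC (le_trans (cabsD _ _))// cabsM cabs_iC mulr1.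
by rewrite !cabs_real.
Qed.

Lemma cabs_ge0_id c : 0 <= c -> c = (cabs c)%:C.
Proof. by move=> /ger0_norm <-; rewrite -cabsE normr_id. Qed.

Lemma cabs_sum (I : Type) (r : seq I) (F : I -> R[i]) :
  cabs (\sum_(i <- r) F i) <= \sum_(i <- r) cabs (F i).
Proof.
elim/big_ind2 : _ => [|a s b t ha hb|//]; first by rewrite cabs0.
by rewrite (le_trans (cabsD _ _))// lerD.
Qed.

Lemma cabs_lt_eq0 c : (forall e : R, 0 < e -> cabs c < e) -> c = 0.
Proof.
move=> h; apply/eqP; rewrite -cabs_eq0 eq_le cabs_ge0 andbT.
by apply/ler_addgt0Pr => e e0; rewrite add0r ltW// h.
Qed.

Definition ctends (u : nat -> R[i]) l : Prop :=
  forall e : R, 0 < e -> exists N, forall n, (N <= n)%N -> cabs (u n - l) < e.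

Definition cbounded (u : nat -> R[i]) : Prop := exists M, forall n, cabs (u n) <= M.

(* Evaluated along traces, a generalized limit replaces the weak*-compactness
   of the set of tracial states. *)
Record generalized_limit (L : (nat -> R[i]) -> R[i]) : Prop := {
  gl_linear : forall c u v, cbounded u -> cbounded v ->
    L (fun n => c * u n + v n) = c * L u + L v;
  gl_le : forall u M, (forall n, cabs (u n) <= M) -> cabs (L u) <= M;
  gl_lim : forall u l, ctends u l -> cbounded u -> L u = l;
  gl_ge0 : forall u, cbounded u -> (forall n, 0 <= u n) -> 0 <= L u
}.

Section ultrafilter.
Variable U : set_system nat.
Hypothesis U_ultra : UltraFilter U.
Hypothesis U_oo : \oo `<=` U.

Let ulimit (u : nat -> R[i]) l : Prop :=
  forall e : R, 0 < e -> U [set n | cabs (u n - l) < e].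

Let UI (P Q : set nat) : U P -> U Q -> U (P `&` Q).
Proof. by move=> UP UQ; apply: filterI. Qed.

Let US (P Q : set nat) : P `<=` Q -> U P -> U Q.
Proof. by move=> PQ; apply: filterS. Qed.

Let UT : U setT. Proof. exact: filterT. Qed.

Let Uex (P : set nat) : U P -> exists n, P n.
Proof. by move=> /filter_ex. Qed.

(** The limit is the supremum of the x with x <= u n for [U]-many n. Above it, the ultrafilter
    property gives the complementary inequality for [U]-many n. *)
Let ultra_real (u : nat -> R) M : (forall n, `|u n| <= M) ->
  exists l, forall e, 0 < e -> U [set n | `|u n - l| < e].
Proof.
move=> uM; pose X := [set x : R | U [set n | x <= u n]].
have Xs : has_sup X.
  split.
    exists (- M); rewrite /X /=; apply: US UT => n _ /=.
    by have := uM n; rewrite ler_norml => /andP[].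
  exists M => x /Uex[n /= xn]; rewrite (le_trans xn)//.
  by have := uM n; rewrite ler_norml => /andP[].
exists (sup X) => e e0.
have [x Xx xe] := sup_adherent e0 Xs.
have nX : ~ X (sup X + e / 2).
  move=> Xe; have := sup_ubound (proj2 Xs) Xe; lra.
have [/nX//|Xc] := in_ultra_setVsetC [set n | sup X + e / 2 <= u n] U_ultra.
apply: US (UI Xx Xc) => n [/= h1 /negP]; rewrite -ltNge => h2.
by rewrite ltr_norml; apply/andP; split; lra.
Qed.

Let ulimit_ex u : cbounded u -> exists l, ulimit u l.
Proof.
move=> [M uM].
have [|x xP] := @ultra_real (fun n => complex.Re (u n)) M.
  by move=> n; rewrite (le_trans (cabs_Re _)).
have [|y yP] := @ultra_real (fun n => complex.Im (u n)) M.
  by move=> n; rewrite (le_trans (cabs_Im _)).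
exists (x +i* y) => e e0; have e20 : 0 < e / 2 by rewrite divr_gt0.
apply: US (UI (xP _ e20) (yP _ e20)) => n [/= h1 h2].
rewrite (le_lt_trans (cabs_le _))// [ltRHS](splitr e).
by move: h1 h2; case: (u n) => a b /= h1 h2; rewrite ltrD.
Qed.

Let ulimit_unique u l m : ulimit u l -> ulimit u m -> l = m.
Proof.
move=> ul um; apply/subr0_eq/cabs_lt_eq0 => e e0.
have e20 : 0 < e / 2 by rewrite divr_gt0.
have [n [/= h1 h2]] := Uex (UI (ul _ e20) (um _ e20)).
have -> : l - m = (u n - m) - (u n - l) by ring.
by rewrite (le_lt_trans (cabsB _ _))// [ltRHS](splitr e) ltrD.
Qed.

Let L u : R[i] := if pselect (exists l, ulimit u l) is left h then projT1 (cid h) else 0.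

Let LP u : cbounded u -> ulimit u (L u).
Proof.
move=> /ulimit_ex h; rewrite /L; case: pselect => // h'.
by case: cid.
Qed.

Let generalized_limit_ultra : generalized_limit L.
Proof.
split.
- move=> c u v bu bv; apply: (ulimit_unique (LP _)).
    case: bu => M uM; case: bv => N vN; exists (cabs c * M + N) => n.
    by rewrite (le_trans (cabsD _ _))// cabsM lerD// ler_wpM2l ?cabs_ge0.
  move=> e e0; have k0 : 0 < cabs c + 1 by rewrite ltr_wpDl// cabs_ge0.
  have e1 : 0 < e / 2 / (cabs c + 1) by rewrite !divr_gt0.
  have e2 : 0 < e / 2 by rewrite divr_gt0.
  apply: US (UI (LP bu e1) (LP bv e2)) => n [/=]; rewrite ltr_pdivlMr// => h1 h2.
  have -> : c * u n + v n - (c * L u + L v) = c * (u n - L u) + (v n - L v) by ring.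
  rewrite (le_lt_trans (cabsD _ _))// [ltRHS](splitr e) ltrD// cabsM.
  by rewrite (le_lt_trans _ h1)// mulrC ler_wpM2l ?cabs_ge0// lerDl.
- move=> u M uM; have bu : cbounded u by exists M.
  apply/ler_addgt0Pr => e e0; have [n /= h] := Uex (LP bu e0).
  have -> : L u = u n - (u n - L u) by ring.
  by rewrite (le_trans (cabsB _ _))// lerD// ltW.
- move=> u l ul bu; apply: (ulimit_unique (LP bu)) => e /ul[N Nu].
  by apply: U_oo; exists N => // n /=; exact: Nu.
- move=> u bu u0; have h e : 0 < e -> exists2 c, 0 <= c & cabs (c - L u) < e.
    by move=> e0; have [n hn] := Uex (LP bu e0); exists (u n).
  have im0 : complex.Im (L u) = 0.
    apply/eqP; rewrite -normr_eq0 eq_le normr_ge0 andbT.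
    apply/ler_addgt0Pr => e /h[c c0 ce]; rewrite add0r (le_trans _ (ltW ce))//.
    rewrite (le_trans _ (cabs_Im _))//; move: (ger0_Im c0).
    by case: (c) (L u) => a b [a' b'] /= ->; rewrite sub0r normrN.
  have re0 : 0 <= complex.Re (L u).
    rewrite leNgt; apply/negP => rn; have [|c c0 ce] := h (- complex.Re (L u)).
      by rewrite oppr_gt0.
    have := le_lt_trans (cabs_Re _) ce; move: c0 rn; rewrite lecE.
    case: (c) (L u) => a b [a' b'] /= /andP[_ a0] a'0.
    by rewrite ger0_norm; lra.
  by rewrite lecE im0 eqxx re0.
Qed.

Lemma ultrafilter_limit : exists L, generalized_limit L.
Proof. by exists L; exact: generalized_limit_ultra. Qed.

End ultrafilter.

(** An ultrafilter refining [\oo] is used, so that its limits extend the ordinary ones. *)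
Lemma exists_generalized_limit : exists L, generalized_limit L.
Proof.
have [U [U_ultra U_oo]] := ultraFilterLemma eventually_filter.
exact: (ultrafilter_limit U_ultra U_oo).
Qed.

End complex_modulus.

Section trace_limits.
Context (R : realType) (A : cstarAlgType R).
Notation T := (cring A).
Notation sc := (sc A).
Variables (B : T -> Prop) (L : (nat -> R[i]) -> R[i]).
Hypothesis csB : closed_star_subalgebra B.
Hypothesis gL : generalized_limit L.
Implicit Types (a b : T) (M : R) (tau : T -> R[i]).

Notation trace := (bounded_trace (A := A) B).

Lemma bounded_traceP tau : trace tau <->
  [/\ forall a, ~ B a -> tau a = 0,
      forall (c : R[i]) a b, B a -> B b -> tau (c *: a + b) = c * tau a + tau b,
      exists M : R, forall a, B a -> cabs (tau a) <= M * nrm a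
    & forall a b, B a -> B b -> tau (a * b) = tau (b * a)].
Proof.
split=> [[h1 h2 [M h3] h4]|[h1 h2 [M h3] h4]]; split=> //; exists M => a /h3.
  by rewrite cabsE nrmE -real_complexM lecR.
by rewrite cabsE nrmE -real_complexM lecR.
Qed.

Lemma trace_limit (tau : nat -> T -> R[i]) M : (forall n, trace (tau n)) ->
  (forall n a, B a -> cabs (tau n a) <= M * nrm a) ->
  trace (fun a => L (fun n => tau n a)) /\
  forall a, B a -> cabs (L (fun n => tau n a)) <= M * nrm a.
Proof.
move=> tt tM; have bt a : cbounded (fun n => tau n a).
  have [Ba|nBa] := pselect (B a); first by exists (M * nrm a) => n; exact: tM.
  by exists 0 => n; rewrite (trace_out (tt n) nBa) cabs0.
have le a : B a -> cabs (L (fun n => tau n a)) <= M * nrm a.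
  by move=> Ba; apply: (gl_le gL) => n; exact: tM.
split=> //; apply/bounded_traceP; split.
- move=> a nBa; apply: (gl_lim gL) (bt a) => e e0; exists 0%N => n _.
  by rewrite (trace_out (tt n) nBa) subrr cabs0.
- move=> c a b Ba Bb; rewrite -(gl_linear gL)//; congr L; apply/funext => n.
  by rewrite (trace_linear (tt n)).
- by exists M.
- move=> a b Ba Bb; congr L; apply/funext => n; by rewrite (trace_mulC (tt n)).
Qed.

Lemma trace_combination (c : R[i]) tau tau' : trace tau -> trace tau' ->
  trace (fun a => c * tau a + tau' a).
Proof.
move=> tt tt'; have [h1 h2 [M h3] h4] := (bounded_traceP tau).1 tt.
have [h1' h2' [M' h3'] h4'] := (bounded_traceP tau').1 tt'.
apply/bounded_traceP; split.
- by move=> a nBa; rewrite h1// h1'// mulr0 addr0.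
- by move=> d a b Ba Bb; rewrite h2// h2'//; ring.
- exists (cabs c * M + M') => a Ba; rewrite (le_trans (cabsD _ _))// cabsM mulrDl.
  by rewrite lerD ?h3'// -mulrA ler_wpM2l ?cabs_ge0 ?h3.
- by move=> a b Ba Bb; rewrite h4// h4'.
Qed.

Lemma trace_zero : trace (fun=> 0).
Proof.
apply/bounded_traceP; split=> //; first by move=> c a b _ _; rewrite mulr0 addr0.
by exists 0 => a _; rewrite cabs0 mul0r.
Qed.

Lemma trace_scale (c : R[i]) tau : trace tau -> trace (fun a => c * tau a).
Proof.
move=> tt; have := trace_combination c tt trace_zero; congr (trace _).
by apply/funext => a; rewrite addr0.
Qed.

Lemma trace_sum_fun (I : Type) (r : seq I) (F : I -> T -> R[i]) :
  (forall i, trace (F i)) -> trace (fun a => \sum_(i <- r) F i a).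
Proof.
move=> tF; elim: r => [|i r IH].
  by have := trace_zero; congr (trace _); apply/funext => a; rewrite big_nil.
have := trace_combination 1 (tF i) IH; congr (trace _).
by apply/funext => a; rewrite big_cons mul1r.
Qed.

Notation tn := (trace_norm (A := A) B).

Let tn_has_sup tau : trace tau ->
  has_sup [set complex.Re `|tau a| | a in [set a | B a /\ `|a : A| <= 1]].
Proof.
move=> tt; have [_ _ [M tM] _] := (bounded_traceP tau).1 tt; split.
  by exists (cabs (tau 0)), 0 => //; split; [exact: cs_zero|rewrite normr0].
exists `|M| => _ [a [Ba a1] <-]; rewrite -/(cabs _) (le_trans (tM a Ba))//.
move: a1; rewrite (nrmE (a : T)) -real_complex1 lecR => a1.
rewrite (le_trans (ler_norm _))// normrM [`|nrm a|]ger0_norm ?nrm_ge0//.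
by rewrite -[leRHS]mulr1 ler_wpM2l.
Qed.

Lemma le_trace_norm tau a : trace tau -> B a -> cabs (tau a) <= tn tau * nrm a.
Proof.
move=> tt Ba; have [a0|a0] := eqVneq (nrm a) 0.
  by rewrite (nrm_eq0 a0) (trace_0 csB tt) cabs0 nrm0 mulr0.
have an : 0 < nrm a by rewrite lt_def a0 nrm_ge0.
have {1}-> : a = (nrm a)%:C *: ((nrm a)^-1%:C *: a).
  by rewrite scalerA -real_complexM divff// real_complex1 scale1r.
rewrite (traceZ csB tt); last exact: cs_scale.
rewrite cabsM cabs_real ger0_norm ?nrm_ge0// mulrC ler_pM2r//.
apply: sup_ubound; first by case: (tn_has_sup tt).
exists ((nrm a)^-1%:C *: a) => //; split; first exact: cs_scale.
by rewrite nrmE -real_complex1 lecR nrmZ_ge0 ?invr_ge0 ?nrm_ge0// mulVf.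
Qed.

Lemma trace_norm_le tau M : trace tau -> 0 <= M ->
  (forall a, B a -> cabs (tau a) <= M * nrm a) -> tn tau <= M.
Proof.
move=> tt M0 tM; apply: ge_sup; first by case: (tn_has_sup tt).
move=> _ [a [Ba a1] <-]; rewrite -/(cabs _) (le_trans (tM a Ba))//.
move: a1; rewrite (nrmE (a : T)) -real_complex1 lecR => a1.
by rewrite -[leRHS]mulr1 ler_wpM2l.
Qed.

Lemma trace_norm_ge0 tau : trace tau -> 0 <= tn tau.
Proof.
move=> tt; have := le_trace_norm tt (cs_one csB); rewrite nrm1 mulr1.
by apply: le_trans; exact: cabs_ge0.
Qed.

(** A self-adjoint h lies between -nrm h and nrm h; treating real and imaginary parts separately
    costs the factor 2. Boundedness of [g] is not assumed, so that the lemma can establish it for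
    restrictions of KMS states. *)
Lemma positive_functional_le (g : T -> R[i]) a :
  (forall (c : R[i]) a b, B a -> B b -> g (c *: a + b) = c * g a + g b) ->
  (forall a, B a -> pos a -> 0 <= g a) -> B a ->
  cabs (g a) <= 2 * cabs (g 1) * nrm a.
Proof.
move=> gl gp Ba; have B1 := cs_one csB; have Bsc t : B (sc t) by exact: cs_sc.
have gD b c : B b -> B c -> g (b + c) = g b + g c.
  by move=> Bb Bc; have := gl 1 b c Bb Bc; rewrite scale1r mul1r.
have g0 : g 0 = 0.
  by apply: (addrI (g 0)); rewrite -gD ?addr0//; exact: cs_zero.
have gZ (c : R[i]) b : B b -> g (c *: b) = c * g b.
  by move=> Bb; have := gl c b 0 Bb (cs_zero csB); rewrite g0 !addr0.
have le h : B h -> sa h -> nrm h <= nrm a -> cabs (g h) <= cabs (g 1) * nrm a.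
  move=> Bh sh ha.
  have p1 := gp _ (cs_add csB (Bsc (nrm a)) Bh) (pos_scD sh ha).
  have p2 := gp _ (cs_sub csB (Bsc (nrm a)) Bh) (pos_scB sh ha).
  have g1 : 0 <= g 1 by apply: gp => //; rewrite -(sc1 A); exact: pos_sc.
  move: p1 p2; rewrite -[- h]scaleN1r !gD//; last exact: cs_scale.
  rewrite !gZ// mulN1r (cabs_ge0_id g1) cabs_real ger0_norm ?cabs_ge0//.
  rewrite -real_complexM !lecE.
  case: (g h) => x y /= /andP[/eqP y0 p1] /andP[_ p2].
  rewrite add0r in y0; rewrite y0.
  by rewrite complexr0 cabs_real ler_norml; apply/andP; split; lra.
have Br : B (rpart a) by apply: cs_scale => //; apply: cs_add => //; exact: cs_adj.
have Bi : B (ipart a).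
  by do 2!apply: cs_scale => //; apply: cs_sub => //; exact: cs_adj.
have BI : B (iC R *: ipart a) by exact: (cs_scale csB _ Bi).
rewrite {1}[a]rpart_ipart gD// gZ// (le_trans (cabsD _ _))// cabsM cabs_iC mul1r.
have -> : 2 * cabs (g 1) * nrm a = cabs (g 1) * nrm a + cabs (g 1) * nrm a by ring.
apply: lerD; apply: le; rewrite ?nrm_rpart ?nrm_ipart//;
  [exact: sa_rpart|exact: sa_ipart].
Qed.

Lemma positive_trace_le (g : T -> R[i]) a : positive_trace B g -> B a ->
  cabs (g a) <= 2 * cabs (g 1) * nrm a.
Proof. by move=> [gt gp]; apply: positive_functional_le => //;
  exact: trace_linear gt. Qed.

Lemma trace_jordan tau M : trace tau ->
  (forall a, B a -> cabs (tau a) <= M * nrm a) ->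
  exists g1 g2 g3 g4 : T -> R[i],
  [/\ [/\ positive_trace B g1, positive_trace B g2, positive_trace B g3
        & positive_trace B g4],
      [/\ cabs (g1 1) <= M + M, cabs (g2 1) <= M + M, cabs (g3 1) <= M + M
        & cabs (g4 1) <= M + M]
    & forall a, B a -> tau a = g1 a - g2 a + iC R * (g3 a - g4 a)].
Proof.
move=> tt tM; have B1 := cs_one csB.
have M0 : 0 <= M by have := tM _ B1; rewrite nrm1 mulr1; apply: le_trans; exact: cabs_ge0.
have p1 : pos (1 : T) by rewrite -(sc1 A); exact: pos_sc.
have [|||| g1 [g2 [pg1 pg2 g11 g21 E1]]] :=
  @jordan_decomposition _ A B csB (fun a => complex.Re (tau a)) M.
- by move=> a b Ba Bb; rewrite (traceD tt)//; case: (tau a) (tau b) => ? ? [].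
- by move=> t a Ba; rewrite (traceZ csB tt)//; case: (tau a) => x y /=;
  rewrite mul0r subr0.
- by move=> a b Ba Bb; rewrite (trace_mulC tt).
- by move=> a Ba; rewrite (le_trans (cabs_Re _))// tM.
have [|||| g3 [g4 [pg3 pg4 g31 g41 E2]]] :=
  @jordan_decomposition _ A B csB (fun a => complex.Im (tau a)) M.
- by move=> a b Ba Bb; rewrite (traceD tt)//; case: (tau a) (tau b) => ? ? [].
- by move=> t a Ba; rewrite (traceZ csB tt)//; case: (tau a) => x y /=;
  rewrite mul0r addr0.
- by move=> a b Ba Bb; rewrite (trace_mulC tt).
- by move=> a Ba; rewrite (le_trans (cabs_Im _))// tM.
have m (g : T -> R[i]) (K : R) : positive_trace B g -> g 1 <= K%:C -> cabs (g 1) <= K.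
  by move=> [_ gp] gK; rewrite -lecR -cabs_ge0_id// gp.
exists g1, g2, g3, g4; split=> //.
  have M2 : M <= M + M by lra.
  by split; [exact: le_trans (m _ _ pg1 g11) M2|exact: (m _ _ pg2 g21)|
             exact: le_trans (m _ _ pg3 g31) M2|exact: (m _ _ pg4 g41)].
have E a : B a -> sa a -> tau a = g1 a - g2 a + iC R * (g3 a - g4 a).
  by move=> Ba sa_a; rewrite -E1// -E2// mulrC -complex_iC.
move=> a Ba; rewrite [a]rpart_ipart.
have Br : B (rpart a) by apply: cs_scale => //; apply: cs_add => //; exact: cs_adj.
have Bi : B (ipart a).
  by do 2!apply: cs_scale => //; apply: cs_sub => //; exact: cs_adj.
have BI : B (iC R *: ipart a) by exact: (cs_scale csB _ Bi).
have L1 (g : T -> R[i]) : trace g -> g (rpart a + iC R *: ipart a) = g (rpart a) + iC R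
  * g (ipart a).
  by move=> gt; rewrite (traceD gt)// (traceZ csB gt).
case: pg1 pg2 pg3 pg4 => [t1 _] [t2 _] [t3 _] [t4 _].
rewrite !L1// (E _ Br (sa_rpart a)) (E _ Bi (sa_ipart a)).
by ring.
Qed.

End trace_limits.

(** * Positive operators on traces *)

Section trace_operators.
Context (R : realType) (A : cstarAlgType R).
Notation T := (cring A).
Notation sc := (sc A).
Variable B : set T.
Hypothesis csB : closed_star_subalgebra B.
Implicit Types (a b : T) (M : R) (tau sigma g : T -> R[i]) (s : T -> T).

Notation trace := (bounded_trace (A := A) B).
Notation tn := (trace_norm (A := A) B).

(** Operators on traces are given by maps [s] on [B], acting through composition. [op_trace] makes
    [dual s] preserve traces; it is required only under a trace, as s(ab) and s(ba) may differ
    already for the identity. *)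
Record trace_op s : Prop := {
  op_sub : forall a, B a -> B (s a);
  op_linear : forall (c : R[i]) a b, B a -> B b -> s (c *: a + b) = c *: s a + s b;
  op_pos : forall a, B a -> pos a -> pos (s a);
  op_bound : exists2 C, 0 <= C & forall a, B a -> nrm (s a) <= C * nrm a;
  op_trace : forall tau a b, trace tau -> B a -> B b -> tau (s (a * b)) = tau (s (b * a))
}.

(** The form is chosen so that [dual] of a compression is convertible to [dual_operator]. *)
Definition dual s tau : T -> R[i] := fun a => if a \in B then tau (s a) else 0.

Lemma dualE s tau a : B a -> dual s tau a = tau (s a).
Proof. by move=> Ba; rewrite /dual mem_set. Qed.

Lemma dual_out s tau a : ~ B a -> dual s tau a = 0.
Proof. by move=> Ba; rewrite /dual memNset. Qed.

Lemma dual_le s tau C M : trace_op s -> 0 <= M ->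
  (forall a, B a -> nrm (s a) <= C * nrm a) ->
  (forall a, B a -> cabs (tau a) <= M * nrm a) ->
  forall a, B a -> cabs (dual s tau a) <= M * C * nrm a.
Proof.
move=> sop M0 sC tM a Ba; rewrite dualE// (le_trans (tM _ (op_sub sop Ba)))//.
by rewrite -mulrA ler_wpM2l// sC.
Qed.

Lemma dual_trace s tau : trace_op s -> trace tau -> trace (dual s tau).
Proof.
move=> sop tt; apply/bounded_traceP; split.
- by move=> a; exact: dual_out.
- move=> c a b Ba Bb; rewrite !dualE//; last first.
    by apply: (cs_add csB) => //; exact: (cs_scale csB).
  by rewrite (op_linear sop)// (trace_linear tt)//; exact: (op_sub sop).
- have [C C0 sC] := op_bound sop.
  exists (tn tau * C); apply: dual_le => //; first exact: trace_norm_ge0.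
  by move=> a Ba; exact: le_trace_norm.
- by move=> a b Ba Bb; rewrite !dualE//; [exact: (op_trace sop)|exact: (cs_mul
  csB)|exact: (cs_mul csB)].
Qed.

Lemma dual_positive s g : trace_op s -> positive_trace B g -> positive_trace B (dual s g).
Proof.
move=> sop [gt gp]; split; first exact: dual_trace.
by move=> a Ba pa; rewrite dualE//; apply: gp; [exact: (op_sub sop)|exact: (op_pos sop)].
Qed.

Lemma trace_op_id : trace_op id.
Proof.
split=> //; first by exists 1 => // a _; rewrite mul1r.
by move=> tau a b tt Ba Bb; rewrite (trace_mulC tt).
Qed.

Lemma trace_op_comp s s' : trace_op s -> trace_op s' -> trace_op (s \o s').
Proof.
move=> sop sop'; split => /=.
- by move=> a /(op_sub sop')/(op_sub sop).
- move=> c a b Ba Bb; rewrite (op_linear sop')// (op_linear sop)//;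
    exact: (op_sub sop').
- by move=> a Ba pa; apply: (op_pos sop); [exact: (op_sub sop')|exact: (op_pos sop')].
- have [C C0 sC] := op_bound sop; have [C' C'0 sC'] := op_bound sop'.
  exists (C * C'); first exact: mulr_ge0.
  move=> a Ba; rewrite (le_trans (sC _ (op_sub sop' Ba)))// -mulrA ler_wpM2l//.
  exact: sC'.
- move=> tau a b tt Ba Bb; have := op_trace sop' (dual_trace sop tt) Ba Bb.
  by rewrite !dualE//; apply: (op_sub sop'); exact: (cs_mul csB).
Qed.

Lemma trace_op_iter s k : trace_op s -> trace_op (iter k s).
Proof.
move=> sop; elim: k => [|k IH]; first exact: trace_op_id.
exact: trace_op_comp sop IH.
Qed.

(** Invertibility of [dual s - lambda] in a form that is checked one trace at a time: solvability
    with a uniform bound, and uniqueness. Linearity of the inverse is recovered from uniqueness. *)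
Definition resolvable s (lambda : R[i]) : Prop :=
  (exists2 W, 0 <= W & forall tau, trace tau -> exists sigma,
    [/\ trace sigma, forall a, B a -> sigma (s a) - lambda * sigma a = tau a
      & tn sigma <= W * tn tau]) /\
  (forall sigma, trace sigma ->
    (forall a, B a -> sigma (s a) = lambda * sigma a) -> sigma = fun=> 0).

Lemma invertible_of_resolvable s lambda : trace_op s -> resolvable s lambda ->
  invertible_operator (A := A) B (fun tau a => dual s tau a - lambda * tau a).
Proof.
move=> sop [[W W0 h] inj].
have h' tau : exists sigma, trace tau -> [/\ trace sigma,
    forall a, B a -> sigma (s a) - lambda * sigma a = tau a & tn sigma <= W * tn tau].
  have [tt|nt] := pselect (trace tau); last by exists tau.
  by have [sigma sP] := h tau tt; exists sigma.
have [S SP] := choice h'.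
have uniq sigma sigma' : trace sigma -> trace sigma' ->
    (forall a, B a -> sigma (s a) - lambda * sigma a = sigma' (s a) - lambda * sigma'
      a) ->
    sigma = sigma'.
  move=> st st' ss; have dt := trace_combination (-1) st' st.
  have /(_ _)/funeqP d0 := inj _ dt.
  apply/funext => a; apply/eqP; rewrite -subr_eq0 addrC -mulN1r; apply/eqP.
  apply: d0 => b Bb; have := ss b Bb => /eqP; rewrite subr_eq => /eqP ->; ring.
have SL tau : trace tau -> S (fun a => dual s tau a - lambda * tau a) = tau.
  move=> tt; have Lt : trace (fun a => dual s tau a - lambda * tau a).
    have := trace_combination (- lambda) tt (dual_trace sop tt); congr (trace _).
    by apply/funext => a; rewrite addrC mulNr.
  have [St SE _] := SP _ Lt; apply: uniq => // a Ba; rewrite SE// dualE//.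
have LS tau : trace tau -> (fun a => dual s (S tau) a - lambda * S tau a) = tau.
  move=> tt; have [St SE _] := SP _ tt; apply/funext => a.
  have [Ba|nBa] := pselect (B a); first by rewrite dualE// SE.
  by rewrite dual_out// (trace_out St)// (trace_out tt)// mulr0 subr0.
exists S; split; last by move=> tau tt; split; [exact: SL|exact: LS].
split.
- by move=> tau tt; case: (SP _ tt).
- move=> c tau tau' tt tt'.
  have [St SE _] := SP _ tt; have [St' SE' _] := SP _ tt'.
  have ct := trace_combination c tt tt'.
  have [Sct ScE _] := SP _ ct.
  apply: uniq => //; first exact: trace_combination.
  by move=> a Ba; rewrite ScE// -SE// -SE'//; ring.
- by exists W => tau tt; case: (SP _ tt).
Qed.

Lemma eigenvalue_spectrum s lambda tau : trace_op s -> trace tau -> tau 1 != 0 ->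
  (forall a, B a -> tau (s a) = lambda * tau a) ->
  spectrum (A := A) B (dual s) lambda.
Proof.
move=> sop tt t1 ts [S [[St Sl _] SL]].
have [SLt _] := SL _ tt.
have L0 : (fun a => dual s tau a - lambda * tau a) = fun=> 0.
  apply/funext => a; have [Ba|nBa] := pselect (B a); first by rewrite dualE// ts// subrr.
  by rewrite dual_out// (trace_out tt)// mulr0 subr0.
have zt := trace_zero B.
have S0 a : S (fun=> 0) a = 0.
  have := Sl (-1) _ _ zt zt; rewrite (_ : (fun a => _) = fun=> 0); last first.
    by apply/funext => b; rewrite mulr0 addr0.
  by move=> /(congr1 (fun f => f a)) ->; rewrite mulN1r addNr.
by move: t1; rewrite -SLt L0 S0 eqxx.
Qed.

(** On traces, s' - lambda^-1 = - lambda^-1 s' (s - lambda). Solving for [s] with right-hand side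
    tau thus amounts to solving for [s'] with right-hand side - lambda^-1 s' tau. *)
Lemma resolvable_inverse s s' lambda : trace_op s -> trace_op s' ->
  (forall tau a, trace tau -> B a -> tau (s (s' a)) = tau a) ->
  (forall tau a, trace tau -> B a -> tau (s' (s a)) = tau a) ->
  lambda != 0 -> resolvable s' lambda^-1 -> resolvable s lambda.
Proof.
move=> sop sop' ss' s's l0 [[W W0 h] inj]; split.
  have [C C0 sC] := op_bound sop'.
  exists (W * (cabs lambda^-1 * C)); first by rewrite !mulr_ge0// cabs_ge0.
  move=> tau tt; have dt := trace_scale (- lambda^-1) (dual_trace sop' tt).
  have [sigma [st sE sle]] := h _ dt; exists sigma; split=> //.
    move=> a Ba; have Bsa := op_sub sop Ba.
    have := sE _ Bsa; rewrite s's// dualE// s's// => e.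
    have -> : tau a = - lambda * (- lambda^-1 * tau a) by rewrite mulrA mulrNN divff//
      mul1r.
    by rewrite -e mulrBr !mulNr opprK mulrA divff// mul1r addrC.
  rewrite (le_trans sle)// -mulrA ler_wpM2l//.
  apply: trace_norm_le => //; first by rewrite !mulr_ge0 ?cabs_ge0// trace_norm_ge0.
  move=> a Ba; rewrite cabsM cabsN -!mulrA ler_wpM2l ?cabs_ge0//.
  rewrite mulrA [C * _]mulrC; apply: dual_le => //; first exact: trace_norm_ge0.
  by move=> b Bb; exact: le_trace_norm.
move=> sigma st sE; apply: inj => // a Ba; have Bsa := op_sub sop' Ba.
by have := sE _ Bsa; rewrite ss'// => ->; rewrite mulKf.
Qed.

Lemma resolvable_zero s s' : trace_op s -> trace_op s' ->
  (forall tau a, trace tau -> B a -> tau (s (s' a)) = tau a) ->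
  (forall tau a, trace tau -> B a -> tau (s' (s a)) = tau a) ->
  resolvable s 0.
Proof.
move=> sop sop' ss' s's; split.
  have [C C0 sC] := op_bound sop'; exists C => // tau tt; exists (dual s' tau); split.
  - exact: dual_trace.
  - by move=> a Ba; rewrite mul0r subr0 dualE; [exact: s's|exact: (op_sub sop)].
  - apply: trace_norm_le => //; first exact: dual_trace.
      by rewrite mulr_ge0// trace_norm_ge0.
    move=> a Ba; rewrite [C * _]mulrC; apply: dual_le => //; first exact: trace_norm_ge0.
    by move=> b Bb; exact: le_trace_norm.
move=> sigma st sE; apply/funext => a; have [Ba|nBa] := pselect (B a).
  by rewrite -ss'// sE ?mul0r//; exact: (op_sub sop').
by rewrite (trace_out st).
Qed.

Lemma positive_trace_mono g a b : positive_trace B g -> B a -> B b -> pos a ->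
  pos (b - a) -> cabs (g a) <= cabs (g b).
Proof.
move=> [gt gp] Ba Bb pa pab; have pb : pos b by rewrite -[b](subrK a); exact: posD.
have := gp _ (cs_sub csB Bb Ba) pab; rewrite (traceB csB gt)// subr_ge0.
by rewrite (cabs_ge0_id (gp _ Ba pa)) (cabs_ge0_id (gp _ Bb pb)) lecR !cabs_real
  !ger0_norm// cabs_ge0.
Qed.

Lemma positive_trace_combination (t : R) g g' : 0 <= t -> positive_trace B g ->
  positive_trace B g' -> positive_trace B (fun a => t%:C * g a + g' a).
Proof.
move=> t0 [gt gp] [gt' gp']; split; first exact: trace_combination.
by move=> a Ba pa; rewrite addr_ge0 ?mulr_ge0 ?ler0c ?gp ?gp'.
Qed.

Lemma positive_trace_zero : positive_trace B (fun=> 0).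
Proof. by split=> //; exact: trace_zero. Qed.

Lemma positive_trace_scale (t : R) g : 0 <= t -> positive_trace B g ->
  positive_trace B (fun a => t%:C * g a).
Proof.
move=> t0 gp; have := positive_trace_combination t0 gp positive_trace_zero.
by congr positive_trace; apply/funext => a; rewrite addr0.
Qed.

Lemma positive_trace_sum (I : Type) (r : seq I) (F : I -> T -> R[i]) :
  (forall i, positive_trace B (F i)) -> positive_trace B (fun a => \sum_(i <- r) F i a).
Proof.
move=> pF; split; first by apply: trace_sum_fun => i; case: (pF i).
by move=> a Ba pa; apply: sumr_ge0 => i _; case: (pF i) => _; exact.
Qed.

(** A generalized limit of approximate eigenstates for e = 1/(n+1); [positive_trace_le] and the
    normalization at 1 supply the uniform bound. Closedness of the set of temperatures uses this as
    well. *)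
Lemma eigenstate_of_approx s (r : R) : trace_op s ->
  (forall e, 0 < e -> exists g, [/\ positive_trace B g, g 1 = 1
     & forall a, B a -> cabs (g (s a) - r%:C * g a) <= e * nrm a]) ->
  exists g, [/\ positive_trace B g, g 1 = 1 & forall a, B a -> g (s a) = r%:C * g a].
Proof.
move=> sop h; pose dl n : R := n.+1%:R^-1.
have dl0 n : 0 < dl n by rewrite invr_gt0.
have [g gP] := choice (fun n => h _ (dl0 n)).
have [L gL] := exists_generalized_limit R.
have gt n : trace (g n) by case: (gP n) => -[].
have g1 n : g n 1 = 1 by case: (gP n).
have gb n a : B a -> cabs (g n a) <= 2 * nrm a.
  move=> Ba; have [gp _ _] := gP n.
  by have := positive_trace_le csB gp Ba; rewrite g1 cabs1 mulr1.
have bd a : cbounded (fun n => g n a).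
  have [Ba|nBa] := pselect (B a); first by exists (2 * nrm a) => n; exact: gb.
  by exists 0 => n; rewrite (trace_out (gt n) nBa) cabs0.
have [st _] := trace_limit gL gt gb.
exists (fun a => L (fun n => g n a)); split.
- split=> // a Ba pa; apply: (gl_ge0 gL) => // n.
  by case: (gP n) => -[_ gp] _ _; exact: gp.
- apply: (gl_lim gL) (bd 1) => e e0; exists 0%N => n _.
  by rewrite g1 subrr cabs0.
- move=> a Ba; apply/eqP; rewrite -subr_eq0 addrC -mulNr -(gl_linear gL)//; apply/eqP.
  have le n : cabs (- r%:C * g n a + g n (s a)) <= dl n * nrm a.
    by rewrite mulNr addrC; case: (gP n) => _ _; exact.
  apply: (gl_lim gL).
    move=> e e0; have k0 : 0 < nrm a + 1 by rewrite ltr_wpDl// nrm_ge0.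
    exists (Num.Def.truncn ((nrm a + 1) / e)) => n Nn; rewrite subr0.
    rewrite (le_lt_trans (le n))// /dl mulrC ltr_pdivrMr//.
    have : (nrm a + 1) / e < n.+1%:R.
      by rewrite (lt_le_trans (truncnS_gt _))// ler_nat.
    by rewrite ltr_pdivrMr// mulrC; lra.
  exists (nrm a) => n; rewrite (le_trans (le n))// -[leRHS]mul1r ler_wpM2r ?nrm_ge0//.
  by rewrite invf_le1// ler1n.
Qed.

End trace_operators.

(** * Growth rate and tracial eigenstates *)

Section krein_rutman.
Context (R : realType) (A : cstarAlgType R).
Notation T := (cring A).
Notation sc := (sc A).
Variables (B : set T) (s s' : T -> T) (g0 : T -> R[i]).
Hypothesis csB : closed_star_subalgebra B.
Hypothesis sop : trace_op B s.
Hypothesis sop' : trace_op B s'.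
Hypothesis ss' : forall tau a,
  bounded_trace (A := A) B tau -> B a -> tau (s (s' a)) = tau a.
Hypothesis g0_positive : positive_trace B g0.
Hypothesis g0_1 : g0 1 = 1.
Implicit Types (a b : T) (tau sigma g : T -> R[i]) (l d e : R) (n k N q : nat).

Notation trace := (bounded_trace (A := A) B).
Notation tn := (trace_norm (A := A) B).
Notation ptrace := (positive_trace B).

Let B1 : B 1. Proof. exact: (cs_one csB). Qed.

Let pos1 : pos (1 : T). Proof. by rewrite -(sc1 A); exact: pos_sc. Qed.

Let iop k : trace_op B (iter k s). Proof. exact: trace_op_iter. Qed.

Let Bi k a : B a -> B (iter k s a). Proof. exact: (op_sub (iop k)). Qed.

(** The mass of the positive trace g o s^k, which controls it on all of [B]. Through [m_dual], a
    bound valid for all positive traces becomes one between the masses of index k and k + n. *)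
Let m g k : R := cabs (g (iter k s 1)).

Let m_ge0 g k : 0 <= m g k. Proof. exact: cabs_ge0. Qed.

Let mE g k : ptrace g -> g (iter k s 1) = (m g k)%:C.
Proof. by move=> [_ gp]; apply: cabs_ge0_id; apply: gp;
  [exact: Bi|exact: (op_pos (iop k))]. Qed.

Let m_dual g k n : m (dual B (iter k s) g) n = m g (k + n).
Proof. by rewrite /m dualE ?iterD//; exact: (Bi n B1). Qed.

Let dual_p g k : ptrace g -> ptrace (dual B (iter k s) g).
Proof. exact: dual_positive. Qed.

Let m_le g k : ptrace g -> m g k <= nrm (iter k s 1) * m g 0.
Proof.
move=> gp; have Bsc t : B (sc t) by exact: (cs_sc _ csB).
have n0 := nrm_ge0 (iter k s (1 : T)).
have -> : nrm (iter k s 1) * m g 0 = cabs (g (sc (nrm (iter k s 1)))).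
  case: (gp) => gt _; rewrite (traceZ csB gt)// cabsM cabs_real ger0_norm//.
apply: (positive_trace_mono csB gp) => //; [exact: (Bi k B1)|exact: (op_pos (iop k))|].
by apply: pos_scB => //; apply/pos_sa/(op_pos (iop k)).
Qed.

Let m_scale (t : R) g k : 0 <= t -> m (fun a => t%:C * g a) k = t * m g k.
Proof. by move=> t0; rewrite /m cabsM cabs_real ger0_norm. Qed.

(* [rho = inf good] is the growth rate of [m g k] over tracial states [g]. *)
Let good l : Prop :=
  0 < l /\ exists N, forall g, ptrace g -> 2 * m g N <= l ^+ N * m g 0.

Let good_up l d : good l -> l <= d -> good d.
Proof.
move=> [l0 [N lN]] ld; split; first exact: lt_le_trans ld.
exists N => g gp; rewrite (le_trans (lN g gp))// ler_wpM2r//.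
by rewrite lerXn2r// nnegrE ltW// (lt_le_trans l0).
Qed.

(** Each application of the inequality to g o s^(q N) gains another factor 2 over l^N. *)
Let decay l N q g : 0 < l -> (forall g, ptrace g -> 2 * m g N <= l ^+ N * m g 0) ->
  ptrace g -> 2 ^+ q * m g (q * N) <= l ^+ (q * N) * m g 0.
Proof.
move=> l0 lN gp; elim: q => [|q IH]; first by rewrite mul0n !expr0 !mul1r.
have := lN _ (dual_p (q * N) gp); rewrite !m_dual addn0 -mulSnr => h.
rewrite exprS -mulrA mulrCA.
have : 2 ^+ q * (2 * m g (q.+1 * N)) <= 2 ^+ q * (l ^+ N * m g (q * N)).
  by rewrite ler_wpM2l// exprn_ge0.
move=> /le_trans; apply.
rewrite mulrCA mulSn exprD -mulrA ler_wpM2l//.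
by rewrite exprn_ge0// ltW.
Qed.

Let Z l g n : R := \sum_(0 <= k < n) l^-1 ^+ k * m g k.

Let Z_mono l g n k : 0 < l -> (n <= k)%N -> Z l g n <= Z l g k.
Proof.
move=> l0 nk; rewrite /Z (big_cat_nat (leq0n n) nk)/= lerDl sumr_ge0// => i _.
by rewrite mulr_ge0// exprn_ge0// invr_ge0 ltW.
Qed.

(* [Z (N + n) <= Z N + Z n / 2] bounds [Z] by [2 Z N]. *)
Let Z_le l : good l -> exists2 W, 0 <= W & forall g n, ptrace g -> Z l g n <= W * m g 0.
Proof.
move=> [l0 [N lN]]; have li : 0 <= l^-1 by rewrite invr_ge0 ltW.
exists (2 * \sum_(0 <= k < N) l^-1 ^+ k * nrm (iter k s (1 : T))).
  by rewrite mulr_ge0// sumr_ge0// => k _; rewrite mulr_ge0 ?exprn_ge0 ?nrm_ge0.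
move=> g n gp.
have h1 : Z l g N <= (\sum_(0 <= k < N) l^-1 ^+ k * nrm (iter k s (1 : T))) * m g 0.
  rewrite mulr_suml; apply: ler_sum => k _; rewrite -mulrA ler_wpM2l ?exprn_ge0//.
  exact: m_le.
have h2 : Z l g (N + n) <= Z l g N + 2^-1 * Z l g n.
  rewrite /Z (big_cat_nat (leq0n N) (leq_addr n N))/= lerD2l mulr_sumr.
  rewrite -{1}[N]add0n big_addn addKn; apply: ler_sum => k _.
  have := lN _ (dual_p k gp); rewrite !m_dual addn0 => h.
  have : l^-1 ^+ (k + N) * (2 * m g (k + N)) <= l^-1 ^+ (k + N) * (l ^+ N * m g k).
    by rewrite ler_wpM2l// exprn_ge0.
  rewrite [X in _ <= X](_ : _ = l^-1 ^+ k * m g k); last first.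
    rewrite exprD -mulrA; congr (_ * _).
    by rewrite mulrA -exprMn mulVf ?gt_eqF// expr1n mul1r.
  lra.
have h3 : Z l g n <= Z l g (N + n) by rewrite Z_mono// leq_addl.
lra.
Qed.

(** For N = 0 the inequality would fail at the tracial state [g0]. *)
Let good_pos_exponent l : good l -> exists2 N, (0 < N)%N &
  forall g, ptrace g -> 2 * m g N <= l ^+ N * m g 0.
Proof.
move=> [l0 [[|N] lN]]; last by exists N.+1.
have := lN _ g0_positive; rewrite expr0 mul1r /m g0_1 cabs1; lra.
Qed.

(** The orbit of an arbitrary trace is dominated by the masses of its four Jordan parts; each has
    mass at most 2 tn tau, whence the constant 8. *)
Lemma trace_iter_le tau : trace tau -> exists g1 g2 g3 g4 : T -> R[i],
  [/\ [/\ ptrace g1, ptrace g2, ptrace g3 & ptrace g4],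
      m g1 0 + m g2 0 + m g3 0 + m g4 0 <= 8 * tn tau
    & forall k a, B a -> cabs (tau (iter k s a)) <=
        2 * nrm a * (m g1 k + m g2 k + m g3 k + m g4 k)].
Proof.
move=> tt; have [g1 [g2 [g3 [g4 [[p1 p2 p3 p4] [b1 b2 b3 b4] E]]]]] :=
  trace_jordan csB tt (fun a => le_trace_norm csB tt (a := a)).
exists g1, g2, g3, g4; split=> //; first by rewrite /m /=; lra.
move=> k a Ba; rewrite E; last exact: Bi.
have le g : ptrace g -> cabs (g (iter k s a)) <= 2 * nrm a * m g k.
  move=> gp; have := positive_trace_le csB (dual_p k gp) Ba.
  rewrite !dualE// -/(m g k) => /le_trans; apply.
  by rewrite -mulrA [m g k * _]mulrC mulrA.
have := cabsD (g1 (iter k s a) - g2 (iter k s a)) (iC R * (g3 (iter k s a) - g4 (iter k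
  s a))).
rewrite cabsM cabs_iC mul1r.
have := cabsB (g1 (iter k s a)) (g2 (iter k s a)).
have := cabsB (g3 (iter k s a)) (g4 (iter k s a)).
have := le _ p1; have := le _ p2; have := le _ p3; have := le _ p4.
lra.
Qed.

Lemma pow2_small e : 0 < e -> exists N, forall n, (N <= n)%N -> (2^-1 : R) ^+ n < e.
Proof. by apply: expr_small; lra. Qed.

(** The solution is a generalized limit of the partial sums of - lambda^-1 sum_k lambda^-k s^k tau,
    which [Z_le] bounds. They telescope up to lambda^-n tau(s^n a); since [decay] controls this
    along multiples of [N], the limit is taken over n = q N. The same decay gives uniqueness. *)
Lemma resolvable_good (lambda : R[i]) : good (cabs lambda) -> resolvable B s lambda.
Proof.
set l := cabs lambda => lgood; have l0 : 0 < l by case: lgood.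
have lambda0 : lambda != 0 by rewrite -cabs_eq0 gt_eqF.
have [W W0 ZW] := Z_le lgood; have [N N0 lN] := good_pos_exponent lgood.
have small tau a : trace tau -> B a -> exists2 C, 0 <= C & forall q,
    cabs (lambda^-1 ^+ (q * N) * tau (iter (q * N) s a)) <= C * 2^-1 ^+ q.
  move=> tt Ba; have [g1 [g2 [g3 [g4 [[p1 p2 p3 p4] ms tle]]]]] := trace_iter_le tt.
  exists (2 * nrm a * (m g1 0 + m g2 0 + m g3 0 + m g4 0)).
    by rewrite !mulr_ge0 ?nrm_ge0// !addr_ge0.
  move=> q; rewrite cabsM cabsX cabsV -/l.
  have li : 0 <= l^-1 ^+ (q * N) by rewrite exprn_ge0// invr_ge0 ltW.
  rewrite (le_trans (ler_wpM2l li (tle _ _ Ba)))// mulrCA -[leRHS]mulrA ler_wpM2l//.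
    by rewrite mulr_ge0// nrm_ge0.
  have le g : ptrace g -> l^-1 ^+ (q * N) * m g (q * N) <= m g 0 * 2^-1 ^+ q.
    move=> gp; have := decay q l0 lN gp.
    have -> : l^-1 ^+ (q * N) = (l ^+ (q * N))^-1 by rewrite exprVn.
    rewrite exprVn ler_pdivlMr ?exprn_gt0// mulrAC -mulrA => h.
    by rewrite ler_pdivrMl ?exprn_gt0// mulrC.
  have := le _ p1; have := le _ p2; have := le _ p3; have := le _ p4; lra.
split.
  have [L gL] := exists_generalized_limit R.
  exists (l^-1 * (2 * (W * 8))).
    by rewrite !mulr_ge0// invr_ge0 ltW.
  move=> tau tt; have M0 := trace_norm_ge0 csB tt.
  have [g1 [g2 [g3 [g4 [[p1 p2 p3 p4] ms tle]]]]] := trace_iter_le tt.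
  pose P n a := \sum_(0 <= k < n) lambda^-1 ^+ k * dual B (iter k s) tau a.
  have Pt n : trace (fun a => - lambda^-1 * P n a).
    apply: trace_scale; apply: trace_sum_fun => k; apply: trace_scale.
    exact: dual_trace.
  have Ple n a : B a -> cabs (- lambda^-1 * P n a) <= l^-1 * (2 * (W * 8)) * tn tau *
    nrm a.
    move=> Ba; rewrite cabsM cabsN cabsV -/l -!mulrA ler_wpM2l ?invr_ge0 ?(ltW l0)//.
    rewrite (le_trans (cabs_sum _ _))//.
    have h k : cabs (lambda^-1 ^+ k * dual B (iter k s) tau a) <=
        2 * nrm a * (l^-1 ^+ k * (m g1 k + m g2 k + m g3 k + m g4 k)).
      rewrite dualE// cabsM cabsX cabsV -/l [leRHS]mulrCA ler_wpM2l ?tle//.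
      by rewrite exprn_ge0// invr_ge0 ltW.
    rewrite (le_trans (ler_sum _ (fun k _ => h k)))// -mulr_sumr.
    have -> : \sum_(0 <= k < n) l^-1 ^+ k * (m g1 k + m g2 k + m g3 k + m g4 k) =
        Z l g1 n + Z l g2 n + Z l g3 n + Z l g4 n.
      by rewrite /Z -!big_split/=; apply: eq_bigr => k _; rewrite !mulrDr.
    rewrite -mulrA ler_wpM2l// mulrC !mulrA ler_wpM2r ?nrm_ge0//.
    have := ZW g1 n p1; have := ZW g2 n p2; have := ZW g3 n p3; have := ZW g4 n p4.
    have : W * (m g1 0 + m g2 0 + m g3 0 + m g4 0) <= W * (8 * tn tau).
      by rewrite ler_wpM2l.
    lra.
  have [st sle] := trace_limit gL (fun q => Pt (q * N)%N) (fun q => @Ple (q * N)%N).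
  exists (fun a => L (fun q => - lambda^-1 * P (q * N)%N a)); split=> //; last first.
    by apply: trace_norm_le => //; rewrite !mulr_ge0// invr_ge0 ltW.
  move=> a Ba; have Bsa := op_sub sop Ba.
  have bd b : B b -> cbounded (fun q => - lambda^-1 * P (q * N)%N b).
    by move=> Bb; exists (l^-1 * (2 * (W * 8)) * tn tau * nrm b) => q; exact: Ple.
  rewrite addrC -mulNr -(gl_linear gL); [|exact: bd|exact: bd].
  have E n : - lambda * (- lambda^-1 * P n a) + - lambda^-1 * P n (s a) =
      tau a - lambda^-1 ^+ n * tau (iter n s a).
    rewrite mulrA mulrNN divff// mul1r.
    elim: n => [|n IH]; first by rewrite /P !big_geq// mulr0 addr0 expr0 mul1r subrr.
    rewrite /P !big_nat_recr//= mulrDr addrACA -/(P n a) -/(P n (s a)) IH !dualE//.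
    by rewrite -iterSr /= exprS mulNr mulrA addrA subrK.
  have [C C0 Cs] := small tau a tt Ba.
  apply: (gl_lim gL).
    move=> e e0; have k0 : 0 < C + 1 by rewrite ltr_wpDl.
    have [|N1 hN] := @pow2_small (e / (C + 1)); first by rewrite divr_gt0.
    exists N1 => q /hN; rewrite ltr_pdivlMr// => hq.
    rewrite E addrAC subrr add0r cabsN (le_lt_trans (Cs q))//.
    rewrite (le_lt_trans _ hq)// mulrC ler_wpM2l ?exprn_ge0 ?invr_ge0// lerDl//.
  exists (cabs (tau a) + C) => q; rewrite E (le_trans (cabsB _ _))// lerD2l.
  rewrite (le_trans (Cs q))// -[leRHS]mulr1 ler_wpM2l//.
  by rewrite exprn_ile1 ?invr_ge0// invf_le1// ler1n.
move=> sigma st sE; apply/funext => a; have [Ba|nBa] := pselect (B a); last first.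
  by rewrite (trace_out st).
have it n : sigma (iter n s a) = lambda ^+ n * sigma a.
  elim: n => [|n IH]; first by rewrite expr0 mul1r.
  by rewrite iterS sE ?IH ?exprS ?mulrA//; exact: Bi.
have [C C0 Cs] := small sigma a st Ba.
apply: cabs_lt_eq0 => e e0; have k0 : 0 < C + 1 by rewrite ltr_wpDl.
have [|q hN] := @pow2_small (e / (C + 1)); first by rewrite divr_gt0.
have := hN q (leqnn _); rewrite ltr_pdivlMr// => hq.
have := Cs q; rewrite it mulrA -exprMn mulVf// expr1n mul1r => /le_lt_trans; apply.
by rewrite (le_lt_trans _ hq)// mulrC ler_wpM2l ?exprn_ge0 ?invr_ge0// lerDl.
Qed.

Let rho : R := inf good.

Let good_bound : exists l, good l.
Proof.
exists (2 * nrm (s (1 : T)) + 1); split; first by rewrite ltr_wpDl// mulr_ge0// nrm_ge0.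
exists 1%N => g gp; rewrite expr1; have := m_le 1 gp => /= h.
have := m_ge0 g 0; lra.
Qed.

(** Invertibility bounds the growth rate from below: g 1 = g (s (s' 1)) <= D g (s 1) with D = nrm
    (s' 1), so a mass shrinks at most by the factor D in each step. *)
Let low : exists2 D, 0 < D & forall l, good l -> 1 < l * D.
Proof.
pose D := nrm (s' (1 : T)); have D0 : 0 <= D by exact: nrm_ge0.
have step g : ptrace g -> m g 0 <= D * m g 1.
  move=> gp; have [gt _] := gp.
  have Bs' := op_sub sop' B1; have ps' := op_pos sop' B1 pos1.
  have Bsc t : B (sc t) by exact: (cs_sc _ csB).
  have := positive_trace_mono csB (dual_p 1 gp) Bs' (Bsc D) ps' (pos_scB (pos_sa ps')
    (lexx _)).
  rewrite !dualE//= ss'// => /le_trans; apply.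
  have [dt _] := dual_p 1 gp.
  have -> : s (sc D) = D%:C *: s 1.
    have := op_linear sop D%:C B1 (cs_zero csB); rewrite addr0 => ->.
    have := op_linear sop (-1) (cs_zero csB) (cs_zero csB).
    by rewrite scaler0 addr0 scaleN1r addNr => ->; rewrite addr0.
  rewrite (traceZ csB gt) ?cabsM ?cabs_real ?ger0_norm//; exact: (op_sub sop).
have iterD g n : ptrace g -> m g 0 <= D ^+ n * m g n.
  move=> gp; elim: n => [|n IH]; first by rewrite expr0 mul1r.
  rewrite (le_trans IH)// exprSr -mulrA ler_wpM2l ?exprn_ge0//.
  by have := step _ (dual_p n gp); rewrite !m_dual addn0 addn1.
have m0 : m g0 0 = 1 by rewrite /m g0_1 cabs1.
exists D.
  by have := step _ g0_positive; rewrite m0 lt_def D0 andbT; case: eqP => // ->;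
    rewrite mul0r; lra.
move=> l [l0 [N lN]]; rewrite ltNge; apply/negP => lD.
have h1 := lN _ g0_positive; have h2 := iterD _ N g0_positive.
rewrite m0 mulr1 in h1; rewrite m0 in h2.
have h3 : D ^+ N * (2 * m g0 N) <= D ^+ N * l ^+ N by rewrite ler_wpM2l// exprn_ge0.
have : (D * l) ^+ N <= 1 by rewrite exprn_ile1// 1?mulrC// mulr_ge0// ltW.
rewrite exprMn; lra.
Qed.

Let good_inf : has_inf good.
Proof.
split; first by case: good_bound => l; exists l.
by exists 0 => l [l0 _]; exact: ltW.
Qed.

Let rho_gt0 : 0 < rho.
Proof.
have [D D0 Dl] := low; have : D^-1 <= rho.
  apply: lb_le_inf; first by case: good_inf.
  by move=> l /Dl lD; rewrite -[D^-1]mul1r ler_pdivrMr// ltW.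
by apply: lt_le_trans; rewrite invr_gt0.
Qed.

Let good_gt l : rho < l -> good l.
Proof.
move=> rl; have [|d gd dl] := inf_adherent (_ : 0 < l - rho) good_inf.
  by rewrite subr_gt0.
by apply: good_up gd _; move: dl; rewrite -/rho; lra.
Qed.

Let good_ge l : good l -> rho <= l.
Proof. by move=> gl; apply: ge_inf => //; case: good_inf. Qed.

(* If [Z l g n <= K] near [rho], applying this bound to [g \o s^k] gives
   [N l^-N m g N <= K Z l g N <= K^2]; for large [N] this makes some number
   below [rho] good. *)
Let unbounded_sums (K d : R) : 0 < d -> exists l g n,
  [/\ rho < l < rho + d, ptrace g, m g 0 = 1 & K <= Z l g n].
Proof.
move=> d0; apply: contrapT => no.
have K0 : 0 < K.
  rewrite ltNge; apply/negP => K0; apply: no.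
  exists (rho + d / 2), g0, 0%N; split=> //; first by apply/andP; split; lra.
    by rewrite /m g0_1 cabs1.
  by rewrite /Z big_geq.
have bound l g n : rho < l < rho + d -> ptrace g -> Z l g n <= K * m g 0.
  move=> lr gp; have [m0|m0] := eqVneq (m g 0) 0.
    rewrite m0 mulr0 /Z big1// => k _; apply/eqP; rewrite mulf_eq0; apply/orP; right.
    by rewrite eq_le m_ge0 andbT (le_trans (m_le _ gp))// m0 mulr0.
  have m1 : 0 < m g 0 by rewrite lt_def m0 m_ge0.
  pose g' a := (m g 0)^-1%:C * g a; have gp' : ptrace g'.
    by apply: positive_trace_scale => //; rewrite invr_ge0 ltW.
  have mE' k : m g' k = (m g 0)^-1 * m g k by rewrite m_scale// invr_ge0 ltW.
  have ZE : Z l g' n = (m g 0)^-1 * Z l g n.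
    by rewrite /Z mulr_sumr; apply: eq_bigr => k _; rewrite mE' mulrCA.
  have : Z l g' n < K.
    rewrite ltNge; apply/negP => KZ; apply: no; exists l, g', n; split=> //.
    by rewrite mE' mulVf.
  by rewrite ZE mulrC ltr_pdivrMr// => /ltW.
(* With N > 4 K^2 the estimate N l^-N m g N <= K^2 m g 0 yields the factor 4 in [key], twice what
   [good] demands. *)
pose N := (Num.Def.truncn (4 * (K * K))).+1.
have N0 : 0 < N%:R :> R by rewrite ltr0n.
have NK : 4 * (K * K) < N%:R by exact: truncnS_gt.
have term l g k n : rho < l < rho + d -> ptrace g -> l^-1 ^+ k * m g k <= K * m g 0.
  move=> lr gp; rewrite (le_trans _ (bound l g k.+1 lr gp))//.
  rewrite /Z big_nat_recr//= lerDr sumr_ge0// => i _.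
  rewrite mulr_ge0// exprn_ge0// invr_ge0; move: rho_gt0; lra.
have key l g : rho < l < rho + d -> ptrace g -> 4 * m g N <= l ^+ N * m g 0.
  move=> lr gp; have l0 : 0 < l by move: rho_gt0; lra.
  have h k : (k < N)%N -> l^-1 ^+ N * m g N <= K * (l^-1 ^+ k * m g k).
    move=> kN; have := term l _ (N - k)%N 0%N lr (dual_p k gp).
    rewrite !m_dual addn0 subnKC ?(ltnW kN)// => h.
    have : l^-1 ^+ k * (l^-1 ^+ (N - k) * m g N) <= l^-1 ^+ k * (K * m g k).
      by rewrite ler_wpM2l// exprn_ge0// invr_ge0 ltW.
    by rewrite mulrA -exprD subnKC ?(ltnW kN)// mulrCA.
  have : N%:R * (l^-1 ^+ N * m g N) <= K * Z l g N.
    rewrite /Z mulr_sumr mulr_natl -[N in X in X <= _]subn0 -sumr_const_nat subn0.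
    by rewrite !big_mkord; apply: ler_sum => k _; exact: h.
  have : K * Z l g N <= K * (K * m g 0) by rewrite ler_wpM2l ?(ltW K0)// bound.
  rewrite exprVn => h1 h2.
  have lN0 : 0 < l ^+ N by rewrite exprn_gt0.
  rewrite -ler_pdivrMl// mulrCA.
  have h3 : 0 <= (l ^+ N)^-1 * m g N by rewrite mulr_ge0// invr_ge0 ltW.
  set x := (l ^+ N)^-1 * m g N in h2 h3 *.
  have h4 : N%:R * x <= K * K * m g 0 by rewrite -mulrA; exact: le_trans h2 h1.
  have m0 := m_ge0 g 0.
  rewrite -(ler_pM2l N0) mulrCA.
  have : 4 * (K * K) * m g 0 <= N%:R * m g 0 by rewrite ler_wpM2r// ltW.
  lra.
(* By Bernoulli's inequality, passing from l to l (1 - eta) costs at most a factor 2 in l^N, which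
   the surplus in [key] absorbs; and l <= (1 + eta) rho gives l (1 - eta) < rho. *)
pose eta : R := (2 * N%:R)^-1.
have eta0 : 0 < eta by rewrite invr_gt0 mulr_gt0.
have etaN : eta * N%:R = 2^-1 by rewrite /eta invfM -mulrA mulVf ?mulr1// gt_eqF.
have eta1 : eta <= 2^-1.
  by rewrite -etaN -[leLHS]mulr1 ler_wpM2l ?(ltW eta0)// ler1n.
pose l := rho + Num.min (d / 2) (eta * rho).
have l_rho : rho < l.
  by rewrite /l ltrDl lt_min divr_gt0//= mulr_gt0.
have l_d : l < rho + d.
  by rewrite ltrD2l gt_min; apply/orP; left; lra.
have l_eta : l * (1 - eta) < rho.
  have h : l <= rho + eta * rho by rewrite lerD2l ge_min lexx orbT.
  have : l * (1 - eta) <= (rho + eta * rho) * (1 - eta) by rewrite ler_wpM2r//; lra.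
  have : 0 < eta * eta * rho by rewrite !mulr_gt0.
  lra.
have l'0 : 0 < l * (1 - eta).
  rewrite mulr_gt0//; [exact: lt_trans l_rho|lra].
suff : good (l * (1 - eta)) by move=> /good_ge; rewrite leNgt l_eta.
split=> //; exists N => g gp.
have := @key l g; rewrite l_rho l_d => /(_ isT gp) k4.
have bern n : n%:R * eta <= 1 -> 1 - n%:R * eta <= (1 - eta) ^+ n.
  elim: n => [|n IH]; first by rewrite expr0 mul0r subr0.
  rewrite -natr1 mulrDl mul1r => h.
  have h' : 1 - n%:R * eta <= (1 - eta) ^+ n by apply: IH; lra.
  rewrite exprSr.
  have : (1 - n%:R * eta) * (1 - eta) <= (1 - eta) ^+ n * (1 - eta).
    by rewrite ler_wpM2r//; lra.
  have : 0 <= n%:R * eta * eta by rewrite !mulr_ge0// ltW.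
  lra.
have half : 2^-1 <= (1 - eta) ^+ N.
  have := bern N; rewrite mulrC etaN; lra.
rewrite exprMn.
have m0 := m_ge0 g 0; have lN0 : 0 <= l ^+ N * m g 0.
  by rewrite mulr_ge0// exprn_ge0// ltW// (lt_trans rho_gt0).
have : l ^+ N * m g 0 * 2^-1 <= l ^+ N * m g 0 * (1 - eta) ^+ N by rewrite ler_wpM2l.
lra.
Qed.

(** The partial sum [P] satisfies P o s - l P = l (l^-n g o s^n - g), which stays bounded, while its
    mass [Z l g n] is large. After normalization this defect takes half of [e]; replacing l by rho,
    at distance at most e/4, takes the other half. *)
Let approx_eigenstate e : 0 < e -> exists g, [/\ ptrace g, g 1 = 1
  & forall a, B a -> cabs (g (s a) - rho%:C * g a) <= e * nrm a].
Proof.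
move=> e0; pose d := Num.min 1 (e / 4).
have d0 : 0 < d by rewrite lt_min ltr01 divr_gt0.
have d1 : d <= 1 by rewrite ge_min lexx.
have de : d <= e / 4 by rewrite ge_min lexx orbT.
(* The defect is at most 4 l nrm a with l <= rho + 1, and K e / 2 exceeds 4 (rho + 1). *)
pose K := 8 * (rho + 1) / e + 1.
have [l [g [n0 [/andP[l1 l2] gp m0 KZ]]]] := unbounded_sums K d0.
have K0 : 0 < K by rewrite ltr_wpDl// divr_ge0 ?ltW//; move: rho_gt0; lra.
have l0 : 0 < l by exact: lt_trans l1.
have [N N0 lN] := good_pos_exponent (good_gt l1).
(* A multiple of [N], so that [decay] bounds the last term; since N > 0, the sum does not become
   smaller. *)
pose n := (n0 * N)%N.
have mn : l^-1 ^+ n * m g n <= 1.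
  have := decay n0 l0 lN gp; rewrite m0 mulr1 -/n => h.
  rewrite exprVn ler_pdivrMl ?exprn_gt0// mulr1 (le_trans _ h)//.
  by rewrite -[leLHS]mul1r ler_wpM2r// exprn_ege1// ler1n.
have Zn : K <= Z l g n by rewrite (le_trans KZ)// Z_mono// leq_pmulr.
have Z0 : 0 < Z l g n by exact: lt_le_trans Zn.
pose P a := \sum_(0 <= k < n) (l^-1 ^+ k)%:C * dual B (iter k s) g a.
have Pp : ptrace P.
  apply: positive_trace_sum => k; apply: positive_trace_scale; last exact: dual_p.
  by rewrite exprn_ge0// invr_ge0 ltW.
have P1 : P 1 = (Z l g n)%:C.
  rewrite /P /Z (big_morph _ (@real_complexD R) (real_complex0 R)).
  by apply: eq_bigr => k _; rewrite dualE// mE// real_complexM.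
pose sigma a := (Z l g n)^-1%:C * P a.
have sp : ptrace sigma by apply: positive_trace_scale => //; rewrite invr_ge0 ltW.
have s1 : sigma 1 = 1.
  by rewrite /sigma P1 -real_complexM mulVf ?gt_eqF// real_complex1.
exists sigma; split=> // a Ba; have Bsa := op_sub sop Ba.
have E j : \sum_(0 <= k < j) (l^-1 ^+ k)%:C * dual B (iter k s) g (s a) -
    l%:C * (\sum_(0 <= k < j) (l^-1 ^+ k)%:C * dual B (iter k s) g a) =
    l%:C * ((l^-1 ^+ j)%:C * g (iter j s a) - g a).
  elim: j => [|j IH]; first by rewrite !big_geq// mulr0 subr0 expr0 real_complex1 mul1r
    subrr mulr0.
  rewrite !big_nat_recr//= mulrDr opprD addrACA IH !dualE// -iterSr /=.
  rewrite exprS real_complexM real_complexV.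
  have lc : l%:C != 0 by rewrite -cabs_eq0 cabs_real normr_eq0 gt_eqF.
  by field.
have ga := positive_trace_le csB gp Ba.
have gna : cabs (g (iter n s a)) <= 2 * nrm a * m g n.
  have := positive_trace_le csB (dual_p n gp) Ba.
  by rewrite !dualE// -/(m g n) => /le_trans; apply;
    rewrite -mulrA [m g n * _]mulrC mulrA.
have PE : cabs (P (s a) - l%:C * P a) <= l * (4 * nrm a).
  rewrite E cabsM cabs_real gtr0_norm// ler_wpM2l ?(ltW l0)//.
  rewrite (le_trans (cabsB _ _))// cabsM cabs_real.
  have li : 0 <= l^-1 ^+ n by rewrite exprn_ge0// invr_ge0 ltW.
  rewrite ger0_norm//.
  have : l^-1 ^+ n * cabs (g (iter n s a)) <= l^-1 ^+ n * (2 * nrm a * m g n).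
    by rewrite ler_wpM2l.
  have : l^-1 ^+ n * m g n * (2 * nrm a) <= 1 * (2 * nrm a).
    by rewrite ler_wpM2r// mulr_ge0// nrm_ge0.
  move: ga; rewrite -/(m g 0) m0; lra.
have sE : cabs (sigma (s a) - l%:C * sigma a) <= e / 2 * nrm a.
  have -> : sigma (s a) - l%:C * sigma a = (Z l g n)^-1%:C * (P (s a) - l%:C * P a).
    by rewrite /sigma; ring.
  rewrite cabsM cabs_real gtr0_norm ?invr_gt0// ler_pdivrMl//.
  rewrite (le_trans PE)// mulrA [leRHS]mulrA ler_wpM2r ?nrm_ge0//.
  have : K * (e / 2) <= Z l g n * (e / 2) by rewrite ler_wpM2r// ltW// divr_gt0.
  have : K * (e / 2) = 4 * (rho + 1) + e / 2.
    by rewrite /K; field; rewrite gt_eqF.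
  lra.
have sa2 := positive_trace_le csB sp Ba; rewrite s1 cabs1 in sa2.
have -> : sigma (s a) - rho%:C * sigma a =
    (sigma (s a) - l%:C * sigma a) + (l - rho)%:C * sigma a.
  by rewrite real_complexB; ring.
rewrite (le_trans (cabsD _ _))// cabsM cabs_real ger0_norm; last lra.
have : (l - rho) * cabs (sigma a) <= e / 4 * (2 * 1 * nrm a).
  by apply: ler_pM => //; [lra|exact: cabs_ge0|lra].
have := nrm_ge0 a; lra.
Qed.

Lemma krein_rutman : exists2 r : R, 0 < r &
  (exists g, [/\ ptrace g, g 1 = 1 & forall a, B a -> g (s a) = r%:C * g a]) /\
  (forall lambda, r < cabs lambda -> resolvable B s lambda).
Proof.
exists rho => //; split.
  by apply: eigenstate_of_approx => // e e0; exact: approx_eigenstate.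
by move=> lambda rl; apply: resolvable_good; exact: good_gt.
Qed.

End krein_rutman.

(** * Compressions by homogeneous elements, and fullness *)

Section compressions.
Context (R : realType) (A : cstarAlgType R).
Notation T := (cring A).
Notation sc := (sc A).
Variables (alpha : R -> T -> T) (gamma : R[i] -> T -> T).
Hypothesis alpha_group : automorphism_group (A := A) alpha.
Hypothesis alpha_gamma : induces_circle_action (A := A) alpha gamma.
Implicit Types (a b : T) (k l : int).

Notation Sp := (spectral_subspace (A := A) gamma).

Let csB := Sp0_closed alpha_group alpha_gamma.
Let SpM := SpM alpha_group alpha_gamma.
Let SpJ := Sp_adj alpha_group alpha_gamma.

Definition compression (I : finType) (x : I -> T) a : T :=
  \sum_j adj (x j) * a * x j.

(** For the trace property, sum_i x_i x_i^* = 1 is inserted between the factors. The resulting x_j^*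
    c x_i and x_i^* d x_j have degree 0, so the trace exchanges them although the x_j are not in
    A0. *)
Lemma compression_trace_op (I : finType) (x : I -> T) k :
  (forall j, Sp k (x j)) -> \sum_j x j * adj (x j) = 1 ->
  trace_op (Sp 0) (compression x).
Proof.
move=> xk x1.
have Bt i j a : Sp 0 a -> Sp 0 (adj (x i) * a * x j).
  by move=> a0; rewrite -(addNr k) -[- k]addr0; do 2?apply: SpM => //; exact: SpJ.
split.
- by move=> a a0; rewrite /compression; apply: (cs_sum _ csB) => j _; exact: Bt.
- move=> c a b _ _; rewrite /compression scaler_sumr -big_split; apply: eq_bigr => j _ /=.
  by rewrite mulrDr mulrDl -scalerAr -scalerAl.
- by move=> a _ pa; apply: pos_sum => j _; exact: pos_conj.
- exists (\sum_j nrm (x j) * nrm (x j)).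
    by apply: sumr_ge0 => j _; rewrite mulr_ge0 ?nrm_ge0.
  move=> a _; rewrite (le_trans (nrm_sum _ _ _))// mulr_suml; apply: ler_sum => j _.
  rewrite (le_trans (nrmM _ _))// mulrAC ler_wpM2r ?nrm_ge0//.
  by rewrite (le_trans (nrmM _ _))// nrm_adj.
- move=> tau a b tt a0 b0.
  have E (c d : T) : Sp 0 c -> Sp 0 d -> tau (compression x (c * d)) =
      \sum_j \sum_i tau ((adj (x j) * c * x i) * (adj (x i) * d * x j)).
    move=> c0 d0; rewrite (trace_sum csB tt) => [|j]; last by apply: Bt;
      exact: (cs_mul csB).
    apply: eq_bigr => j _; rewrite -(trace_sum csB tt) => [|i]; last first.
      by apply: (cs_mul csB); exact: Bt.
    congr tau; rewrite -{1}[c]mulr1 -x1 mulr_sumr mulr_suml mulr_sumr mulr_suml.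
    by apply: eq_bigr => i _; rewrite !mulrA.
  rewrite !E// exchange_big; apply: eq_bigr => j _; apply: eq_bigr => i _.
  by rewrite (trace_mulC tt)//; exact: Bt.
Qed.

(** The elements z_ij = y_i x_j have degree 0 and satisfy sum z_ij z_ij^* = 1. The composite is a
    |-> sum z_ij^* a z_ij, which has the same trace as a sum z_ij z_ij^* = a. *)
Lemma compression_inverse (I J : finType) (x : I -> T) (y : J -> T) k tau a :
  (forall j, Sp k (x j)) -> \sum_j x j * adj (x j) = 1 ->
  (forall j, Sp (- k) (y j)) -> \sum_j y j * adj (y j) = 1 ->
  bounded_trace (A := A) (Sp 0) tau -> Sp 0 a ->
  tau (compression x (compression y a)) = tau a.
Proof.
move=> xk x1 yk y1 tt a0.
have B2 i j : Sp 0 (y i * x j) by rewrite -(addNr k); exact: SpM.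
have -> : compression x (compression y a) =
    \sum_j \sum_i adj (y i * x j) * (a * (y i * x j)).
  apply: eq_bigr => j _; rewrite mulr_sumr mulr_suml; apply: eq_bigr => i _.
  by rewrite adjM !mulrA.
have B3 i j : Sp 0 (a * (y i * x j)) by exact: (cs_mul csB).
have B4 i j : Sp 0 (adj (y i * x j)) by exact: (cs_adj csB).
have aE : a = \sum_j \sum_i a * (y i * x j) * adj (y i * x j).
  rewrite exchange_big -[LHS]mulr1 -y1 mulr_sumr; apply: eq_bigr => i _.
  rewrite -{1}[y i]mulr1 -x1 mulr_sumr mulr_suml mulr_sumr; apply: eq_bigr => j _.
  by rewrite adjM !mulrA.
have ts (F : I -> J -> T) : (forall j i, Sp 0 (F j i)) ->
    tau (\sum_j \sum_i F j i) = \sum_j \sum_i tau (F j i).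
  move=> F0; rewrite (trace_sum csB tt) => [|j]; last exact: (cs_sum _ csB).
  by apply: eq_bigr => j _; rewrite (trace_sum csB tt).
rewrite [in RHS]aE (ts _ (fun j i => cs_mul csB (B4 i j) (B3 i j))).
rewrite (ts _ (fun j i => cs_mul csB (B3 i j) (B4 i j))).
by apply: eq_bigr => j _; apply: eq_bigr => i _; rewrite (trace_mulC tt).
Qed.

Lemma exists_unit_decomposition k : full_action (A := A) gamma ->
  exists (I : finType) (y : I -> T),
    (forall i, Sp k (y i)) /\ \sum_i y i * adj (y i) = 1.
Proof.
move=> /(_ k) full; have : Sp 0 (1 : T) by exact: (cs_one csB).
rewrite -full => /closure_nrm/(_ 2^-1); rewrite invr_gt0 => /(_ (ltr0n _ 2)).
move=> [b [n [c [u [uP bE]]]] b1].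
have [p pP] := choice uP; have [q qP] := choice pP.
pose w (i : 'I_n + 'I_n) : T :=
  match i with inl i => c i *: (p i : T) | inr i => adj (q i) end.
have wk i : Sp k (w i).
  case: i => i /=; case: (qP i) => h1 h2 _.
    exact: (Sp_scale alpha_group alpha_gamma).
  by have := SpJ h2; rewrite opprK.
pose g : T := \sum_i w i * adj (w i).
have g0 : Sp 0 g.
  by rewrite /g; apply: (cs_sum _ csB) => i _; rewrite -(addrN k); apply: SpM => //;
    exact: SpJ.
have {}bE : (b : T) = \sum_(i < n) (c i *: (p i : T)) * q i.
  by rewrite bE; apply: eq_bigr => i _; case: (qP i) => _ _ ->;
    exact: (scalerAl (c i) (p i : T) (q i)).
have pgb : pos (g - ((b : T) + adj (b : T))).
  have -> : g - ((b : T) + adj (b : T)) =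
      \sum_(i < n) (c i *: (p i : T) - adj (q i)) * adj (c i *: (p i : T) - adj (q i)).
    rewrite /g big_sumType /= -big_split bE adj_sum -big_split -sumrB /=.
    apply: eq_bigr => i _; move: (c i *: _) => z.
    rewrite adjB !adjK adjM mulrBr !mulrBl opprB [RHS]addrACA -opprD.
    by rewrite [adj (q i) * adj z + _]addrC.
  by apply: pos_sum => i _; set z := _ - _; rewrite -{1}[z]adjK; exact: pos_adjM.
have pb : pos ((b : T) + adj (b : T) - 1).
  have -> : (b : T) + adj (b : T) - 1 = sc 1 - ((1 - (b : T)) + adj (1 - (b : T))).
    have -> : (1 - (b : T)) + adj (1 - (b : T)) = (1 + 1) - ((b : T) + adj (b : T)).
      by rewrite adjB adj1 addrACA -opprD.
    by rewrite sc1 opprB addrCA opprD [1 + _]addrA subrr add0r.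
  apply: pos_scB; first by rewrite /sa adjD adjK addrC.
  rewrite (le_trans (nrmD _ _))// nrm_adj.
  move: b1; rewrite -[b in (1 - b)]/(b : T) => b1.
  have {}b1 : nrm (1 - (b : T)) < 2^-1 by exact: b1.
  lra.
have pg1 : pos (g - sc 1).
  by rewrite sc1 -[g](subrK ((b : T) + adj (b : T))) -addrA; exact: posD.
have [r [pr gr rg Cr]] := exists_inv pg1 ltr01.
have [h [ph hh Ch]] := exists_sqrt pr.
have sh := pos_sa ph.
have h0 : Sp 0 h by exact: (Ch _ csB (Cr _ csB g0)).
have gh : g * h = h * g.
  apply: (@Cgen_comm _ _ g r) => //; last by rewrite gr rg.
  by rewrite -[g](subrK (sc 1)); apply: saD; [exact: pos_sa pg1|exact: sa_sc].
exists ('I_n + 'I_n)%type, (fun i => h * w i); split.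
  by move=> i; have := SpM h0 (wk i); rewrite add0r.
under eq_bigr do rewrite adjM sh !mulrA -[h * w _ * _]mulrA.
by rewrite -mulr_suml -mulr_sumr -/g -gh -mulrA hh.
Qed.

End compressions.

(** * KMS states *)

Section power_series.
Context (R : realType) (A : cstarAlgType R).
Notation T := (cring A).
Notation sc := (sc A).
Implicit Types (a b : T) (d : nat -> T) (t e r theta : R) (n k : nat) (z w : R[i]).

Definition psum d z n : T := \sum_(0 <= k < n) z ^+ k *: d k.

Lemma psum_le d t n M : 0 <= t < 1 -> (forall k, nrm (d k) <= M) ->
  nrm (psum d t%:C n) <= M / (1 - t).
Proof.
move=> /andP[t0 t1] dM; have t1' : 0 < 1 - t by rewrite subr_gt0.
have M0 : 0 <= M by rewrite (le_trans (nrm_ge0 _) (dM 0%N)).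
rewrite ler_pdivlMr//.
suff : nrm (psum d t%:C n) * (1 - t) <= M * (1 - t ^+ n).
  move=> /le_trans; apply; rewrite -[leRHS]mulr1 ler_wpM2l// gerBl.
  exact: exprn_ge0.
elim: n => [|n IH]; first by rewrite /psum big_geq// nrm0 expr0 subrr mul0r mulr0.
have : nrm (psum d t%:C n.+1) <= nrm (psum d t%:C n) + t ^+ n * M.
  rewrite /psum big_nat_recr//= (le_trans (nrmD _ _))// lerD2l.
  rewrite -real_complexX nrmZ_ge0 ?exprn_ge0//.
  by rewrite ler_wpM2l// exprn_ge0.
move=> h; have {h} : nrm (psum d t%:C n.+1) * (1 - t) <= (nrm (psum d t%:C n) + t ^+ n
  * M) * (1 - t).
  by rewrite ler_pM2r.
rewrite exprS; lra.
Qed.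

(** Convergence at t = 1 bounds the coefficients, as differences of partial sums. The leading
    coefficient then vanishes by letting t tend to 0, and the next ones after division by a power of
    t. *)
Lemma power_series_eq0 d : (forall t, tends (psum d t%:C) 0) -> forall n, d n = 0.
Proof.
move=> d0.
have [M M0 dM] : exists2 M, 0 <= M & forall n, nrm (d n) <= M.
  have [|N hN] := d0 1 2^-1; first by lra.
  have M1 : 0 <= \sum_(0 <= k < N) nrm (d k) by apply: sumr_ge0 => k _; exact: nrm_ge0.
  exists (1 + \sum_(0 <= k < N) nrm (d k)); first by lra.
  move=> n; have [Nn|nN] := leqP N n.
    have h1 := hN n Nn; have h2 := hN n.+1 (leqW Nn); rewrite !subr0 in h1 h2.
    have -> : d n = psum d 1%:C n.+1 - psum d 1%:C n.
      by rewrite /psum big_nat_recr//= [X in X - _]addrC addrK real_complex1 expr1n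
        scale1r.
    by rewrite (le_trans (nrmB _ _))//; lra.
  rewrite (big_cat_nat (leq0n n) (ltnW nN))/= [X in _ + (_ + X)]big_ltn//.
  have : 0 <= \sum_(0 <= k < n) nrm (d k) by apply: sumr_ge0 => k _; exact: nrm_ge0.
  have : 0 <= \sum_(n.+1 <= k < N) nrm (d k) by apply: sumr_ge0 => k _; exact: nrm_ge0.
  lra.
(* All shifts of [d] obey the same bound [M]. Dividing by t^m is why only t > 0 is kept. *)
suff shift d' : (forall n, nrm (d' n) <= M) -> (forall t, 0 < t -> tends (psum d' t%:C)
  0) ->
    d' 0%N = 0.
  have all0 m : (forall j, (j < m)%N -> d j = 0) -> d m = 0.
    move=> dj; rewrite -[m]addn0; apply: (shift (fun j => d (m + j)%N)) => // t t0 e e0.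
    have tm : 0 < t ^+ m by rewrite exprn_gt0.
    have [|N hN] := d0 t (t ^+ m * e); first by rewrite mulr_gt0.
    exists N => n Nn; have := hN (m + n)%N (leq_trans Nn (leq_addl _ _)).
    rewrite !subr0; have -> : psum d t%:C (m + n) = (t ^+ m)%:C *: psum (fun j => d (m
      + j)%N) t%:C n.
      rewrite /psum (big_cat_nat (leq0n m) (leq_addr n m))/= big_nat big1 ?add0r.
        rewrite -{1}[m]add0n big_addn addKn scaler_sumr; apply: eq_bigr => j _.
        by rewrite scalerA real_complexX -exprD addnC.
      by move=> j /andP[_ /dj ->]; rewrite scaler0.
    by rewrite nrmZ_ge0 ?(ltW tm)// ltr_pM2l.
  move=> n; elim/ltn_ind: n => n; exact: all0.
move=> d'M d'0; apply: nrm_lt_eq0 => e e0.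
(* t <= 1/2 bounds the tail sum by 2 M, and the second bound makes its contribution at most e/2. *)
pose t := Num.min 2^-1 (e / (4 * (M + 1))).
have M1 : 0 < M + 1 by lra.
have t0 : 0 < t by rewrite lt_min invr_gt0 ltr0n /= divr_gt0// mulr_gt0.
have t2 : t <= 2^-1 by rewrite ge_min lexx.
have te : t * (4 * (M + 1)) <= e.
  by rewrite -ler_pdivlMr ?mulr_gt0// ge_min lexx orbT.
have [|N hN] := d'0 t t0 (e / 2); first by rewrite divr_gt0.
have := hN N.+1 (leqnSn N); rewrite subr0.
have -> : psum d' t%:C N.+1 = d' 0%N + t%:C *: psum (fun j => d' j.+1) t%:C N.
  rewrite /psum big_ltn// expr0 scale1r; congr (_ + _).
  rewrite big_add1 scaler_sumr; apply: eq_bigr => j _.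
  by rewrite scalerA exprS.
move=> h; have t01 : 0 <= t < 1 by apply/andP; split; lra.
have := psum_le N t01 (fun k => d'M k.+1); set S := psum _ _ _ in h *.
rewrite ler_pdivlMr; last lra.
move=> hS; have S2 : nrm S <= 2 * M.
  have : nrm S * 2^-1 <= nrm S * (1 - t) by rewrite ler_wpM2l ?nrm_ge0//; lra.
  lra.
have := nrmB (d' 0%N + t%:C *: S) (t%:C *: S); rewrite addrK nrmZ_ge0 ?(ltW t0)//.
have : t * nrm S <= t * (2 * M) by rewrite ler_wpM2l// ltW.
lra.
Qed.

(** Partial sums of the exponential series. The limit is identified only on the two axes: imaginary
    arguments give the circle action, real ones the factor at i beta. *)
Definition cexp_sum w n : R[i] := \sum_(0 <= k < n) w ^+ k / k`!%:R.

Lemma cexp_sum_real r : ctends (cexp_sum r%:C) (expR r)%:C.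
Proof.
move=> e e0.
have /cvgrPdist_lt/(_ _ e0)[N _ hN] := is_cvg_series_exp_coeff r.
exists N => n Nn; have -> : cexp_sum r%:C n = (series (exp_coeff r) n)%:C.
  rewrite /cexp_sum seriesEnat (big_morph _ (@real_complexD R) (real_complex0 R)).
  apply: eq_bigr => k _; rewrite /exp_coeff /= real_complexM real_complexX real_complexV.
  by congr (_ / _); rewrite [RHS](rmorph_nat (real_complex R)).
rewrite -real_complexB cabs_real distrC; exact: hN.
Qed.

Lemma cexp_sum_imag theta : ctends (cexp_sum (iC R * theta%:C)) (expi theta).
Proof.
move=> e e0; have e20 : 0 < e / 2 by rewrite divr_gt0.
have /cvgrPdist_lt/(_ _ e20)[N1 _ h1] := @is_cvg_series_cos_coeff _ theta.
have /cvgrPdist_lt/(_ _ e20)[N2 _ h2] := @is_cvg_series_sin_coeff _ theta.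
exists (maxn N1 N2) => n; rewrite geq_max => /andP[/h1 /= {}h1 /h2 /= {}h2].
have -> : cexp_sum (iC R * theta%:C) n =
    (series (cos_coeff theta) n)%:C + (series (sin_coeff theta) n)%:C * iC R.
  rewrite /cexp_sum !seriesEnat !(big_morph _ (@real_complexD R) (real_complex0 R)).
  rewrite mulr_suml -big_split; apply: eq_bigr => k _ /=.
  rewrite cos_coeffE sin_coeffE /= !real_complexM !real_complexX !real_complexV.
  (* Even powers of i are real and produce the cosine coefficients, odd ones are imaginary and
     produce the sine coefficients. *)
  rewrite exprMn; have -> : iC R ^+ k = ((~~ odd k)%:R * (-1) ^+ k./2 : R)%:C +
      ((odd k)%:R * (-1) ^+ k.-1./2 : R)%:C * iC R.
    rewrite -{1}[k]odd_double_half; case: (boolP (odd k)) => ok /=.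
      have -> : k.-1./2 = k./2.
        by rewrite -{1}[k]odd_double_half ok /= doubleK.
      rewrite exprS -mul2n exprM expr2 iC2 !mul0r real_complex0 add0r mul1r.
      by rewrite real_complexX real_complexN real_complex1 mulrC.
    rewrite add0n -mul2n exprM expr2 iC2 !mul0r ?real_complex0 ?mul0r addr0 mul1r.
    by rewrite real_complexX real_complexN real_complex1.
  rewrite !(real_complexM, real_complexX, real_complexV) (_ : (k`!%:R : R)%:C =
    k`!%:R); last by rewrite [LHS](rmorph_nat (real_complex R)).
  ring.
have -> : expi theta = (cos theta)%:C + (sin theta)%:C * iC R by rewrite /iC /expi; simpc.
set x := series _ n in h1 *; set y := series _ n in h2 *.
have -> : x%:C + y%:C * iC R - ((cos theta)%:C + (sin theta)%:C * iC R) =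
  (x - cos theta)%:C + (y - sin theta)%:C * iC R by rewrite !real_complexB; ring.
rewrite (le_lt_trans (cabsD _ _))// cabsM cabs_iC mulr1 !cabs_real [ltRHS](splitr e)
  ltrD//.
  by rewrite distrC cos.unlock.
by rewrite distrC sin.unlock.
Qed.

Lemma cexp_sum_cauchy w e : 0 < e -> exists N, forall m n, (N <= m)%N -> (N <= n)%N ->
  cabs (cexp_sum w m - cexp_sum w n) < e.
Proof.
move=> e0; have e20 : 0 < e / 2 by rewrite divr_gt0.
have /cvgrPdist_lt/(_ _ e20)[N _ hN] := is_cvg_series_exp_coeff (cabs w).
exists N => m n; wlog mn : m n / (n <= m)%N.
  move=> h Nm Nn; have [nm|mn] := leqP n m; first exact: h.
  by rewrite cabs_sub; apply: h => //; exact: ltnW.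
move=> Nm Nn; have := hN m Nm; have := hN n Nn; rewrite /=.
set E := limn _ => h1 h2.
have : cabs (cexp_sum w m - cexp_sum w n) <=
    series (exp_coeff (cabs w)) m - series (exp_coeff (cabs w)) n.
  have -> : cexp_sum w m - cexp_sum w n = \sum_(n <= k < m) w ^+ k / k`!%:R.
    by rewrite /cexp_sum (big_cat_nat (leq0n n) mn)/= addrAC subrr add0r.
  have -> : series (exp_coeff (cabs w)) m - series (exp_coeff (cabs w)) n =
      \sum_(n <= k < m) exp_coeff (cabs w) k.
    by rewrite !seriesEnat /= (big_cat_nat (leq0n n) mn)/= addrAC subrr add0r.
  rewrite (le_trans (cabs_sum _ _))//.
  apply: ler_sum => k _; rewrite /exp_coeff /= cabsM cabsX cabsV.
  by rewrite -(rmorph_nat (real_complex R)) cabs_real normr_nat.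
move: h1 h2; rewrite !ltr_norml => /andP[h1 h1'] /andP[h2 h2'].
lra.
Qed.

Lemma cexp_sum_scale w (l : R[i]) b : ctends (cexp_sum w) l ->
  tends (fun n => cexp_sum w n *: b) (l *: b).
Proof.
move=> wl e e0; have b0 : 0 < nrm b + 1 by rewrite ltr_wpDl// nrm_ge0.
have [|N hN] := wl (e / (nrm b + 1)); first by rewrite divr_gt0.
exists N => n /hN; rewrite ltr_pdivlMr// -scalerBl nrmZ -/(cabs _) => /(le_lt_trans _);
  apply.
by rewrite ler_wpM2l ?cabs_ge0// lerDl.
Qed.

Lemma cexp_sum_cvg w b : exists l, tends (fun n => cexp_sum w n *: b) l.
Proof.
apply: tends_cauchy => e e0; have b0 : 0 < nrm b + 1 by rewrite ltr_wpDl// nrm_ge0.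
have [|N hN] := @cexp_sum_cauchy w (e / (nrm b + 1)); first by rewrite divr_gt0.
exists N => m n Nm Nn; have := hN m n Nm Nn.
rewrite ltr_pdivlMr// -scalerBl nrmZ -/(cabs _) => /(le_lt_trans _); apply.
by rewrite ler_wpM2l ?cabs_ge0// lerDl.
Qed.

Variables (alpha : R -> T -> T) (gamma : R[i] -> T -> T).
Hypothesis alpha_group : automorphism_group (A := A) alpha.
Hypothesis alpha_gamma : induces_circle_action (A := A) alpha gamma.
Notation Sp := (spectral_subspace (A := A) gamma).
Notation entire := (entire_extension (A := A) alpha).

Lemma entireP b (F : R[i] -> T) : entire b F <->
  (exists d, forall z, tends (psum d z) (F z)) /\ (forall t, F t%:C = alpha t b).
Proof.
have E d z : series (fun n => z ^+ n *: (d n : A)) = psum d z.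
  by apply/funext => n; rewrite seriesEnat.
by split=> -[[d h] h2]; split=> //; exists d => z; [rewrite -E; apply/cvg_tends;
  exact: h|rewrite E; apply/cvg_tends; exact: h].
Qed.

Lemma entire_unique b (F G : R[i] -> T) : entire b F -> entire b G -> F = G.
Proof.
move=> /entireP[[c cF] Ft] /entireP[[d dG] Gt].
have E z n : psum (fun k => -1 *: d k + c k) z n = -1 *: psum d z n + psum c z n.
  rewrite /psum scaler_sumr -big_split; apply: eq_bigr => k _ /=.
  by rewrite scalerDr !scalerA mulrC.
have cd n : -1 *: d n + c n = 0.
  apply: (@power_series_eq0 (fun k => -1 *: d k + c k)) => t.
  have := tends_linear (-1) (dG t%:C) (cF t%:C); rewrite Ft Gt scaleN1r addNr.
  by congr tends; apply/funext => m; rewrite E.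
apply/funext => z; apply: (tends_unique (cF z)); have := dG z; congr tends.
apply/funext => n; rewrite /psum; apply: eq_bigr => k _; congr (_ *: _).
by have := cd k; rewrite scaleN1r => /eqP; rewrite addrC subr_eq0 => /eqP.
Qed.

Lemma entire_linear (c : R[i]) a b (F G : R[i] -> T) : entire a F -> entire b G ->
  entire (c *: a + b) (fun z => c *: F z + G z).
Proof.
move=> /entireP[[u uF] Ft] /entireP[[v vG] Gt]; apply/entireP; split; last first.
  move=> t; rewrite Ft Gt; have aut : star_automorphism (A := A) (alpha t) by case:
    alpha_group.
  by rewrite (aut_linear aut).
exists (fun k => c *: u k + v k) => z.
have := tends_linear c (uF z) (vG z); congr tends; apply/funext => n.
rewrite /psum scaler_sumr -big_split; apply: eq_bigr => k _ /=.
by rewrite scalerDr !scalerA mulrC.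
Qed.

(** The extension is z |-> exp(i k z) b, built from the exponential series. *)
Lemma exists_entire_Sp (k : int) b : Sp k b -> exists2 F : R[i] -> T, entire b F &
  forall beta : R, F (0 +i* beta) = (expR (- (beta *~ k)))%:C *: b.
Proof.
move=> /(SpP alpha_gamma) kb; pose kap : R := k%:~R.
have [F FP] := choice (fun z => cexp_sum_cvg (z * (iC R * kap%:C)) b).
exists F.
  apply/entireP; split.
    exists (fun j => ((iC R * kap%:C) ^+ j / j`!%:R) *: b) => z.
    have := FP z; congr tends; apply/funext => n.
    rewrite /psum /cexp_sum scaler_suml; apply: eq_bigr => j _.
    by rewrite scalerA exprMn mulrA.
  move=> t; rewrite kb -expiMz; apply: (tends_unique (FP _)).
  have -> : t%:C * (iC R * kap%:C) = iC R * (t *~ k)%:C.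
    by rewrite mulrCA -real_complexM -mulrzr.
  exact/cexp_sum_scale/cexp_sum_imag.
move=> beta; apply: (tends_unique (FP _)).
have -> : (0 +i* beta) * (iC R * kap%:C) = (- (beta *~ k))%:C.
  rewrite -mulrzr -/kap (_ : 0 +i* beta = iC R * beta%:C); last by rewrite /iC; simpc.
  by rewrite mulrACA iC2 -real_complexM mulN1r real_complexN.
exact/cexp_sum_scale/cexp_sum_real.
Qed.

End power_series.

Section KMS.
Context (R : realType) (A : cstarAlgType R).
Notation T := (cring A).
Notation sc := (sc A).
Variables (alpha : R -> T -> T) (gamma : R[i] -> T -> T).
Hypothesis alpha_group : automorphism_group (A := A) alpha.
Hypothesis alpha_periodic : periodic_2pi (A := A) alpha.
Hypothesis alpha_gamma : induces_circle_action (A := A) alpha gamma.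
Variables (I : finType) (x : I -> T).
Notation Sp := (spectral_subspace (A := A) gamma).
Hypothesis x1 : forall j, Sp 1 (x j).
Hypothesis x_sum : \sum_j x j * adj (x j) = 1.
Implicit Types (a b : T) (k l : int) (beta : R).

Notation span := (linear_span (K := R[i]) (V := A) (\bigcup_k Sp k)).
Notation s := (compression x).

Let csB := Sp0_closed alpha_group alpha_gamma.
Let SpM := SpM alpha_group alpha_gamma.
Let SpJ := Sp_adj alpha_group alpha_gamma.

Definition trace_eigenstate (r : R) (g : T -> R[i]) : Prop :=
  [/\ positive_trace (Sp 0) g, g 1 = 1 & forall a, Sp 0 a -> g (s a) = r%:C * g a].

Lemma span_Sp k a : Sp k a -> span a.
Proof.
move=> ka; exists 1%N, (fun=> 1), (fun=> a); split=> [_|]; first by exists k.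
by rewrite big_ord1 scale1r.
Qed.

(** For homogeneous [b] of degree k the condition reads e^(-beta k) omega(ab) = omega(ba). Degree 0
    gives the trace property; taking b = x_j and x_j^* a for the other factor, and summing over j,
    gives omega(a) = e^(-beta) omega(s a). *)
Lemma eigenstate_of_KMS beta omega : KMS_state (A := A) alpha gamma beta omega ->
  exists g, trace_eigenstate (expR beta) g.
Proof.
move=> [[ol op o1] kms].
have olin (c : R[i]) a b : omega (c *: a + b) = c * omega a + omega b by exact: ol.
have oD a b : omega (a + b) = omega a + omega b.
  by have := olin 1 a b; rewrite scale1r mul1r.
have o0 : omega (0 : T) = 0 by apply: (addrI (omega (0 : T))); rewrite -oD !addr0.
have oZ (c : R[i]) a : omega (c *: a) = c * omega a.
  by have := olin c a 0; rewrite o0 !addr0.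
have opos a : pos a -> 0 <= omega a.
  move=> /exists_sqrt[u [pu <- _]].
  have ou : 0 <= omega (adj u * u) := op u.
  by move: ou; rewrite (pos_sa pu).
have osum (J : Type) (r : seq J) (F : J -> T) :
    omega (\sum_(j <- r) F j) = \sum_(j <- r) omega (F j).
  by rewrite (big_morph omega oD o0).
have kmsE k l a b : Sp l a -> Sp k b ->
    (expR (- (beta *~ k)))%:C * omega (a * b) = omega (b * a).
  move=> la kb; have [F Fe FE] := kms a b (span_Sp la) (span_Sp kb).
  have [G Ge GE] := exists_entire_Sp alpha_gamma kb.
  have FG := entire_unique Fe Ge.
  have {}FE : omega (a * F (0 +i* beta)) = omega (b * a) by exact: FE.
  by rewrite -FE FG GE -scalerAr oZ.
pose g a := if a \in (Sp 0 : set T) then omega a else 0.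
have gE a : Sp 0 a -> g a = omega a by move=> a0; rewrite /g mem_set.
have g_out a : ~ Sp 0 a -> g a = 0 by move=> a0; rewrite /g memNset.
have glin (c : R[i]) a b : Sp 0 a -> Sp 0 b -> g (c *: a + b) = c * g a + g b.
  move=> a0 b0; rewrite !gE//.
  by apply: (cs_add csB) => //; exact: (cs_scale csB).
have gpos a : Sp 0 a -> pos a -> 0 <= g a by move=> a0 pa; rewrite gE// opos.
exists g; split.
- split=> //; apply/bounded_traceP; split=> //.
    by exists (2 * cabs (g 1)) => a a0; apply: (positive_functional_le csB).
  move=> a b a0 b0; have M a' b' : Sp 0 a' -> Sp 0 b' -> Sp 0 (a' * b').
    exact: (cs_mul csB).
  rewrite !gE; [|exact: M|exact: M].
  by rewrite -(kmsE 0 0)// mulr0z oppr0 expR0 real_complex1 mul1r.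
- by rewrite gE//; exact: (cs_one csB).
- move=> a a0; have opx := compression_trace_op alpha_group alpha_gamma x1 x_sum.
  rewrite !gE//; last exact: (op_sub opx).
  have : omega a = (expR (- beta))%:C * omega (s a).
    rewrite osum mulr_sumr -{1}[a]mul1r -x_sum mulr_suml osum.
    apply: eq_bigr => j _; rewrite -mulrA -(kmsE 1 (- 1))//.
    by rewrite -[- 1]addr0; apply: SpM => //; exact: SpJ.
  move=> ->; rewrite mulrA -real_complexM -expRD subrr expR0 real_complex1 mul1r//.
Qed.

(* Inserting [sum_j x j * adj (x j) = 1] between [a] and [b] lowers the degree
   [k] by one. *)
Lemma eigenstate_twist beta g : trace_eigenstate (expR beta) g ->
  forall k a b, Sp (- k) a -> Sp k b ->
  (expR (- (beta *~ k)))%:C * g (a * b) = g (b * a).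
Proof.
move=> [[gt gp] g1 gs].
have nat_case n a b : Sp (- n%:Z) a -> Sp n%:Z b ->
    (expR (- (beta *~ n%:Z)))%:C * g (a * b) = g (b * a).
  elim: n a b => [|n IH] a b ha hb.
    rewrite oppr0 in ha.
    by rewrite mulr0z oppr0 expR0 real_complex1 mul1r (trace_mulC gt).
  have ax j : Sp (- n%:Z) (a * x j).
    by have := SpM ha (x1 j); rewrite intS opprD addrAC addNr add0r.
  have xb j : Sp n%:Z (adj (x j) * b).
    by have := SpM (SpJ (x1 j)) hb; rewrite intS addrA addNr add0r.
  have ba0 : Sp 0 (b * a) by have := SpM hb ha; rewrite subrr.
  have -> : a * b = \sum_j (a * x j) * (adj (x j) * b).
    rewrite -{1}[a]mulr1 -x_sum mulr_sumr mulr_suml.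
    by apply: eq_bigr => j _; rewrite !mulrA.
  have axb j : Sp 0 ((a * x j) * (adj (x j) * b)).
    by have := SpM (ax j) (xb j); rewrite addNr.
  have xba j : Sp 0 (adj (x j) * (b * a) * x j).
    have := SpM (SpM (SpJ (x1 j)) ba0) (x1 j).
    by rewrite addr0 addNr.
  rewrite (trace_sum csB gt)// mulr_sumr.
  have -> : g (b * a) = (expR (- beta))%:C * g (s (b * a)).
    by rewrite gs// mulrA -real_complexM -expRD addNr expR0 real_complex1 mul1r.
  rewrite (trace_sum csB gt)// mulr_sumr; apply: eq_bigr => j _.
  rewrite intS mulrzDr mulr1z opprD expRD real_complexM -mulrA (IH _ _ (ax j) (xb j)).
  by rewrite !mulrA.
(* Negative degrees follow by exchanging [a] and [b]. *)
move=> [n|n] a b ha hb; first exact: nat_case.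
have {}ha : Sp n.+1%:Z a by rewrite -[n.+1%:Z]opprK -NegzE.
rewrite NegzE in hb *.
rewrite -(nat_case n.+1 b a hb ha) mulrNz opprK mulrA -real_complexM -expRD subrr.
by rewrite expR0 real_complex1 mul1r.
Qed.

Lemma KMS_of_eigenstate beta g : trace_eigenstate (expR beta) g ->
  exists omega, KMS_state (A := A) alpha gamma beta omega.
Proof.
move=> geig; have tw := eigenstate_twist geig; have [[gt gp] g1 gs] := geig.
have [E [E0 Eid Elin Epos Ezero]] :=
  exists_expectation alpha_group alpha_periodic alpha_gamma.
pose omega a := g (E a).
have olin (c : R[i]) a b : omega (c *: a + b) = c * omega a + omega b.
  by rewrite /omega Elin (trace_linear gt).
have oD a b : omega (a + b) = omega a + omega b.
  by have := olin 1 a b; rewrite scale1r mul1r.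
have o0 : omega 0 = 0 by apply: (addrI (omega 0)); rewrite -oD !addr0.
have oZ (c : R[i]) a : omega (c *: a) = c * omega a.
  by have := olin c a 0; rewrite o0 !addr0.
have osum (J : Type) (r : seq J) (F : J -> T) :
    omega (\sum_(j <- r) F j) = \sum_(j <- r) omega (F j).
  by rewrite (big_morph omega oD o0).
have okms k l a b : Sp l a -> Sp k b ->
    (expR (- (beta *~ k)))%:C * omega (a * b) = omega (b * a).
  move=> la kb; have lkab := SpM la kb; have klba := SpM kb la.
  (* If the degrees do not cancel, the expectation annihilates both sides. *)
  have [lk|lk] := eqVneq (l + k) 0.
    have lE : l = - k by apply/eqP; rewrite -subr_eq0 opprK lk.
    rewrite lk in lkab; rewrite addrC lk in klba.
    rewrite /omega (Eid _ lkab) (Eid _ klba).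
    by apply: tw => //; rewrite -lE.
  rewrite /omega (Ezero _ _ lk lkab) (Ezero _ _ _ klba) ?(trace_0 csB gt) ?mulr0//.
  by rewrite addrC.
exists omega; split.
  split.
  - exact: olin.
  - by move=> a; apply: gp; [exact: E0|apply: Epos; exact: pos_adjM].
  - have -> : omega (1 : T) = 1 by rewrite /omega Eid//; exact: (cs_one csB).
    by [].
suff kms (a b : T) : span a -> span b -> exists2 F : R[i] -> T,
    entire_extension (A := A) alpha b F & omega (a * F (0 +i* beta)) = omega (b * a).
  by move=> a b; exact: kms.
move=> [n [c [u [uP aE]]]] [m [d [v [vP bE]]]].
(* The extension of [b] is assembled term by term, so the claim is generalized to sums over an
   arbitrary list of indices. *)
have key (r : seq 'I_m) : exists2 F : R[i] -> T,
    entire_extension (A := A) alpha (\sum_(i <- r) d i *: (v i : T)) F &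
    omega (a * F (0 +i* beta)) = omega ((\sum_(i <- r) d i *: (v i : T)) * a).
  elim: r => [|i r [F Fe FE]].
    exists (fun=> 0); last by rewrite big_nil mulr0 mul0r.
    apply/entireP; split; last first.
      move=> t; have aut : star_automorphism (A := A) (alpha t) by case: alpha_group.
      by rewrite big_nil (aut0 aut).
    exists (fun=> 0) => z; have := @tends_cst _ A 0; congr tends.
    by apply/funext => n'; rewrite /psum big1// => k _; rewrite scaler0.
  have [k _ kv] := vP i; have [G Ge GE] := exists_entire_Sp alpha_gamma kv.
  have := entire_linear alpha_group (d i) Ge Fe => He.
  exists (fun z => d i *: G z + F z); rewrite big_cons//.
  rewrite mulrDr mulrDl oD FE [RHS]oD; congr (_ + _).
  rewrite GE -!scalerAr -scalerAl !oZ; congr (_ * _).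
  have -> : (a : T) = \sum_(j < n) c j *: (u j : T) by exact: aE.
  rewrite mulr_suml mulr_sumr !osum mulr_sumr; apply: eq_bigr => j _.
  have [l _ lu] := uP j.
  by rewrite -scalerAl -scalerAr !oZ mulrCA (okms _ _ _ _ lu kv).
have [F Fe FE] := key (index_enum 'I_m).
by exists F; rewrite bE.
Qed.

Lemma inverse_temperatureP beta :
  inverse_temperatures (A := A) alpha gamma beta <->
  exists g, trace_eigenstate (expR beta) g.
Proof.
split=> [[omega]|[g]]; first exact: eigenstate_of_KMS.
exact: KMS_of_eigenstate.
Qed.

(** By continuity of the exponential, an eigenstate at a nearby temperature is an approximate one
    for expR beta. Closeness e/2 of the eigenvalues offsets the factor 2 of [positive_trace_le]. *)
Lemma closed_inverse_temperatures : closed (inverse_temperatures (A := A) alpha gamma).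
Proof.
move=> beta cl; apply/inverse_temperatureP.
apply: eigenstate_of_approx (compression_trace_op alpha_group alpha_gamma x1 x_sum) _
  => //.
move=> e e0; have e20 : 0 < e / 2 by rewrite divr_gt0.
have /cvgrPdist_lt/(_ _ e20) near_beta := @continuous_expR R beta.
have [b' [/inverse_temperatureP[g [gp g1 gs]] /= hb]] := cl _ near_beta.
exists g; split=> // a a0; rewrite gs//.
have -> : (expR b')%:C * g a - (expR beta)%:C * g a = (expR b' - expR beta)%:C * g a.
  by rewrite real_complexB mulrBl.
rewrite cabsM cabs_real distrC.
have := positive_trace_le csB gp a0; rewrite g1 cabs1 mulr1 => ga.
rewrite (le_trans (ler_pM (normr_ge0 _) (cabs_ge0 _) (ltW hb) ga))//.
by rewrite mulrA divfK ?pnatr_eq0.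
Qed.

End KMS.

(** * Spectral radii as extreme eigenvalues *)

Section spectral_radii.
Context (R : realType) (A : cstarAlgType R).
Notation T := (cring A).
Variables (B : set T) (s s' : T -> T) (g0 : T -> R[i]).
Hypothesis csB : closed_star_subalgebra B.
Hypothesis sop : trace_op B s.
Hypothesis sop' : trace_op B s'.
Hypothesis ss' : forall tau a,
  bounded_trace (A := A) B tau -> B a -> tau (s (s' a)) = tau a.
Hypothesis s's : forall tau a,
  bounded_trace (A := A) B tau -> B a -> tau (s' (s a)) = tau a.
Hypothesis g0_positive : positive_trace B g0.
Hypothesis g0_1 : g0 1 = 1.

Let eigenstate r := exists g,
  [/\ positive_trace B g, g 1 = 1 & forall a, B a -> g (s a) = r%:C * g a].

Let spec := spectrum (A := A) B (dual B s).

Let eigen_spectrum r : eigenstate r -> spec r%:C.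
Proof.
move=> [g [[gt _] g1 gs]]; apply: (eigenvalue_spectrum sop gt) => //.
by rewrite g1 oner_eq0.
Qed.

Let resolvable_spectrum lambda : resolvable B s lambda -> ~ spec lambda.
Proof. by move=> rs sp; apply: sp; exact: invertible_of_resolvable. Qed.

(** The Krein-Rutman eigenvalue is itself spectral and nothing of larger modulus is, so it is the
    supremum. *)
Lemma r_max_eigenstate : exists2 r, r_max (A := A) B (dual B s) = r &
  [/\ 0 < r, eigenstate r & forall q, 0 < q -> eigenstate q -> q <= r].
Proof.
have [r r0 [reig rres]] := krein_rutman csB sop sop' ss' g0_positive g0_1.
have ub lambda : spec lambda -> cabs lambda <= r.
  by move=> sl; rewrite leNgt; apply/negP => /rres/resolvable_spectrum.
have rspec : [set complex.Re `|lambda| | lambda in spec] r.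
  exists r%:C; first exact: eigen_spectrum.
  by rewrite -/(cabs _) cabs_real gtr0_norm.
exists r.
  apply/eqP; rewrite eq_le; apply/andP; split.
    by apply: ge_sup; [exists r|move=> _ [lambda sl <-]; exact: ub].
  by apply: sup_ubound => //; exists r => _ [lambda sl <-]; exact: ub.
split=> // q q0 /eigen_spectrum/ub.
by rewrite cabs_real gtr0_norm.
Qed.

(** The Krein-Rutman eigenvalue r of the inverse becomes the eigenvalue r^-1 of [s]. A nonzero
    lambda with modulus below r^-1 is handled through lambda^-1, and 0 by invertibility. *)
Lemma r_min_eigenstate : exists2 r, r_min (A := A) B (dual B s) = r &
  [/\ 0 < r, eigenstate r & forall q, 0 < q -> eigenstate q -> r <= q].
Proof.
have [r r0 [[g [gp g1 gs]] rres]] := krein_rutman csB sop' sop s's g0_positive g0_1.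
have [gt _] := gp.
have ri0 : 0 < r^-1 by rewrite invr_gt0.
have reig : eigenstate r^-1.
  exists g; split=> // a Ba; have := gs _ (op_sub sop Ba); rewrite s's// => ->.
  by rewrite mulrA -real_complexM mulVf ?gt_eqF// real_complex1 mul1r.
have lb lambda : spec lambda -> r^-1 <= cabs lambda.
  move=> sl; rewrite leNgt; apply/negP => lr; move: sl; apply: resolvable_spectrum.
  have [->|l0] := eqVneq lambda 0; first exact (resolvable_zero csB sop sop' ss' s's).
  apply: (resolvable_inverse csB sop sop' ss' s's l0); apply: rres.
  rewrite cabsV -[r]invrK ltf_pV2// posrE//.
  by rewrite lt_def cabs_ge0 cabs_eq0 l0.
have rspec : [set complex.Re `|lambda| | lambda in spec] r^-1.
  exists r^-1%:C; first exact: eigen_spectrum.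
  by rewrite -/(cabs _) cabs_real gtr0_norm.
exists r^-1.
  apply/eqP; rewrite eq_le; apply/andP; split.
    by apply: ge_inf => //; exists r^-1 => _ [lambda sl <-]; exact: lb.
  by apply: lb_le_inf; [exists r^-1|move=> _ [lambda sl <-]; exact: lb].
split=> // q q0 /eigen_spectrum/lb.
by rewrite cabs_real gtr0_norm.
Qed.

End spectral_radii.

Local Open Scope cstar_scope.

Theorem corollary2p6 (R : realType) (A : cstarAlgType R)
    (alpha : R -> A -> A) (gamma : R[i] -> A -> A)
    (alpha_group : automorphism_group alpha)
    (alpha_periodic : periodic_2pi alpha)
    (alpha_gamma : induces_circle_action alpha gamma)
    (gamma_full : full_action gamma)
    (A0_tracial : exists tau, tracial_state (spectral_subspace gamma 0) tau)
    (n : nat) (x : 'I_n -> A)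
    (x_A1 : forall j, spectral_subspace gamma 1 (x j))
    (x_sum : \sum_(j < n) x j ** star (x j) = cone) :
  let A0 := spectral_subspace gamma 0 in
  let s' := dual_operator A0 x in
  let temps := inverse_temperatures alpha gamma in
  [/\ closed temps,
      temps `<=` `[ln (r_min A0 s'), ln (r_max A0 s')],
      temps (ln (r_min A0 s'))
    & temps (ln (r_max A0 s'))].
Proof.
move=> A0 s' temps.
have csA0 : closed_star_subalgebra (A := A) A0 := Sp0_closed alpha_group alpha_gamma.
(* Fullness enters here: elements of degree -1 provide the inverse of s'. *)
have [I [y [yk y1]]] := exists_unit_decomposition alpha_group alpha_gamma (-1) gamma_full.
have xop := compression_trace_op alpha_group alpha_gamma x_A1 x_sum.
have yop := compression_trace_op alpha_group alpha_gamma yk y1.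
have xy tau a := compression_inverse alpha_group alpha_gamma (tau := tau) (a := a) x_A1
  x_sum yk y1.
have x_A1' : forall j, spectral_subspace gamma (- -1) (x j) by rewrite opprK.
have yx tau a := compression_inverse alpha_group alpha_gamma (tau := tau) (a := a) yk
  y1 x_A1' x_sum.
have [g0 [g0t g0p g01]] := A0_tracial.
(* A tracial state is positive on squares of elements of A0; the root of a positive element of A0
   lies again in A0, thanks to [Cgen]. *)
have g0_positive : positive_trace (A := A) A0 g0.
  split=> // a a0 /exists_sqrt[u [pu uu Cu]].
  have u0 : A0 u by exact: (Cu _ csA0 a0).
  have : 0 <= g0 (adj u * u) by exact: g0p.
  by rewrite (pos_sa pu) uu.
have [rM rME [rM0 eM leM]] := r_max_eigenstate csA0 xop yop xy g0_positive g01.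
have [rm rmE [rm0 em lem]] := r_min_eigenstate csA0 xop yop xy yx g0_positive g01.
(* By conversion of [dual] with [dual_operator]. *)
have rMs : r_max A0 s' = rM := rME.
have rms : r_min A0 s' = rm := rmE.
have tempP beta := inverse_temperatureP alpha_group alpha_periodic alpha_gamma x_A1
  x_sum beta.
split.
- exact: (closed_inverse_temperatures alpha_group alpha_periodic alpha_gamma x_A1 x_sum).
- move=> beta /tempP eig; rewrite rMs rms /= in_itv /=.
  have e0 := expR_gt0 beta.
  rewrite -[beta]expRK !ler_ln ?posrE//.
  by rewrite lem// leM.
- by apply/tempP; rewrite rms lnK ?posrE.
- by apply/tempP; rewrite rMs lnK ?posrE.
Qed.
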